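(* Let $\Phi$ be a crystallographic root system of rank $r$ with Weyl group $W$, and let $\lambda_1,\ldots,\lambda_r$ be the fundamental weights of $\Phi$ (with respect to a fixed set of simple roots). Then the following identity holds in the fraction field of the group algebra of the weight lattice: $$\sum_{w\in W}\ \prod_{i=1}^r\frac{1}{1-\mathbf{e}^{w\lambda_i}}=E(\Phi).$$
   Context: The weight lattice is $\Lambda=\bigoplus_{i=1}^r\mathbb{Z}\lambda_i$; its group algebra $\mathbb{Z}[\Lambda]$ has $\mathbb{Z}$-basis $\{\mathbf{e}^x\}_{x\in\Lambda}$ with multiplication $\mathbf{e}^x\mathbf{e}^y=\mathbf{e}^{x+y}$. $E(\Phi)$ is the product of the exponents $e_1,\ldots,e_r$ of the Weyl group $W$. *)

(* Defs.v *)
From HB Require Import structures.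
From mathcomp Require Import all_boot all_order all_algebra finmap.
From mathcomp Require Import boolp classical_sets functions cardinality fsbigop.
From mathcomp Require Import reals.
From mathcomp Require monalg mpoly.

Set Implicit Arguments.
Unset Strict Implicit.
Unset Printing Implicit Defensive.

Import Order.TTheory GRing.Theory Num.Theory.
Local Open Scope ring_scope.

Module GroupAlgebra.
Import monalg.
Local Open Scope fset_scope.
Local Open Scope ring_scope.

(* monalg only provides the product of {malg R[K]} for monoids K without
   nontrivial units, hence the convolution product is redefined here. *)
Definition group_algebra (A : zmodType) : Type := {malg int[A]}.

HB.instance Definition _ (A : zmodType) := GRing.Zmodule.on (group_algebra A).

Definition gexp (A : zmodType) (x : A) : group_algebra A := << 1 *g x >>.

Section Ring.
Variable A : zmodType.
Implicit Types (p q : group_algebra A).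

Definition gmul p q : group_algebra A :=
  \sum_(x <- msupp p) \sum_(y <- msupp q) << p@_x * q@_y *g x + y >>.

Lemma gmulw (d1 d2 : {fset A}) p q : msupp p `<=` d1 -> msupp q `<=` d2 ->
  gmul p q = \sum_(x <- d1) \sum_(y <- d2) << p@_x * q@_y *g x + y >>.
Proof.
move=> le_d1 le_d2; rewrite /gmul (big_fset_incl _ le_d1) /=.
  apply/eq_bigr=> k1 _; apply/big_fset_incl => // k _ /mcoeff_outdom ->.
  by rewrite mulr0 monalgU0.
move=> k _ /mcoeff_outdom g1k.
by rewrite big1 => // k' _; rewrite g1k mul0r monalgU0.
Qed.

Lemma gmulC : commutative gmul.
Proof.
move=> p q; rewrite /gmul exchange_big; apply: eq_bigr => x _.
by apply: eq_bigr => y _; rewrite mulrC addrC.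
Qed.

Lemma gmulUU (c1 c2 : int) (x y : A) :
  gmul << c1 *g x >> << c2 *g y >> = << c1 * c2 *g x + y >>.
Proof. by rewrite (gmulw msuppU_le msuppU_le) !big_seq_fset1 !mcoeffUU. Qed.

Lemma gmulDl : left_distributive gmul +%R.
Proof.
move=> p1 p2 q.
rewrite (gmulw (msuppD_le p1 p2) (fsubset_refl _)).
rewrite (gmulw (fsubsetUl _ (msupp p2)) (fsubset_refl _)).
rewrite (gmulw (fsubsetUr (msupp p1) _) (fsubset_refl _)).
rewrite -big_split /=; apply/eq_bigr=> x _.
rewrite -big_split /=; apply/eq_bigr=> y _.
by rewrite mcoeffD mulrDl monalgUD.
Qed.

Lemma gmulDr : right_distributive gmul +%R.
Proof. by move=> p q1 q2; rewrite gmulC gmulDl !(gmulC p). Qed.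

Lemma gmul0g : left_zero 0 gmul.
Proof. by move=> p; rewrite /gmul msupp0 big_seq_fset0. Qed.

Lemma gmulg0 : right_zero 0 gmul.
Proof. by move=> p; rewrite gmulC gmul0g. Qed.

Lemma gmul_suml (s : seq A) (F : A -> group_algebra A) q :
  gmul (\sum_(x <- s) F x) q = \sum_(x <- s) gmul (F x) q.
Proof. exact: (big_morph (gmul^~ q) (fun _ _ => gmulDl _ _ _) (gmul0g _)). Qed.

Lemma gmul_sumr (s : seq A) (F : A -> group_algebra A) p :
  gmul p (\sum_(x <- s) F x) = \sum_(x <- s) gmul p (F x).
Proof. exact: (big_morph (gmul p) (fun _ _ => gmulDr _ _ _) (gmulg0 _)). Qed.

Lemma gmulA : associative gmul.
Proof.
move=> p q r; rewrite (monalgE p) (monalgE q) (monalgE r).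
rewrite [LHS]gmul_suml [X in _ = gmul X _]gmul_suml [RHS]gmul_suml.
apply: eq_bigr => x _.
rewrite [X in gmul _ X = _]gmul_suml [LHS]gmul_sumr.
rewrite [X in _ = gmul X _]gmul_sumr [RHS]gmul_suml; apply: eq_bigr => y _.
rewrite [X in gmul _ X = _]gmul_sumr [LHS]gmul_sumr [RHS]gmul_sumr.
apply: eq_bigr => z _.
by rewrite !gmulUU mulrA addrA.
Qed.

Lemma gmul1g : left_id (gexp 0) gmul.
Proof.
move=> p; rewrite {1}(monalgE p) gmul_sumr [RHS]monalgE.
by apply: eq_bigr => x _; rewrite gmulUU mul1r add0r.
Qed.

Lemma gexp0_neq0 : gexp (0 : A) != 0.
Proof. by apply/eqP/malgP=> /(_ 0) /eqP; rewrite !mcoeffsE. Qed.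

HB.instance Definition _ := GRing.Zmodule_isComNzRing.Build (group_algebra A)
  gmulA gmulC gmul1g gmulDl gexp0_neq0.

Lemma gexpD (x y : A) : gexp (x + y) = gexp x * gexp y.
Proof. by rewrite [RHS]gmulUU mulr1. Qed.

Lemma mcoeffM p q (k : A) : (p * q : group_algebra A)@_k =
  \sum_(x <- msupp p) \sum_(y <- msupp q) p@_x * q@_y *+ (x + y == k).
Proof.
rewrite raddf_sum /=; apply/eq_bigr=> x _; rewrite raddf_sum /=.
by apply/eq_bigr=> y _; rewrite mcoeffU.
Qed.

End Ring.

Section Domain.
Variable r : nat.
Notation L := 'rV[int]_r.
Implicit Types (p q : group_algebra L).

Definition height (N : int) (x : L) : int := (rVpoly x).[N].

Lemma heightD N x y : height N (x + y) = height N x + height N y.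
Proof. by rewrite /height linearD hornerD. Qed.

Lemma height0 N : height N 0 = 0.
Proof. by rewrite /height linear0 horner0. Qed.

Lemma nonroot_int (P : {poly int}) : P != 0 -> exists N : int, P.[N] != 0.
Proof.
move=> P0; pose s := [seq (i%:Z) | i <- iota 0 (size P)].
case: (boolP (all (root P) s)) => [ar|].
  have us : uniq s by rewrite map_inj_uniq ?iota_uniq // => i j [].
  by have := max_poly_roots P0 ar us; rewrite size_map size_iota ltnn.
by move=> /allPn[N _ NP]; exists N.
Qed.

Lemma height_inj (s : seq L) : exists N, {in s &, injective (height N)}.
Proof.
pose P := \prod_(z <- [seq x - y | x <- s, y <- s] | z != 0) rVpoly z.
have /nonroot_int[N PN] : P != 0.
  rewrite prodf_seq_neq0; apply/allP => z _; apply/implyP.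
  by apply: contra => /eqP z0; rewrite -(rVpolyK z) z0 linear0.
exists N => x y xs ys xy; apply/eqP; rewrite -subr_eq0; apply/negPn/negP => xy0.
move: PN; rewrite horner_prod prodf_seq_neq0 => /allP/(_ (x - y)).
have -> : x - y \in [seq x' - y' | x' <- s, y' <- s].
  by apply/allpairsP; exists (x, y).
move=> /(_ isT); rewrite xy0 /= linearB hornerD hornerN.
by move: xy; rewrite /height => ->; rewrite subrr eqxx.
Qed.

(* sg = true selects the highest and sg = false the lowest element *)
Lemma height_max (N : int) (sg : bool) (s : seq L) : s != [::] ->
  exists2 x, x \in s &
    forall y, y \in s -> (-1) ^+ sg * height N x <= (-1) ^+ sg * height N y.
Proof.
elim: s => // a s IH _; case: (eqVneq s [::]) => [->|/IH[x xs xP]].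
  by exists a; rewrite ?mem_head // => y; rewrite inE => /eqP ->.
have [le|/ltW le] := lerP ((-1) ^+ sg * height N a) ((-1) ^+ sg * height N x).
  exists a; rewrite ?mem_head // => y; rewrite inE => /predU1P[->//|/xP].
  exact: le_trans.
by exists x; rewrite ?inE ?xs ?orbT // => y; rewrite inE => /predU1P[->//|/xP].
Qed.

Lemma msupp_seq_neq0 p : p != 0 -> (msupp p : seq L) != [::].
Proof.
apply: contra => /eqP E; apply/eqP; rewrite (monalgE p) E; exact: big_nil.
Qed.

Lemma extremal p q : p != 0 -> q != 0 -> exists N,
  [/\ {in msupp p &, injective (height N)},
      {in msupp q &, injective (height N)} &
   forall sg : bool, exists x y, [/\ x \in msupp p, y \in msupp q,
    forall z, z \in msupp p ->
      (-1) ^+ sg * height N x <= (-1) ^+ sg * height N z,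
    forall z, z \in msupp q ->
      (-1) ^+ sg * height N y <= (-1) ^+ sg * height N z &
    (p * q : group_algebra L)@_(x + y) = p@_x * q@_y]].
Proof.
move=> p0 q0; have [N Ninj] := height_inj (msupp p ++ msupp q).
have ip : {in msupp p &, injective (height N)}.
  by move=> x y xp yp; apply: Ninj; rewrite mem_cat ?xp ?yp.
have iq : {in msupp q &, injective (height N)}.
  by move=> x y xp yp; apply: Ninj; rewrite mem_cat ?xp ?yp orbT.
exists N; split=> // sg.
have [x xp xP] := height_max N sg (msupp_seq_neq0 p0).
have [y yq yP] := height_max N sg (msupp_seq_neq0 q0).
exists x, y; split=> //.
have key x' y' : x' \in msupp p -> y' \in msupp q -> x' + y' = x + y ->
    x' = x /\ y' = y.
  move=> x'p y'q /(congr1 (height N)); rewrite !heightD => E.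
  have h : height N x' = height N x.
    move: (xP _ x'p) (yP _ y'q) E; case: (sg); rewrite ?mul1r ?mulN1r ?lerN2.
      move=> h1 h2 E; apply/eqP; rewrite eq_le h1 /=.
      by rewrite -(lerD2r (height N y')) E lerD2l.
    move=> h1 h2 E; apply/eqP; rewrite eq_le h1 andbT.
    by rewrite -(lerD2r (height N y')) E lerD2l.
  split; first exact: ip.
  by apply: iq => //; apply: (addrI (height N x)); rewrite -E h.
rewrite mcoeffM (big_fsetD1 x) //= [X in _ + X]big1_fset ?addr0; last first.
  move=> x' /fsetD1P[x'x x'p] _; apply: big1_fset => y' y'q _.
  by case: eqP => // /key[]// E _; rewrite E eqxx in x'x.
rewrite (big_fsetD1 y) //= [X in _ + X]big1_fset ?eqxx ?addr0 //.
move=> y' /fsetD1P[y'y y'q] _.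
by case: eqP => // /key[]// _ E; rewrite E eqxx in y'y.
Qed.

(* The units of Z[L] are the monomials c e^x with c = 1 or -1. *)
Definition gunit : pred (group_algebra L) := fun p =>
  (#|` msupp p| == 1)%N && all (fun x => p@_x \is a GRing.unit) (msupp p).

Definition ginv p : group_algebra L :=
  if gunit p then \sum_(x <- msupp p) << (p@_x)^-1 *g - x >> else p.

Lemma gmulVg : {in gunit, left_inverse 1 ginv *%R}.
Proof.
move=> p pu; have pu' : gunit p by [].
rewrite /ginv pu'; move: pu' => /andP[/cardfs1P[x px]].
rewrite px big_seq_fset1.
move=> /allP/(_ x); rewrite inE eqxx => /(_ isT) xu.
rewrite {2}(monalgE p) px big_seq_fset1 [LHS]gmulUU mulVr //.
by rewrite addNr.
Qed.

Lemma gunitPl p q : q * p = 1 -> gunit p.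
Proof.
move=> qp; have [p0 q0] : p != 0 /\ q != 0.
  split; apply/eqP => E; move: qp; rewrite E ?mulr0 ?mul0r => /eqP;
    by rewrite eq_sym oner_eq0.
have [N [iq ip /[dup]/(_ false) + /(_ true)]] := extremal q0 p0.
move=> [x [y [xq yp xP yP]]] + [x' [y' [x'q y'p x'P y'P]]]; rewrite qp.
have c1 (k : L) : (1 : group_algebra L)@_k = (0 == k)%:R by rewrite mcoeffU.
have nz z z' : z \in msupp q -> z' \in msupp p -> q@_z * p@_z' != 0.
  by rewrite -!mcoeff_neq0 => *; rewrite mulf_neq0.
rewrite !c1; case: eqP => [xy0 e|_ /esym/eqP]; last first.
  by rewrite (negbTE (nz _ _ xq yp)).
case: eqP => [x'y'0 e'|_ /esym/eqP]; last by rewrite (negbTE (nz _ _ x'q y'p)).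
have hh : height N x' = height N x.
  have := xP _ x'q; have := yP _ y'p.
  have := congr1 (height N) xy0; have := congr1 (height N) x'y'0.
  rewrite !heightD height0 !expr0 !mul1r => /eqP.
  rewrite eq_sym addrC addr_eq0 => /eqP -> /eqP.
  rewrite eq_sym addrC addr_eq0 => /eqP ->; rewrite lerN2 => h1 h2.
  by apply/eqP; rewrite eq_le h1.
have Ex : x' = x by exact: iq.
have Ey : y' = y by apply: (addrI x); rewrite -xy0 -{1}Ex.
have py : msupp p = [fset y].
  apply/fsetP => z; rewrite inE; apply/idP/eqP => [zp|-> //].
  apply: ip => //; apply/eqP; rewrite eq_le.
  have := yP _ zp; have := y'P _ zp; rewrite Ey expr0 expr1 !mul1r !mulN1r lerN2.
  by move=> -> ->.
apply/andP; split; first by rewrite py cardfs1.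
rewrite py; apply/allP => z; rewrite inE => /eqP ->.
by apply/unitrPr; exists (q@_x); rewrite mulrC -e.
Qed.

Lemma ginv_out : {in [predC gunit], ginv =1 id}.
Proof. by move=> p pu; rewrite /ginv ifN. Qed.

HB.instance Definition _ := GRing.ComNzRing_hasMulInverse.Build
  (group_algebra L) gmulVg gunitPl ginv_out.

Lemma gmul_eq0 p q : p * q = 0 -> (p == 0) || (q == 0).
Proof.
move=> pq; apply/norP => -[p0 q0].
have [N [_ _ /(_ true)[x [y [xp yq _ _]]]]] := extremal p0 q0.
rewrite pq mcoeff0 => /esym/eqP; rewrite mulf_eq0 !mcoeff_eq0.
by rewrite xp yq.
Qed.

HB.instance Definition _ := GRing.ComUnitRing_isIntegral.Build
  (group_algebra L) gmul_eq0.

End Domain.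
End GroupAlgebra.
Export GroupAlgebra(group_algebra, gexp).
HB.export GroupAlgebra.

Section RootSystem.
Variables (R : realType) (r : nat).
Notation V := 'cV[R]_r.
Implicit Types (Phi : {fset V}) (Delta lambda : 'I_r -> V).

Definition dot (u v : V) : R := \sum_i u i 0 * v i 0.

(* <u, a^vee>, where a^vee = 2 a / (a, a) *)
Definition pairing (u a : V) : R := 2 * dot u a / dot a a.

(* The matrix of v |-> v - <v, a^vee> a *)
Definition reflection (a : V) : 'M[R]_r := 1%:M - (2 / dot a a) *: (a *m a^T).

Record crystallographic_root_system Phi : Prop := {
  roots_span : (<<enum_fset Phi>> = fullv)%VS;
  roots_neq0 : 0 \notin Phi;
  roots_reduced : forall (a : V) (c : R),
    a \in Phi -> c *: a \in Phi -> c = 1 \/ c = -1;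
  roots_reflection : forall a b : V,
    a \in Phi -> b \in Phi -> reflection a *m b \in Phi;
  roots_integral : forall a b : V,
    a \in Phi -> b \in Phi -> pairing b a \is a Num.int
}.

Record simple_roots Phi Delta : Prop := {
  simple_in : forall i, Delta i \in Phi;
  simple_basis : basis_of fullv [seq Delta i | i <- enum 'I_r];
  simple_sign : forall b : V, b \in Phi -> exists c : 'I_r -> nat,
    b = \sum_i Delta i *+ c i \/ b = - \sum_i Delta i *+ c i
}.

Definition fundamental_weights Delta lambda : Prop :=
  forall i j, pairing (lambda i) (Delta j) = (i == j)%:R.

(* Reflections are involutions, so products of reflections form a group.  It is
   finite, since it acts faithfully on Phi; a finitely supported sum over this
   set is therefore the ordinary sum over the group. *)
Definition weyl_group Phi : set 'M[R]_r :=
  [set w | exists2 s : seq V, {subset s <= Phi} &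
    w = \big[mulmx/1%:M]_(a <- s) reflection a]%classic.

(* The weight lattice is the free abelian group 'rV[int]_r on lambda_1, ...,
   lambda_r. By duality the lambda_j-coordinate of x is <x, alpha_j^vee>; it is
   an integer when x is in the lattice, in particular on the Weyl orbit of a
   fundamental weight, so that the floor below is not a truncation there. *)
Definition weight_coord Delta (x : V) : 'rV[int]_r :=
  \row_j Num.floor (pairing x (Delta j)).

Lemma weight_coordK Delta lambda (c : 'rV[int]_r) :
  fundamental_weights Delta lambda ->
  weight_coord Delta (\sum_i (c 0 i)%:~R *: lambda i) = c.
Proof.
move=> fw; apply/rowP => j; rewrite mxE.
suff -> : pairing (\sum_i (c 0 i)%:~R *: lambda i) (Delta j) = (c 0 j)%:~R.
  by rewrite intrKfloor.
have pairingE (u a : V) : pairing u a = \sum_k u k 0 * (2 * a k 0 / dot a a).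
  rewrite /pairing mulr_sumr mulr_suml; apply: eq_bigr => k _.
  by rewrite mulrCA !mulrA.
rewrite pairingE.
under eq_bigr do rewrite summxE mulr_suml.
rewrite exchange_big /= (bigD1 j) //= [X in _ + X]big1 ?addr0 => [|i ij].
  under eq_bigr do rewrite mxE -(mulrA (c 0 _)%:~R).
  by rewrite -mulr_sumr -pairingE fw eqxx mulr1.
under eq_bigr do rewrite mxE -(mulrA (c 0 _)%:~R).
by rewrite -mulr_sumr -pairingE fw (negbTE ij) mulr0.
Qed.

End RootSystem.

Notation weight_algebra r := (group_algebra 'rV[int]_r).

Definition weight_exp (R : realType) (r : nat) (Delta : 'I_r -> 'cV[R]_r)
  (x : 'cV[R]_r) : weight_algebra r := gexp (weight_coord Delta x).

Module Exponents.
Import mpoly.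

Section Exponents.
Variables (R : realType) (r : nat).

(* The polynomial function v |-> f (w v) *)
Definition mpoly_act (w : 'M[R]_r) (f : {mpoly R[r]}) : {mpoly R[r]} :=
  f \mPo [tuple \sum_j w i j *: 'X_j | i < r].

Definition invariant (Phi : {fset 'cV[R]_r}) (f : {mpoly R[r]}) : Prop :=
  forall w, weyl_group Phi w -> mpoly_act w f = f.

(* The exponents are the degrees of the basic polynomial invariants, minus 1;
   they exist by Chevalley's theorem and are unique up to order.  This form of
   the definition also covers reducible root systems. *)
Definition exponents (Phi : {fset 'cV[R]_r}) (e : 'I_r -> nat) : Prop :=
  exists f : r.-tuple {mpoly R[r]},
  [/\ forall i, tnth f i \is (e i).+1.-homog,
      forall i, invariant Phi (tnth f i),
      forall p : {mpoly R[r]}, p \mPo f = 0 -> p = 0 &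
      forall g : {mpoly R[r]}, invariant Phi g ->
        exists p : {mpoly R[r]}, g = p \mPo f].

End Exponents.
End Exponents.
Export Exponents(exponents).

(* Main.v *)
From HB Require Import structures.
From mathcomp Require Import all_boot all_order all_algebra finmap.
From mathcomp Require Import boolp classical_sets fsbigop.
From mathcomp Require Import reals ring zify.
Require Import Defs.
Set Implicit Arguments.
Unset Strict Implicit.
Unset Printing Implicit Defensive.
Import Order.TTheory GRing.Theory Num.Theory.
Local Open Scope ring_scope.

(** Let S be the sum over the Weyl group W on the left hand side.  The proof
    shows that S is the number of elements of W that fix no nonzero vector, and
    that this number is the product of the exponents.

    For the first claim, let the group algebra act by convolution on all integer
    functions on the weight lattice.  The product of the 1 - e^(w lambda_i) sends
    the characteristic function of the closed chamber of w to the characteristic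
    function of 0.  It is a composite of differences in the directions
    w lambda_i, so the same holds for the product over i of
    [<x, w alpha_i^vee> >= 0] - b_i with arbitrary constants b_i
    ([conv_chamber]).  If for some choice of the constants these functions add
    up to n times the characteristic function of 0, then S = n ([chamber_sum]).
    Fix a generic vector xi, and let b_i be 1 or 0 according to whether the i-th
    coordinate of w^-1 xi in the basis of simple roots is negative.  For a
    parabolic subgroup W_J the corresponding sum is the number of elements of
    W_J with the smallest possible fixed space if x is orthogonal to the roots
    in J, and 0 otherwise ([signed_countE]).  This is proved by induction on J:
    the sum of these expressions over the subsets K of J, suitably weighted,
    counts the w in W_J that make x dominant ([signed_sum], which rests on the
    fact that a linear complementarity problem has exactly one solution), that
    is, the elements of the stabilizer of x ([dominant_count]).  On the other
    hand, the elements of the stabilizer can be sorted by their fixed spaces: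
    for generic xi each of them is conjugate in an essentially unique way to an
    element with the smallest possible fixed space in some W_K, in such a way
    that xi meets the condition by which K is weighted
    ([full_conjugate_unique], [full_count]).

    For the second claim, let f_1, ..., f_r be basic invariants of degrees
    e_i + 1 and v a generic vector, and let g_i(y) = f_i(y + v) - f_i(y), a
    polynomial of degree at most e_i.  Since invariants separate orbits, the
    common zeros of the g_i are the solutions y of w y = y + v for some w in W.
    For generic v there is exactly one for each w without fixed vectors and
    none for the other w ([good_displacement]).  By Bezout's theorem their
    number is the product of the e_i, if the zeros are simple, if there is none
    at infinity, and if every polynomial that vanishes on them lies in the ideal
    of the g_i.  Over the real numbers these conditions follow from explicit
    elements of the ideal: if mu runs through an orbit, then the product of the
    X - mu has invariant coefficients, whence the product over nu <> mu of
    <mu - nu, y> + <mu, v> lies in the ideal, and the same product without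
    <mu, v> lies in the ideal of the leading forms ([orbit_relation]).  Hence
    both ideals contain products of maximal ideals of real points
    ([orbit_points]).  The zeros are simple, because an invariant polynomial may
    have any differential at a point with trivial stabilizer ([cotangent]).
    Bezout's theorem itself ([bezout]) is proved by comparing dimensions: if
    c_z is 1 at the zero z and 0 at the other ones, then the products of the
    c_z with monomials in the g_i are linearly independent, and they generate
    all polynomials up to terms of lower order. *)

(** * Euclidean vectors and finite groups of orthogonal matrices *)

Section Dot.
Variables (R : realType) (r : nat).
Implicit Types (u v x y : 'cV[R]_r) (w : 'M[R]_r).

Lemma dotE u v : dot u v = (u^T *m v) 0 0.
Proof. by rewrite mxE; apply: eq_bigr => i _; rewrite mxE. Qed.

Lemma dotC u v : dot u v = dot v u.
Proof. by apply: eq_bigr => i _; rewrite mulrC. Qed.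

Lemma dotDr u v x : dot u (v + x) = dot u v + dot u x.
Proof. by rewrite !dotE mulmxDr mxE. Qed.

Lemma dotZr c u v : dot u (c *: v) = c * dot u v.
Proof. by rewrite !dotE -scalemxAr mxE. Qed.

Lemma dotDl u v x : dot (u + v) x = dot u x + dot v x.
Proof. by rewrite dotC dotDr !(dotC x). Qed.

Lemma dotZl c u v : dot (c *: u) v = c * dot u v.
Proof. by rewrite dotC dotZr dotC. Qed.

Lemma dotNr u v : dot u (- v) = - dot u v.
Proof. by rewrite -scaleN1r dotZr mulN1r. Qed.

Lemma dotNl u v : dot (- u) v = - dot u v.
Proof. by rewrite dotC dotNr dotC. Qed.

Lemma dotBr u v x : dot u (v - x) = dot u v - dot u x.
Proof. by rewrite dotDr dotNr. Qed.

Lemma dotBl u v x : dot (u - v) x = dot u x - dot v x.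
Proof. by rewrite dotDl dotNl. Qed.

Lemma dot0r u : dot u 0 = 0.
Proof. by rewrite -(scale0r 0) dotZr mul0r. Qed.

Lemma dot0l u : dot 0 u = 0.
Proof. by rewrite dotC dot0r. Qed.

Lemma dot_sumr (I : Type) (s : seq I) (P : pred I) (F : I -> 'cV[R]_r) u :
  dot u (\sum_(i <- s | P i) F i) = \sum_(i <- s | P i) dot u (F i).
Proof. exact: (big_morph (dot u) (dotDr u) (dot0r u)). Qed.

Lemma dot_suml (I : Type) (s : seq I) (P : pred I) (F : I -> 'cV[R]_r) u :
  dot (\sum_(i <- s | P i) F i) u = \sum_(i <- s | P i) dot (F i) u.
Proof. by rewrite dotC dot_sumr; apply: eq_bigr => i _; rewrite dotC. Qed.

Lemma dot_ge0 u : 0 <= dot u u.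
Proof. by apply: sumr_ge0 => i _; rewrite -expr2 sqr_ge0. Qed.

Lemma dot_eq0 u : dot u u = 0 -> u = 0.
Proof.
move=> /eqP; rewrite psumr_eq0; last by move=> i _; rewrite -expr2 sqr_ge0.
move=> /allP h; apply/colP => i; rewrite mxE.
have := h i (mem_index_enum i); rewrite /= -expr2 sqrf_eq0.
by move/eqP.
Qed.

Lemma dot_le0 u : dot u u <= 0 -> u = 0.
Proof. by move=> h; apply: dot_eq0; apply/eqP; rewrite eq_le h dot_ge0. Qed.

Lemma dot_gt0 u : u != 0 -> 0 < dot u u.
Proof. by rewrite lt_def dot_ge0 andbT; apply: contra => /eqP /dot_eq0 ->. Qed.

Lemma dot_neq0 u : u != 0 -> dot u u != 0.
Proof. by move/dot_gt0; rewrite lt0r => /andP[]. Qed.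

Lemma dot_mull w u v : dot (w *m u) v = dot u (w^T *m v).
Proof. by rewrite !dotE trmx_mul mulmxA. Qed.

Lemma dot_orth w u v : w^T *m w = 1%:M -> dot (w *m u) (w *m v) = dot u v.
Proof. by move=> h; rewrite dot_mull mulmxA h mul1mx. Qed.

(** For a generic N the vector (1, N, N^2, ...) works: the product of the
    polynomials attached to the given vectors has only finitely many roots. *)
Lemma generic_vector (s : seq 'cV[R]_r) :
  exists v, forall u, u \in s -> u != 0 -> dot u v != 0.
Proof.
pose P := \prod_(u <- s | u != 0) rVpoly u^T.
have P0 : P != 0.
  rewrite prodf_seq_neq0; apply/allP => u _; apply/implyP.
  apply: contra => /eqP h; rewrite -(trmxK u) -(rVpolyK u^T) h.
  by rewrite linear0 trmx0.
have [N PN] : exists N : R, P.[N] != 0.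
  pose t := [seq (i%:R : R) | i <- iota 0 (size P)].
  case: (boolP (all (root P) t)) => [ar|/allPn[N _ NP]]; last by exists N.
  have ut : uniq t by rewrite map_inj_uniq ?iota_uniq // => i j /eqP; rewrite eqr_nat => /eqP.
  by have := max_poly_roots P0 ar ut; rewrite size_map size_iota ltnn.
exists (\col_i N ^+ i) => u us u0; move: PN; rewrite horner_prod prodf_seq_neq0.
move=> /allP/(_ u us)/implyP/(_ u0); rewrite horner_poly.
rewrite [dot _ _](_ : _ = \sum_(i < r) u i 0 * N ^+ i); last first.
  by apply: eq_bigr => i _; rewrite mxE.
by under eq_bigr do rewrite valK mxE.
Qed.

End Dot.

Lemma seq_argmax (R : realDomainType) (T : eqType) (f : T -> R) (s : seq T) :
  s != [::] -> exists2 x, x \in s & forall y, y \in s -> f y <= f x.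
Proof.
elim: s => // a s IH _; case: (eqVneq s [::]) => [->|/IH[x xs xP]].
  by exists a; rewrite ?mem_head // => y; rewrite inE => /eqP ->.
have [le|/ltW le] := lerP (f x) (f a).
  exists a; rewrite ?mem_head // => y; rewrite inE => /predU1P[->//|/xP h].
  exact: le_trans h le.
by exists x; rewrite ?inE ?xs ?orbT // => y; rewrite inE => /predU1P[->//|/xP].
Qed.

Section MatrixGroup.
Variables (R : realType) (r : nat).
Implicit Types (H : seq 'M[R]_r) (u w : 'M[R]_r).

(** The transpose serves as the inverse.  The group is a list, so that it can be
    the index of sums and counts. *)
Record orth_group H : Prop := {
  og_uniq : uniq H;
  og_1 : 1%:M \in H;
  og_mul : forall u w, u \in H -> w \in H -> u *m w \in H;
  og_tr : forall w, w \in H -> w^T \in H;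
  og_trK : forall w, w \in H -> w^T *m w = 1%:M
}.

Lemma og_trKr H w : orth_group H -> w \in H -> w *m w^T = 1%:M.
Proof. by move=> gH wH; apply: mulmx1C; apply: og_trK wH. Qed.

Lemma og_trKV H u w : orth_group H -> u \in H -> (w *m u) *m u^T = w.
Proof. by move=> gH uH; rewrite -mulmxA (og_trKr gH uH) mulmx1. Qed.

Lemma og_trVK H u w : orth_group H -> u \in H -> (w *m u^T) *m u = w.
Proof. by move=> gH uH; rewrite -mulmxA (og_trK gH uH) mulmx1. Qed.

Lemma og_trKl H u m (w : 'M[R]_(r, m)) : orth_group H -> u \in H ->
  u^T *m (u *m w) = w.
Proof. by move=> gH uH; rewrite mulmxA (og_trK gH uH) mul1mx. Qed.

Lemma og_trVl H u m (w : 'M[R]_(r, m)) : orth_group H -> u \in H ->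
  u *m (u^T *m w) = w.
Proof. by move=> gH uH; rewrite mulmxA (og_trKr gH uH) mul1mx. Qed.

Lemma og_perm_mulr H u : orth_group H -> u \in H ->
  perm_eq [seq w *m u | w <- H] H.
Proof.
move=> gH uH; apply: uniq_perm; rewrite ?(og_uniq gH) //.
  rewrite map_inj_uniq ?(og_uniq gH) // => w w' /(congr1 (mulmx^~ u^T)).
  by rewrite !(og_trKV _ gH uH).
move=> w; apply/mapP/idP => [[w' w'H ->]|wH]; first exact: og_mul.
exists (w *m u^T); last by rewrite (og_trVK _ gH uH).
by apply: og_mul => //; apply: og_tr.
Qed.

Lemma og_perm_tr H : orth_group H -> perm_eq [seq w^T | w <- H] H.
Proof.
move=> gH; apply: uniq_perm; rewrite ?(og_uniq gH) //.
  by rewrite map_inj_uniq ?(og_uniq gH) //; apply: (can_inj (@trmxK _ _ _)).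
move=> w; apply/mapP/idP => [[w' w'H ->]|wH]; first exact: og_tr.
by exists w^T; [exact: og_tr | rewrite trmxK].
Qed.

Lemma og_sum_mulr H u (V : nmodType) (F : 'M[R]_r -> V) :
  orth_group H -> u \in H -> \sum_(w <- H) F (w *m u) = \sum_(w <- H) F w.
Proof.
by move=> gH uH; rewrite -[RHS](perm_big _ (og_perm_mulr gH uH)) big_map.
Qed.

Lemma og_sum_tr H (V : nmodType) (F : 'M[R]_r -> V) :
  orth_group H -> \sum_(w <- H) F w^T = \sum_(w <- H) F w.
Proof. by move=> gH; rewrite -[RHS](perm_big _ (og_perm_tr gH)) big_map. Qed.

Lemma og_sum_mull H u (V : nmodType) (F : 'M[R]_r -> V) :
  orth_group H -> u \in H -> \sum_(w <- H) F (u *m w) = \sum_(w <- H) F w.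
Proof.
move=> gH uH; rewrite -(og_sum_tr (fun w => F (u *m w))) // -[RHS]og_sum_tr //.
rewrite -[RHS](og_sum_mulr (u := u^T)) ?(og_tr gH uH) //.
by apply: eq_bigr => w _; rewrite trmx_mul trmxK.
Qed.

(** Averaging over the elements that fix every vector fixed by w gives the
    orthogonal projection onto the fixed space of w. *)
Lemma fixed_projection H w : orth_group H -> w \in H -> exists P : 'M[R]_r,
  [/\ w *m P = P, P^T = P & forall v : 'cV_r, w *m v = v -> P *m v = v].
Proof.
move=> gH wH.
pose fx u := `[< forall v : 'cV_r, w *m v = v -> u *m v = v >].
pose K := filter fx H.
have KP u : u \in K = (fx u) && (u \in H) by rewrite mem_filter.
have gK : orth_group K.
  split; first by rewrite filter_uniq ?(og_uniq gH).
  - by rewrite KP (og_1 gH) andbT; apply/asboolP => v _; rewrite mul1mx.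
  - move=> u u'; rewrite !KP => /andP[/asboolP h uH] /andP[/asboolP h' u'H].
    rewrite (og_mul gH) // andbT; apply/asboolP => v wv.
    by rewrite -mulmxA h' // h.
  - move=> u; rewrite !KP => /andP[/asboolP h uH]; rewrite (og_tr gH) // andbT.
    by apply/asboolP => v wv; rewrite -{1}(h v wv) (og_trKl _ gH).
  - by move=> u; rewrite KP => /andP[_]; apply: og_trK.
have wK : w \in K by rewrite KP wH andbT; apply/asboolP.
have nK : (size K)%:R != 0 :> R.
  by rewrite pnatr_eq0 -lt0n; case: (K) (og_1 gK).
exists ((size K)%:R^-1 *: \sum_(u <- K) u); split.
- by rewrite -scalemxAr mulmx_sumr (og_sum_mull id gK wK).
- by rewrite linearZ /= linear_sum /= (og_sum_tr id gK).
move=> v wv; rewrite -scalemxAl mulmx_suml.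
have -> : \sum_(u <- K) u *m v = (size K)%:R *: v.
  rewrite (eq_big_seq (fun=> v)) => [|u]; last first.
    by rewrite KP => /andP[/asboolP h _]; apply: h.
  by rewrite big_const_seq count_predT scaler_nat -Monoid.iteropE.
by rewrite scalerA mulVf // scale1r.
Qed.

End MatrixGroup.

(** * Root systems and parabolic subgroups *)

Section Reflections.
Variables (R : realType) (r : nat).
Implicit Types (a v : 'cV[R]_r) (w : 'M[R]_r).

Lemma reflE a v : reflection a *m v = v - pairing v a *: a.
Proof.
rewrite /reflection mulmxBl mul1mx -scalemxAl -mulmxA; congr (_ - _).
rewrite (_ : a^T *m v = (dot v a)%:M); last first.
  by apply/matrixP => i j; rewrite !ord1 [RHS]mxE mulr1n dotC dotE.
by rewrite mul_mx_scalar scalerA /pairing mulrAC.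
Qed.

Lemma refl_tr a : (reflection a)^T = reflection a.
Proof.
by rewrite /reflection linearB /= linearZ /= trmx1 trmx_mul trmxK.
Qed.

Lemma mx_ext w w' : (forall v : 'cV_r, w *m v = w' *m v) -> w = w'.
Proof.
move=> h; apply/matrixP => i j; move/colP/(_ i): (h (delta_mx j 0)).
by rewrite -!colE !mxE.
Qed.

Lemma refl_root a : a != 0 -> reflection a *m a = - a.
Proof.
move=> a0; rewrite reflE /pairing mulfK ?dot_neq0 // scaler_nat mulr2n.
by rewrite opprD addrA subrr add0r.
Qed.

Lemma reflK a : a != 0 -> reflection a *m reflection a = 1%:M.
Proof.
move=> a0; apply: mx_ext => v; rewrite -mulmxA mul1mx (reflE a v) mulmxBr.
by rewrite -scalemxAr refl_root // reflE scalerN opprK subrK.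
Qed.

Lemma refl_conj w a : w^T *m w = 1%:M ->
  reflection (w *m a) *m w = w *m reflection a.
Proof.
move=> wK; apply: mx_ext => v.
rewrite -!mulmxA !reflE mulmxBr -scalemxAr; congr (_ - _ *: _).
by rewrite /pairing !dot_orth.
Qed.

End Reflections.

Section RootSystem.
Variables (R : realType) (r : nat) (Phi : {fset 'cV[R]_r}).
Variables (Delta lambda : 'I_r -> 'cV[R]_r).
Hypothesis (Phi_root : crystallographic_root_system Phi).
Hypothesis (Delta_simple : simple_roots Phi Delta).
Hypothesis (lambda_weights : fundamental_weights Delta lambda).
Implicit Types (i j : 'I_r) (s : seq 'I_r) (J K : {set 'I_r}).
Implicit Types (a b v x y : 'cV[R]_r) (w u : 'M[R]_r).

Let V := 'cV[R]_r.

Lemma root_neq0 a : a \in Phi -> a != 0.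
Proof. by apply: contraL => /eqP ->; apply: roots_neq0 Phi_root. Qed.

Lemma Delta_neq0 i : Delta i != 0.
Proof. exact/root_neq0/(simple_in Delta_simple). Qed.

Lemma Delta_gt0 i : 0 < dot (Delta i) (Delta i).
Proof. exact/dot_gt0/Delta_neq0. Qed.

Lemma dot_lambda i j :
  dot (lambda i) (Delta j) = (i == j)%:R * (dot (Delta j) (Delta j) / 2).
Proof.
have := lambda_weights i j; rewrite /pairing => <-.
have := dot_neq0 (Delta_neq0 j); move: (dot _ _) (dot (lambda i) _) => d l d0.
by field.
Qed.

(** By duality with the fundamental weights, this is the coordinate of v on the
    simple root of index j. *)
Definition rcoord v j := 2 * dot (lambda j) v / dot (Delta j) (Delta j).

Lemma rcoordD v x j : rcoord (v + x) j = rcoord v j + rcoord x j.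
Proof. by rewrite /rcoord dotDr mulrDr mulrDl. Qed.

Lemma rcoordZ c v j : rcoord (c *: v) j = c * rcoord v j.
Proof. by rewrite /rcoord dotZr mulrCA -!mulrA. Qed.

Lemma rcoordN v j : rcoord (- v) j = - rcoord v j.
Proof. by rewrite -scaleN1r rcoordZ mulN1r. Qed.

Lemma rcoordB v x j : rcoord (v - x) j = rcoord v j - rcoord x j.
Proof. by rewrite rcoordD rcoordN. Qed.

Lemma rcoord0 j : rcoord 0 j = 0.
Proof. by rewrite -(scale0r 0) rcoordZ mul0r. Qed.

Lemma rcoord_Delta i j : rcoord (Delta i) j = (i == j)%:R.
Proof.
rewrite /rcoord dot_lambda (eq_sym j); case: eqP => [<-|]; last first.
  by rewrite mul0r mulr0 mul0r.
have := dot_neq0 (Delta_neq0 i); move: (dot _ _) => d d0 /=; by field.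
Qed.

Lemma rcoord_sum (I : Type) (t : seq I) (P : pred I) (F : I -> V) j :
  rcoord (\sum_(i <- t | P i) F i) j = \sum_(i <- t | P i) rcoord (F i) j.
Proof. by apply: (big_morph (rcoord^~ j)) => [v x|]; rewrite ?rcoordD ?rcoord0. Qed.

Lemma rcoordE v : v = \sum_j rcoord v j *: Delta j.
Proof.
have /andP[/eqP span_D _] := simple_basis Delta_simple.
have : v \in fullv by rewrite memvf.
rewrite -span_D => /(@coord_span _ _ _ (in_tuple _)) ->.
set X := in_tuple _; rewrite [LHS](eq_bigr
  (fun k => \sum_j rcoord (coord X k v *: X`_k) j *: Delta j)).
  rewrite exchange_big /=; apply: eq_bigr => j _.
  by rewrite rcoord_sum scaler_suml.
move=> k _; have /mapP[i _ ->] : X`_k \in [seq Delta i | i <- enum 'I_r].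
  by apply: mem_nth.
rewrite (bigD1 i) //= rcoordZ rcoord_Delta eqxx mulr1 big1 ?addr0 // => j ji.
by rewrite rcoordZ rcoord_Delta eq_sym (negbTE ji) mulr0 scale0r.
Qed.

Lemma rcoord_eq v x : (forall j, rcoord v j = rcoord x j) -> v = x.
Proof. by move=> h; rewrite (rcoordE v) (rcoordE x); under eq_bigr do rewrite h. Qed.

Definition positive b := forall j, 0 <= rcoord b j.

Lemma rcoord_natsum (c : 'I_r -> nat) j : rcoord (\sum_i Delta i *+ c i) j = (c j)%:R.
Proof.
rewrite rcoord_sum (bigD1 j) //= -scaler_nat rcoordZ rcoord_Delta eqxx mulr1.
rewrite big1 ?addr0 // => i ij.
by rewrite -scaler_nat rcoordZ rcoord_Delta (negbTE ij) mulr0.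
Qed.

Lemma root_sign b : b \in Phi -> positive b \/ positive (- b).
Proof.
move=> /(simple_sign Delta_simple)[c [->|->]]; [left|right] => j.
  by rewrite rcoord_natsum ler0n.
by rewrite opprK rcoord_natsum ler0n.
Qed.

Lemma positive_neg b : positive b -> positive (- b) -> b = 0.
Proof.
move=> p n; apply: rcoord_eq => j; rewrite rcoord0; apply/eqP.
by rewrite eq_le p andbT -oppr_ge0 -rcoordN n.
Qed.

Definition sr i := reflection (Delta i).

Lemma sr_mul i v : sr i *m v = v - pairing v (Delta i) *: Delta i.
Proof. exact: reflE. Qed.

Lemma rcoord_sr i j v : j != i -> rcoord (sr i *m v) j = rcoord v j.
Proof.
move=> ji; rewrite sr_mul rcoordB rcoordZ rcoord_Delta eq_sym (negbTE ji).
by rewrite mulr0 subr0.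
Qed.

Lemma sr_Delta i : sr i *m Delta i = - Delta i.
Proof. exact/refl_root/Delta_neq0. Qed.

Lemma srK i : sr i *m sr i = 1%:M.
Proof. exact/reflK/Delta_neq0. Qed.

Lemma sr_tr i : (sr i)^T = sr i. Proof. exact: refl_tr. Qed.

(** A simple reflection changes a single simple coordinate, so a positive root
    other than the simple root itself keeps a positive coordinate. *)
Lemma sr_positive i b : b \in Phi -> positive b -> b <> Delta i ->
  positive (sr i *m b).
Proof.
move=> bP pb bi.
have sP : sr i *m b \in Phi.
  by apply: (roots_reflection Phi_root) => //; apply: simple_in Delta_simple _.
case: (root_sign sP) => // neg; case: bi.
have z j : j != i -> rcoord b j = 0.
  move=> ji; apply/eqP; rewrite eq_le pb andbT -oppr_ge0.
  by have := neg j; rewrite rcoordN rcoord_sr.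
have Eb : b = rcoord b i *: Delta i.
  rewrite {1}(rcoordE b) (bigD1 i) //= big1 ?addr0 // => j ji.
  by rewrite z // scale0r.
have := bP; rewrite Eb.
move=> /(roots_reduced Phi_root (simple_in Delta_simple i))[->|E].
  by rewrite scale1r.
by have := pb i; rewrite E oppr_ge0 ler10.
Qed.

Definition wprod s := foldr (fun i w => sr i *m w) 1%:M s.

Lemma wprod_cat s t : wprod (s ++ t) = wprod s *m wprod t.
Proof. by elim: s => [|i s IH] /=; rewrite ?mul1mx // IH mulmxA. Qed.

Lemma wprod_rcons s i : wprod (rcons s i) = wprod s *m sr i.
Proof. by rewrite -cats1 wprod_cat /= mulmx1. Qed.

Lemma wprod_tr s : (wprod s)^T = wprod (rev s).
Proof.
elim: s => [|i s IH] /=; first by rewrite trmx1.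
by rewrite trmx_mul IH rev_cons wprod_rcons sr_tr.
Qed.

Lemma wprod_trK s : (wprod s)^T *m wprod s = 1%:M.
Proof.
elim: s => [|i s IH] /=; first by rewrite trmx1 mulmx1.
by rewrite trmx_mul mulmxA -(mulmxA _ (sr i)^T) sr_tr srK mulmx1.
Qed.

Lemma wprod_root s a : a \in Phi -> wprod s *m a \in Phi.
Proof.
move=> aP; elim: s => [|i s IH] /=; first by rewrite mul1mx.
by rewrite -mulmxA (roots_reflection Phi_root) // (simple_in Delta_simple).
Qed.

(** The deletion property: going through the word from the right, the root
    Delta i becomes negative at a letter k for which it has just become
    Delta k, and this letter can be dropped together with i. *)
Lemma deletion s i : positive (- (wprod s *m Delta i)) ->
  exists t, [/\ {subset t <= s}, (size t < size s)%N &
                wprod s *m sr i = wprod t].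
Proof.
elim: s => [|k s IH] /=.
  rewrite mul1mx => /(_ i); rewrite rcoordN rcoord_Delta eqxx oppr_ge0.
  by rewrite ler10.
have bP : wprod s *m Delta i \in Phi.
  by apply/wprod_root/(simple_in Delta_simple).
case: (root_sign bP) => [pb|/IH[t [ts sz E]]] neg; last first.
  exists (k :: t); split=> //; last by rewrite -mulmxA E.
  by move=> x; rewrite !inE => /orP[->//|/ts ->]; rewrite orbT.
have [bk|/eqP bk] := eqVneq (wprod s *m Delta i) (Delta k); last first.
  have := sr_positive bP pb bk; rewrite mulmxA => /positive_neg/(_ neg) E.
  have : wprod (k :: s) *m Delta i \in Phi.
    by apply/wprod_root/(simple_in Delta_simple).
  by move=> /root_neq0; rewrite /= E eqxx.
exists s; split=> //; first by move=> x; rewrite inE => ->; rewrite orbT.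
have := refl_conj (Delta i) (wprod_trK s); rewrite bk -mulmxA => <-.
by rewrite mulmxA srK mul1mx.
Qed.

(** The parabolic subgroup of J, as a set of words, since the arguments below
    shorten words. *)
Definition par J w := exists2 s, {subset s <= J} & w = wprod s.

Lemma par1 J : par J 1%:M. Proof. by exists [::]. Qed.

Lemma par_sr J i : i \in J -> par J (sr i).
Proof.
by move=> iJ; exists [:: i]; [move=> x; rewrite inE => /eqP -> | rewrite /= mulmx1].
Qed.

Lemma par_srT i : par [set: 'I_r] (sr i).
Proof. by apply: par_sr; rewrite finset.in_setT. Qed.

Lemma par_mul J u w : par J u -> par J w -> par J (u *m w).
Proof.
move=> [s sJ ->] [t tJ ->]; exists (s ++ t); last by rewrite wprod_cat.
by move=> x; rewrite mem_cat => /orP[/sJ|/tJ].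
Qed.

Lemma par_tr J w : par J w -> par J w^T.
Proof.
move=> [s sJ ->]; exists (rev s); last by rewrite wprod_tr.
by move=> x; rewrite mem_rev => /sJ.
Qed.

Lemma par_trK J w : par J w -> w^T *m w = 1%:M.
Proof. by move=> [s _ ->]; apply: wprod_trK. Qed.

Lemma par_trKr J w : par J w -> w *m w^T = 1%:M.
Proof. by move=> /par_trK; apply: mulmx1C. Qed.

Lemma par_root J w a : par J w -> a \in Phi -> w *m a \in Phi.
Proof. by move=> [s _ ->]; apply: wprod_root. Qed.

Lemma par_sub J K w : J \subset K -> par J w -> par K w.
Proof. by move=> /fintype.subsetP h [s sJ ->]; exists s => // x /sJ/h. Qed.

(** A reflection in a simple root of J changes only the coordinate on that root. *)
Lemma par_rcoord J w v j : par J w -> j \notin J -> rcoord (w *m v) j = rcoord v j.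
Proof.
move=> [s sJ ->] jJ; elim: s sJ => [|i s IH] sJ /=; first by rewrite mul1mx.
rewrite -mulmxA rcoord_sr ?IH //; first by move=> x xs; rewrite sJ // inE xs orbT.
by apply: contraNneq jJ => ->; apply: sJ; rewrite mem_head.
Qed.

Lemma par_fix J w v : par J w -> {in J, forall j, dot v (Delta j) = 0} ->
  w *m v = v.
Proof.
move=> [s sJ ->] h; elim: s sJ => [|i s IH] sJ /=; first by rewrite mul1mx.
rewrite -mulmxA IH; last by move=> x xs; rewrite sJ // inE xs orbT.
by rewrite sr_mul /pairing h ?sJ ?mem_head // mulr0 mul0r scale0r subr0.
Qed.

Lemma root_height b : b \in Phi -> positive b ->
  exists c : 'I_r -> nat, forall j, rcoord b j = (c j)%:R.
Proof.
move=> bP pb; have [c [E|E]] := simple_sign Delta_simple bP; exists c => j.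
  by rewrite E rcoord_natsum.
have b0 : b = 0 by apply: positive_neg => // k; rewrite E opprK rcoord_natsum ler0n.
by move: (root_neq0 bP); rewrite b0 eqxx.
Qed.

(** A positive root that is not simple has a positive scalar product with some
    simple root, and the reflection in that root lowers its height. *)
Lemma root_simple b : b \in Phi ->
  exists2 u, par [set: 'I_r] u & exists i, b = u *m Delta i.
Proof.
move=> bP; wlog pb : b bP / positive b.
  move=> H; case: (root_sign bP) => [|nb]; first exact: H.
  have NbP : - b \in Phi.
    by rewrite -(refl_root (root_neq0 bP)) (roots_reflection Phi_root).
  have [u pu [i E]] := H _ NbP nb; exists (u *m sr i).
    by apply: par_mul => //; apply: par_srT.
  by exists i; rewrite -mulmxA sr_Delta mulmxN -E opprK.
have [c cE] := root_height bP pb.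
have [n] := ubnP (\sum_j c j); elim: n b bP pb c cE => // n IH b bP pb c cE.
rewrite ltnS => len.
have [[i bi]|nsimple] := pselect (exists i, b = Delta i).
  by exists 1%:M; [apply: par1 | exists i; rewrite mul1mx].
have [i bi] : exists i, 0 < dot b (Delta i).
  apply/not_existsP => H; have := dot_gt0 (root_neq0 bP).
  rewrite {2}(rcoordE b) dot_sumr ltNge sumr_le0 // => j _.
  by rewrite dotZr mulr_ge0_le0 // leNgt; apply/negP/H.
have sbP : sr i *m b \in Phi.
  by apply: (roots_reflection Phi_root) => //; apply: simple_in Delta_simple _.
have psb : positive (sr i *m b).
  by apply: sr_positive => // E; apply: nsimple; exists i.
have [c' c'E] := root_height sbP psb.
have lt_i : (c' i < c i)%N.
  rewrite -(ltr_nat R) -c'E -cE sr_mul rcoordB rcoordZ rcoord_Delta eqxx mulr1.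
  by rewrite ltrBlDr ltrDl /pairing divr_gt0 ?mulr_gt0 ?Delta_gt0.
have [|u pu [k E]] := IH _ sbP psb c' c'E.
  apply: leq_trans len; rewrite (bigD1 i) // [X in (_ < X)%N](bigD1 i) //=.
  rewrite -addSn leq_add // leq_sum // => j ji.
  by rewrite -(ler_nat R) -c'E -cE rcoord_sr.
exists (sr i *m u); first by apply: par_mul => //; apply: par_srT.
by exists k; rewrite -mulmxA -E mulmxA srK mul1mx.
Qed.

Lemma par_refl a : a \in Phi -> par [set: 'I_r] (reflection a).
Proof.
move=> /root_simple[u pu [i ->]].
have <- : u *m sr i *m u^T = reflection (u *m Delta i).
  by rewrite -refl_conj ?(par_trK pu) // -mulmxA (par_trKr pu) mulmx1.
by apply: par_mul; [apply: par_mul => //; apply: par_srT | apply: par_tr].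
Qed.

(** The simple reflections generate the group, because every root is conjugate to
    a simple one. *)
Lemma weyl_par w : weyl_group Phi w <-> par [set: 'I_r] w.
Proof.
split=> [[s sP ->]|[s _ ->]].
  elim: s sP => [|a s IH] sP; first by rewrite big_nil; apply: par1.
  rewrite big_cons; apply: par_mul; first by apply/par_refl/sP/mem_head.
  by apply: IH => x xs; apply: sP; rewrite inE xs orbT.
exists [seq Delta i | i <- s].
  by move=> _ /mapP[i _ ->]; apply: simple_in Delta_simple _.
by rewrite big_map; elim: s => [|i s IH] /=; rewrite ?big_nil // big_cons -IH.
Qed.

(** An element of the group is determined by the roots to which it sends the
    simple roots, which leaves finitely many choices. *)
Lemma weyl_list : exists G : seq 'M[R]_r,
  orth_group G /\ forall w, w \in G <-> par [set: 'I_r] w.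
Proof.
(* The linear map that sends each Delta k to f k. *)
pose mx (f : {ffun 'I_r -> Phi}) : 'M[R]_r :=
  \matrix_(i, j) (\sum_k (2 / dot (Delta k) (Delta k) * lambda k j 0)
     *: val (f k)) i 0.
have mxE v f : mx f *m v = \sum_k rcoord v k *: val (f k).
  apply/colP => i; rewrite !mxE.
  under eq_bigr do rewrite mxE summxE mulr_suml.
  rewrite exchange_big summxE; apply: eq_bigr => k _.
  rewrite mxE /rcoord mulrAC -mulrA /dot mulr_sumr mulr_suml.
  by apply: eq_bigr => j _; rewrite mxE; ring.
pose G := undup [seq w <- [seq mx f | f <- enum {: {ffun 'I_r -> Phi}}]
                | `[< par [set: 'I_r] w >]].
have GP w : w \in G <-> par [set: 'I_r] w.
  rewrite mem_undup mem_filter; split=> [/andP[/asboolP] //|pw].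
  apply/andP; split; first exact/asboolP.
  have wP i : w *m Delta i \in Phi by apply/(par_root pw)/simple_in.
  apply/mapP; exists [ffun i => [` wP i]%fset]; first by rewrite mem_enum.
  apply: mx_ext => v; rewrite mxE {1}(rcoordE v) mulmx_sumr.
  by apply: eq_bigr => k _; rewrite ffunE -scalemxAr.
exists G; split=> //; split.
- exact: undup_uniq.
- exact/GP/par1.
- by move=> u w /GP pu /GP pw; apply/GP/par_mul.
- by move=> w /GP pw; apply/GP/par_tr.
- by move=> w /GP; apply: par_trK.
Qed.

Lemma positive_sum b (y : V) J : positive b ->
    {in [predC J], forall j, rcoord b j = 0} ->
    {in J, forall j, 0 <= dot y (Delta j)} ->
  0 <= dot y b.
Proof.
move=> pb zb dy; rewrite (rcoordE b) dot_sumr sumr_ge0 // => j _; rewrite dotZr.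
have [jJ|jJ] := boolP (j \in J); first by rewrite mulr_ge0 ?dy.
by rewrite zb ?mul0r.
Qed.

Definition dominant J y := {in J, forall j, 0 <= dot y (Delta j)}.

(** If both y and w y are dominant then the last letter of a reduced word of w
    is orthogonal to y, so that all letters of the word fix y. *)
Lemma dominant_stab J w y : par J w -> dominant J y -> dominant J (w *m y) ->
  par [set j in J | dot y (Delta j) == 0] w.
Proof.
move=> [s sJ ->] dy; have [n] := ubnP (size s).
elim: n s sJ => // n IH s; case/lastP: s => [|s i] sJ.
  by move=> _ _; apply: par1.
rewrite ltnS size_rcons wprod_rcons => sz dw.
have iJ : i \in J by apply: sJ; rewrite mem_rcons mem_head.
have sJ' : {subset s <= J} by move=> x xs; rewrite sJ // mem_rcons inE xs orbT.
have DP : Delta i \in Phi by apply: simple_in.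
case: (root_sign (wprod_root s DP)) => [pb|/deletion[t [ts szt E]]]; last first.
  rewrite E in dw *; apply: IH => //; first by move=> x /ts/sJ'.
  by rewrite (leq_trans szt) // ltnW.
have pi : dot y (Delta i) = 0.
  apply/eqP; rewrite eq_le dy // andbT.
  rewrite -(dot_orth y (Delta i) (wprod_trK (rcons s i))) wprod_rcons.
  rewrite -[in X in dot _ X]mulmxA sr_Delta mulmxN dotNr oppr_le0.
  apply: (positive_sum pb) dw => j jJ.
  rewrite (@par_rcoord J) //; first last.
    by exists s.
  by rewrite rcoord_Delta; case: eqP jJ => // <-; rewrite inE /= iJ.
have siy : sr i *m y = y by rewrite sr_mul /pairing pi mulr0 mul0r scale0r subr0.
apply: par_mul; last by apply: par_sr; rewrite inE iJ pi eqxx.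
by apply: IH => //; rewrite -mulmxA siy in dw.
Qed.

Lemma dominant_eq J w y : par J w -> dominant J y -> dominant J (w *m y) ->
  w *m y = y.
Proof.
move=> pw dy dw; apply: par_fix (dominant_stab pw dy dw) _ => j.
by rewrite inE => /andP[_ /eqP].
Qed.

(** If w sends the simple root of the last letter of a word to a negative root,
    the word can be shortened; otherwise that letter changes w y by a positive
    root with a coefficient that is nonnegative because y is dominant. *)
Lemma sub_dominance w y : par [set: 'I_r] w -> dominant [set: 'I_r] y ->
  positive (y - w *m y).
Proof.
move=> [s _ ->] dy; have [n] := ubnP (size s).
elim: n s => // n IH s; case/lastP: s => [|s i].
  by move=> _ j; rewrite /= mul1mx subrr rcoord0.
rewrite ltnS size_rcons wprod_rcons => sz.
have DP : Delta i \in Phi by apply: simple_in.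
case: (root_sign (wprod_root s DP)) => [pb|/deletion[t [_ szt ->]]]; last first.
  by apply: IH; rewrite (leq_trans szt) // ltnW.
move=> j; rewrite -mulmxA sr_mul mulmxBr -scalemxAr opprB addrCA addrC rcoordD.
rewrite addr_ge0 ?IH // rcoordZ mulr_ge0 //.
by rewrite /pairing divr_ge0 ?dot_ge0 // mulr_ge0 // dy // inE.
Qed.

End RootSystem.

(** * Projections and the linear complementarity problem *)

Lemma prod_expand (R : comNzRingType) (T : finType) (K : {set T}) (d c : T -> R) :
  \prod_(i in K) (d i + c i) =
  \sum_(L : {set T} | L \subset K) \prod_(i in L) d i * \prod_(i in K :\: L) c i.
Proof.
rewrite big_mkcond /=.
rewrite (eq_bigr (fun i => (if i \in K then d i else 0)
                           + (if i \in K then c i else 1))); last first.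
  by move=> i _; case: ifP; rewrite ?add0r.
rewrite bigA_distr [RHS]big_mkcond /=; apply: eq_bigr => L _.
case: ifP => [LK|/negbT/fintype.subsetPn[i iL iK]]; last first.
  by rewrite (bigD1 i) //= iL (negbTE iK) mul0r.
rewrite [X in X * _]big_mkcond [X in _ * X]big_mkcond -big_split /=.
apply: eq_bigr => i _; rewrite finset.in_setD.
case: (boolP (i \in L)) => iL /=; last by rewrite mul1r.
by rewrite (fintype.subsetP LK i iL) mulr1.
Qed.

Lemma prod_bool (R : comNzRingType) (T : finType) (K : {set T}) (b : T -> bool) :
  \prod_(i in K) (b i)%:R = [forall i in K, b i]%:R :> R.
Proof.
case: (boolP [forall i in K, b i]) => [/'forall_implyP h|].
  by rewrite big1 // => i /h ->.
rewrite negb_forall => /existsP[i]; rewrite negb_imply => /andP[iK /negbTE bi].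
by rewrite (bigD1 i) //= bi mul0r.
Qed.

Section Projection.
Variables (R : realType) (r : nat) (Phi : {fset 'cV[R]_r}).
Variables (Delta lambda : 'I_r -> 'cV[R]_r).
Hypothesis (Phi_root : crystallographic_root_system Phi).
Hypothesis (Delta_simple : simple_roots Phi Delta).
Hypothesis (lambda_weights : fundamental_weights Delta lambda).
Implicit Types (i j : 'I_r) (J K L : {set 'I_r}).
Implicit Types (a b v x y : 'cV[R]_r) (w u : 'M[R]_r).

Notation par := (par Delta).
Notation rcoord := (rcoord Delta lambda).

Lemma lambda_dominant i j : 0 <= dot (lambda i) (Delta j).
Proof.
rewrite (dot_lambda Phi_root Delta_simple lambda_weights).
by rewrite mulr_ge0 ?ler0n // divr_ge0 ?dot_ge0.
Qed.

Lemma dot_rcoord v y : dot v y = \sum_j rcoord v j * dot (Delta j) y.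
Proof.
rewrite {1}(rcoordE Phi_root Delta_simple lambda_weights v) dot_suml.
by apply: eq_bigr => j _; rewrite dotZl.
Qed.

Lemma Delta_orth0 y : (forall j, dot y (Delta j) = 0) -> y = 0.
Proof.
move=> h; apply: dot_eq0; rewrite dot_rcoord big1 // => j _.
by rewrite dotC h mulr0.
Qed.

Lemma rcoord_comb (p : 'I_r -> R) j : rcoord (\sum_i p i *: Delta i) j = p j.
Proof.
rewrite rcoord_sum (bigD1 j) //= rcoordZ big1 ?addr0 => [|i ij].
  by rewrite (rcoord_Delta Phi_root Delta_simple lambda_weights) eqxx mulr1.
rewrite rcoordZ (rcoord_Delta Phi_root Delta_simple lambda_weights).
by rewrite (negbTE ij) mulr0.
Qed.

(** Maximize the scalar product with the sum of the fundamental weights, which is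
    positive on all simple roots, over the orbit of x. *)
Lemma dominant_conj G J x : orth_group G ->
    (forall w, w \in G <-> par [set: 'I_r] w) ->
  exists2 u, par J u & dominant Delta J (u *m x).
Proof.
move=> gG GP; pose rho := \sum_i lambda i.
pose H := filter (fun w => `[< par J w >]) G.
have HP w : w \in H <-> par J w.
  rewrite mem_filter; split=> [/andP[/asboolP]//|pw].
  by apply/andP; split; [apply/asboolP | apply/GP/par_sub/pw/finset.subsetT].
have : H != [::].
  by have /HP := par1 Delta J; case: (H).
move=> /(seq_argmax (fun w => dot rho (w *m x)))[u /HP pu umax].
exists u => // j jJ.
have /HP/umax : par J (sr Delta j *m u) by apply: par_mul => //; apply: par_sr.
rewrite -mulmxA sr_mul dotBr dotZr lerBlDr lerDl /pairing.
have rD : dot rho (Delta j) = dot (Delta j) (Delta j) / 2.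
  rewrite dot_suml (bigD1 j) //= big1 ?addr0 => [|i ij].
    by rewrite (dot_lambda Phi_root Delta_simple lambda_weights) eqxx mul1r.
  by rewrite (dot_lambda Phi_root Delta_simple lambda_weights) (negbTE ij) mul0r.
have d0 := Delta_gt0 Phi_root Delta_simple j.
by rewrite rD pmulr_lge0 ?divr_gt0 // pmulr_lge0 ?invr_gt0 // pmulr_rge0.
Qed.

(** After moving x to the dominant chamber, take a simple root that is not
    orthogonal to x; the corresponding weight minus any of its conjugates is a
    nonnegative combination of simple roots. *)
Lemma orbit_separation G x : orth_group G ->
    (forall w, w \in G <-> par [set: 'I_r] w) -> x != 0 ->
  exists i u, par [set: 'I_r] u /\
    forall w, par [set: 'I_r] w -> w *m lambda i != u *m lambda i ->
      dot (u *m lambda i - w *m lambda i) x != 0.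
Proof.
move=> gG GP x0; have [u pu du] := dominant_conj [set: 'I_r] x gG GP.
have [i xi] : exists i, dot (u *m x) (Delta i) != 0.
  apply/not_existsP => H; case/eqP: x0.
  rewrite -[x]mul1mx -(par_trK Phi_root Delta_simple pu) -mulmxA.
  by rewrite (@Delta_orth0 (u *m x)) ?mulmx0 // => j; apply/eqP/negPn/negP/H.
exists i, u^T; split=> [|w pw]; first exact: par_tr.
apply: contra => /eqP E.
have [d dE] : {d | d = lambda i - (u *m w) *m lambda i} by eexists.
have puw : par [set: 'I_r] (u *m w) by apply: par_mul.
have pd : positive Delta lambda d.
  rewrite dE; apply: (sub_dominance Phi_root Delta_simple lambda_weights) => // j _.
  exact: lambda_dominant.
have dx : dot d (u *m x) = 0.
  rewrite dE -[X in X - _]mul1mx -(par_trKr Phi_root Delta_simple pu) -!mulmxA.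
  by rewrite -mulmxBr dot_orth ?(par_trK Phi_root Delta_simple pu).
have di : rcoord d i = 0.
  move: dx; rewrite dot_rcoord => /eqP; rewrite psumr_eq0.
    move=> /allP/(_ i); rewrite mem_index_enum => /(_ isT)/=.
    by rewrite mulf_eq0 [dot _ _]dotC (negbTE xi) orbF => /eqP.
  by move=> j _; rewrite mulr_ge0 ?pd // dotC du // finset.in_setT.
have ld : dot (lambda i) d = 0.
  rewrite dotC dot_rcoord big1 // => j _; rewrite dotC.
  rewrite (dot_lambda Phi_root Delta_simple lambda_weights).
  by case: eqP => [<-|]; rewrite ?di ?mul0r ?mulr0.
have d0 : d = 0.
  have := dot_orth (lambda i) (lambda i) (par_trK Phi_root Delta_simple puw).
  have -> : (u *m w) *m lambda i = lambda i - d by rewrite dE opprB addrC subrK.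
  rewrite dotBr !dotBl (dotC d) ld subr0 sub0r opprK => /(canRL (addKr _)).
  by rewrite addNr => /dot_eq0.
apply/eqP; move/eqP: d0; rewrite dE subr_eq0 => /eqP {2}->.
by rewrite -mulmxA mulmxA (par_trK Phi_root Delta_simple pu) mul1mx.
Qed.

Lemma span_projection K x : exists p : 'I_r -> R,
  (forall j, j \notin K -> p j = 0) /\
  forall j, j \in K -> dot (x - \sum_i p i *: Delta i) (Delta j) = 0.
Proof.
(* The Gram matrix of the roots in K, completed by the identity matrix. *)
pose M : 'M[R]_r := \matrix_(i, j)
  if (i \in K) && (j \in K) then dot (Delta i) (Delta j) else (i == j)%:R.
have Mi (p : 'rV_r) j : (p *m M) 0 j =
    if j \in K then dot (\sum_(i in K) p 0 i *: Delta i) (Delta j) else p 0 j.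
  rewrite mxE; case: ifP => jK.
    rewrite dot_suml [RHS]big_mkcond; apply: eq_bigr => i _.
    rewrite mxE jK andbT; case: ifP => iK; first by rewrite dotZl.
    by case: eqP => [E|]; [rewrite E jK in iK | rewrite mulr0].
  rewrite (bigD1 j) //= big1 ?addr0 => [|i ij].
    by rewrite mxE jK andbF eqxx mulr1.
  by rewrite mxE jK andbF (negbTE ij) mulr0.
have uM : M \in unitmx.
  rewrite -row_free_unit -kermx_eq0; apply/rowV0P => p /sub_kermxP pM.
  have pK j : j \notin K -> p 0 j = 0.
    by move=> jK; have := Mi p j; rewrite pM mxE (negbTE jK).
  have s0 : \sum_i p 0 i *: Delta i = 0.
    apply: dot_eq0; rewrite {2}(bigID (mem K)) /= [X in _ + X]big1 ?addr0.
      rewrite dot_sumr big1 // => j jK; rewrite dotZr.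
      rewrite (bigID (mem K)) /= [X in _ + X]big1 ?addr0.
        by have := Mi p j; rewrite jK pM mxE => <-; rewrite mulr0.
      by move=> i iK; rewrite pK ?scale0r.
    by move=> i iK; rewrite pK ?scale0r.
  by apply/rowP => j; rewrite -(rcoord_comb (p 0)) s0 rcoord0 mxE.
pose p := (\row_j if j \in K then dot x (Delta j) else 0) *m invmx M.
have pM : p *m M = \row_j if j \in K then dot x (Delta j) else 0.
  by rewrite mulmxKV.
have pK j : j \notin K -> p 0 j = 0.
  by move=> jK; have := Mi p j; rewrite pM mxE (negbTE jK).
exists (p 0); split=> // j jK.
rewrite dotBl (bigID (mem K)) /= [X in dot (_ + X) _]big1 ?addr0.
  by have := Mi p j; rewrite jK pM mxE jK => <-; rewrite subrr.
by move=> i iK; rewrite pK ?scale0r.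
Qed.

(** The orthogonal projection of x on the span of the simple roots in K has the
    coordinates [pcoef K x], and the residual vector is [orthp K x]. *)
Definition pcoef K x : 'I_r -> R := sval (cid (span_projection K x)).
Definition orthp K x := x - \sum_i pcoef K x i *: Delta i.

Lemma pcoef_out K x j : j \notin K -> pcoef K x j = 0.
Proof. by rewrite /pcoef; case: cid => p [] /= h _; apply: h. Qed.

Lemma orthp_orth K x j : j \in K -> dot (orthp K x) (Delta j) = 0.
Proof. by rewrite /orthp /pcoef; case: cid => p [] /= _ h; apply: h. Qed.

Lemma orthp_unique K x z : {in K, forall j, dot z (Delta j) = 0} ->
    (forall j, j \notin K -> rcoord (x - z) j = 0) ->
  orthp K x = z.
Proof.
move=> zK xz; apply/eqP; rewrite -subr_eq0; apply/eqP/dot_eq0.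
have E : orthp K x - z = \sum_j (rcoord (x - z) j - pcoef K x j) *: Delta j.
  under eq_bigr do rewrite scalerBl.
  rewrite big_split /= sumrN -(rcoordE Phi_root Delta_simple lambda_weights).
  by rewrite /orthp addrAC.
rewrite {2}E dot_sumr big1 // => j _; rewrite dotZr.
have [jK|jK] := boolP (j \in K).
  by rewrite dotBl orthp_orth // zK // subrr mulr0.
by rewrite xz // pcoef_out // subrr mul0r.
Qed.

Lemma orthp_par K w x : par K w -> orthp K (w *m x) = orthp K x.
Proof.
move=> pw; apply: orthp_unique => [j|j jK]; first exact: orthp_orth.
rewrite rcoordB (par_rcoord Phi_root Delta_simple lambda_weights _ pw jK) -rcoordB.
by rewrite /orthp opprB addrC subrK rcoord_comb pcoef_out.
Qed.

(** The difference of the residual vectors is the combination of the simple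
    roots with the differences of the coordinates as coefficients, so that the
    condition makes its square nonpositive. *)
Lemma complementarity_unique K K' x :
    (forall i, 0 <= (pcoef K x i - pcoef K' x i)
                    * (dot (orthp K x) (Delta i) - dot (orthp K' x) (Delta i))) ->
  orthp K x = orthp K' x /\ pcoef K x =1 pcoef K' x.
Proof.
move=> h.
have E : orthp K' x - orthp K x = \sum_j (pcoef K x j - pcoef K' x j) *: Delta j.
  rewrite /orthp opprB addrC addrA subrK -sumrB.
  by under [RHS]eq_bigr do rewrite scalerBl.
have z0 : orthp K' x - orthp K x = 0.
  apply: dot_le0; rewrite {2}E dot_sumr -oppr_ge0 -sumrN sumr_ge0 // => j _.
  by rewrite dotZr -mulrN -dotNl opprB dotBl.
split; first by apply/esym/eqP; rewrite -subr_eq0 z0.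
move=> j; apply/eqP; rewrite -subr_eq0.
by rewrite -(rcoord_comb (fun j => pcoef K x j - pcoef K' x j)) -E z0 rcoord0.
Qed.

Definition qcond J K x := [forall j in J :\: K, dot (orthp K x) (Delta j) < 0].

(** K is the support of a solution of a linear complementarity problem: find
    x = sum_i p_i Delta_i + z with p supported in J, z orthogonal to the roots
    in L and, for all i in J minus L, p_i >= 0, <z, Delta_i> <= 0 and
    p_i <z, Delta_i> = 0.  The strict inequality in [qcond] assigns the indices
    with p_i = <z, Delta_i> = 0 to K, so that K depends only on the solution. *)
Definition lcp L J x K :=
  [&& L \subset K, K \subset J, qcond J K x & [forall i in K :\: L, 0 <= pcoef K x i]].

Lemma lcp_in L J x K i : lcp L J x K -> i \in L ->
  dot (orthp K x) (Delta i) = 0.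
Proof. by case/and4P=> /fintype.subsetP LK _ _ _ /LK; apply: orthp_orth. Qed.

Lemma lcp_out L J x K i : lcp L J x K -> i \in J :\: L ->
  [/\ dot (orthp K x) (Delta i) <= 0, 0 <= pcoef K x i &
      pcoef K x i * dot (orthp K x) (Delta i) = 0].
Proof.
case/and4P=> LK KJ /'forall_implyP q /'forall_implyP p.
rewrite finset.in_setD => /andP[iL iJ]; have [iK|iK] := boolP (i \in K).
  rewrite orthp_orth // mulr0; split=> //.
  by apply: p; rewrite finset.in_setD iL iK.
by rewrite pcoef_out // mul0r ltW // q // finset.in_setD iK.
Qed.

Lemma lcp_sign L J x K i : lcp L J x K -> i \notin J -> pcoef K x i = 0.
Proof.
case/and4P=> _ /fintype.subsetP KJ _ _ iJ; apply: pcoef_out.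
by apply: contra iJ; apply: KJ.
Qed.

Lemma compl_ge0 (p p' v v' : R) : 0 <= p -> 0 <= p' -> v <= 0 -> v' <= 0 ->
  p * v = 0 -> p' * v' = 0 -> 0 <= (p - p') * (v - v').
Proof.
move=> p0 p'0 v0 v'0 pv pv'.
have -> : (p - p') * (v - v') = p * v + p' * v' + p * (- v') + p' * (- v) by ring.
by rewrite pv pv' !add0r addr_ge0 ?mulr_ge0 ?oppr_ge0.
Qed.

Lemma lcp_unique L J x K K' : lcp L J x K -> lcp L J x K' -> K = K'.
Proof.
move=> g g'; have [|zE _] := @complementarity_unique K K' x.
  move=> i; have [iL|iL] := boolP (i \in L).
    by rewrite (lcp_in g iL) (lcp_in g' iL) subrr mulr0.
  have [iJ|iJ] := boolP (i \in J); last first.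
    by rewrite (lcp_sign g iJ) (lcp_sign g' iJ) subrr mul0r.
  have iJL : i \in J :\: L by rewrite finset.in_setD iL.
  have [? ? ?] := lcp_out g iJL; have [? ? ?] := lcp_out g' iJL.
  exact: compl_ge0.
suff KE M : lcp L J x M ->
    M = [set i in J | dot (orthp M x) (Delta i) == 0].
  by rewrite (KE _ g) (KE _ g') zE.
case/and4P=> _ /fintype.subsetP MJ /'forall_implyP q _.
apply/setP => i; rewrite inE; apply/idP/andP => [iM|[iJ /eqP E]].
  by rewrite MJ // orthp_orth.
by apply/negPn/negP => iM; have := q i; rewrite E ltxx finset.in_setD iM iJ => /(_ isT).
Qed.

(** Induction on J minus L: for j in J minus L, one solution ignores j and
    another has j in its support; if neither solves the problem, then both
    violate it in j, and the comparison above makes them equal. *)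
Lemma lcp_exists L J x : L \subset J -> exists K, lcp L J x K.
Proof.
have [n] := ubnP #|J :\: L|; elim: n L J => // n IH L J len LJ.
have [JL|[j jJL]] := set_0Vmem (J :\: L).
  exists J; rewrite /lcp LJ subxx /qcond; apply/andP; split=> //.
  apply/andP; split=> //; apply/andP; split; apply/'forall_implyP => i.
    by rewrite finset.in_setD; case: (i \in J).
  by rewrite JL finset.in_set0.
have [jL jJ] : j \notin L /\ j \in J by move: jJL; rewrite finset.in_setD => /andP[].
have lt1 (A B : {set 'I_r}) : B :\: A \proper J :\: L -> (#|B :\: A| < n)%N.
  by move=> /proper_card h; apply: leq_trans h _.
have [||K g] := IH L (J :\ j).
- apply: lt1; apply/properP; split; first by apply: finset.setSD; apply: finset.subsetDl.
  by exists j => //; rewrite !inE eqxx andbF.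
- by rewrite finset.subsetD1 LJ.
have [jz|jz] := ltP (dot (orthp K x) (Delta j)) 0.
  exists K; case/and4P: g => LK KJ /'forall_implyP q p.
  rewrite /lcp LK p (fintype.subset_trans KJ) ?finset.subsetDl //= andbT.
  apply/'forall_implyP => i; rewrite finset.in_setD => /andP[iK iJ].
  by have [->//|ij] := eqVneq i j; rewrite q // !inE iK ij.
have [||K' g'] := IH (j |: L) J.
- apply: lt1; apply/properP; split; first by apply: finset.setDS; apply: finset.subsetU1.
  by exists j => //; rewrite !inE eqxx.
- by rewrite finset.subUset finset.sub1set jJ.
have [jp|jp] := leP 0 (pcoef K' x j).
  exists K'; case/and4P: g' => LK KJ q /'forall_implyP p.
  rewrite /lcp q KJ (fintype.subset_trans _ LK) ?finset.subsetU1 //=.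
  apply/'forall_implyP => i; rewrite finset.in_setD => /andP[iL iK].
  by have [->//|ij] := eqVneq i j; rewrite p // !inE iK negb_or ij iL.
have pj : pcoef K x j = 0 by apply: (lcp_sign g); rewrite !inE eqxx.
have vj : dot (orthp K' x) (Delta j) = 0 by apply: (lcp_in g'); rewrite !inE eqxx.
have [|_ /(_ j)] := @complementarity_unique K K' x; last first.
  by rewrite pj => E; rewrite -E ltxx in jp.
move=> i; have [->|ij] := eqVneq i j.
  by rewrite pj vj sub0r subr0 mulr_ge0 // oppr_ge0 ltW.
have [iL|iL] := boolP (i \in L).
  by rewrite (lcp_in g iL) (lcp_in g') ?subrr ?mulr0 // !inE iL orbT.
have [iJ|iJ] := boolP (i \in J); last first.
  rewrite (lcp_sign g) ?(lcp_sign g' iJ) ?subrr ?mul0r //.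
  by rewrite !inE negb_and iJ orbT.
have [|? ? ?] := @lcp_out L (J :\ j) x K i g; first by rewrite !inE ij iL.
have [|? ? ?] := @lcp_out (j |: L) J x K' i g'; first by rewrite !inE negb_or ij iL.
exact: compl_ge0.
Qed.

(** In the expansion of the products, the sets K with a common L are those
    allowed by the complementarity problem for L, which has one solution. *)
Lemma signed_sum J (A : 'I_r -> bool) x :
  \sum_(K : {set 'I_r} | K \subset J) (qcond J K x)%:R *
     \prod_(i in K) ((A i)%:R - (pcoef K x i < 0)%R%:R) =
  \prod_(i in J) (A i)%:R :> R.
Proof.
have AE K : \prod_(i in K) ((A i)%:R - (pcoef K x i < 0)%R%:R) =
    \sum_(L : {set 'I_r} | L \subset K) (\prod_(i in L) - (~~ A i)%:R)
      * [forall i in K :\: L, (0 <= pcoef K x i)%R]%:R :> R.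
  transitivity (\prod_(i in K) (- (~~ A i)%:R + (0 <= pcoef K x i)%R%:R) : R).
    apply: eq_bigr => i _; rewrite ltNge.
    by case: (A i); case: (0 <= _) => /=; rewrite ?mulr0n ?mulr1n; ring.
  by rewrite prod_expand; apply: eq_bigr => L _; rewrite prod_bool.
under [LHS]eq_bigr do rewrite AE mulr_sumr.
rewrite (exchange_big_dep (fun L => L \subset J)) /=; last first.
  by move=> K L KJ LK; apply: fintype.subset_trans LK KJ.
transitivity (\prod_(i in J) (- (~~ A i)%:R + 1) : R); last first.
  by apply: eq_bigr => i _; case: (A i); rewrite ?oppr0 ?add0r // addNr.
rewrite prod_expand; apply: eq_bigr => L LJ.
have [K0 g] := lcp_exists x LJ.
have /and4P[LK0 K0J q p] := g.
rewrite [X in _ = _ * X]big1 // mulr1 (bigD1 K0) ?LK0 ?K0J //= q p mul1r mulr1.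
rewrite [X in _ + X]big1 ?addr0 // => K /andP[/andP[KJ LK] KK0].
have : ~~ lcp L J x K by apply: contra KK0 => /(lcp_unique g) ->.
rewrite /lcp LK KJ /= negb_and => /orP[|] /negbTE ->; first by rewrite mul0r.
by rewrite !mulr0.
Qed.

End Projection.

(** * Sums over the chambers with signs *)

Lemma sum_bool (R : pzSemiRingType) (T : Type) (s : seq T) (b : pred T) :
  \sum_(x <- s) (b x)%:R = (count b s)%:R :> R.
Proof. by elim: s => [|x s IH]; rewrite ?big_nil // big_cons IH natrD. Qed.

Section SignedCount.
Variables (R : realType) (r : nat) (Phi : {fset 'cV[R]_r}).
Variables (Delta lambda : 'I_r -> 'cV[R]_r) (G : seq 'M[R]_r).
Hypothesis (Phi_root : crystallographic_root_system Phi).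
Hypothesis (Delta_simple : simple_roots Phi Delta).
Hypothesis (lambda_weights : fundamental_weights Delta lambda).
Hypothesis (G_group : orth_group G).
Hypothesis (G_par : forall w, w \in G <-> par Delta [set: 'I_r] w).
Implicit Types (i j : 'I_r) (J K L : {set 'I_r}).
Implicit Types (a b v x y xi : 'cV[R]_r) (w u : 'M[R]_r).

Notation par := (par Delta).
Notation pcoef := (pcoef Phi_root Delta_simple lambda_weights).
Notation orthp := (orthp Phi_root Delta_simple lambda_weights).
Notation qcond := (qcond Phi_root Delta_simple lambda_weights).
Notation parK := (par_trK Phi_root Delta_simple).
Notation parKr := (par_trKr Phi_root Delta_simple).

Definition parl J := [seq w <- G | `[< par J w >]].

Lemma mem_parl J w : w \in parl J <-> par J w.
Proof.
rewrite mem_filter; split=> [/andP[/asboolP]//|pw].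
apply/andP; split; first exact/asboolP.
exact/G_par/(par_sub (finset.subsetT J)).
Qed.

Lemma parl_group J : orth_group (parl J).
Proof.
split; first by rewrite filter_uniq ?(og_uniq G_group).
- exact/mem_parl/par1.
- by move=> u w /mem_parl pu /mem_parl pw; apply/mem_parl/par_mul.
- by move=> w /mem_parl pw; apply/mem_parl/par_tr.
- by move=> w /mem_parl; apply: parK.
Qed.

Lemma parl_size_neq0 J : (size (parl J))%:R != 0 :> R.
Proof. by rewrite pnatr_eq0 -lt0n; case: (parl J) (og_1 (parl_group J)). Qed.

(** The projection of xi on the fixed space of w lies on no root hyperplane
    except those that contain the whole fixed space. *)
Definition generic xi := forall w a z, w \in G -> a \in Phi -> w *m z = z ->
  (forall v, w *m v = v -> dot (xi - z) v = 0) -> dot a z = 0 ->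
  forall v, w *m v = v -> dot a v = 0.

(** By [fixed_projection] the projection of a root a on a fixed space is P a for
    some matrix P, and a generic vector is not orthogonal to P a unless
    P a = 0. *)
Lemma generic_exists : exists xi, generic xi.
Proof.
have /choice[P PP] : forall w, exists P : 'M[R]_r, w \in G ->
    [/\ w *m P = P, P^T = P & forall v : 'cV_r, w *m v = v -> P *m v = v].
  move=> w; have [wG|_] := boolP (w \in G); last by exists 0.
  by have [P] := fixed_projection G_group wG; exists P.
have [xi xiP] := generic_vector [seq P w *m a | w <- G, a <- enum_fset Phi].
exists xi => w a z wG aP wz zo az v wv; have [wPE PT Pfix] := PP w wG.
have Pa : P w *m a = 0.
  apply/eqP/negPn/negP => Pa0.
  have /xiP/(_ Pa0) : P w *m a \in [seq P w *m a | w <- G, a <- enum_fset Phi].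
    by apply/allpairsP; exists (w, a).
  have : dot (xi - z) (P w *m a) = 0 by apply: zo; rewrite mulmxA wPE.
  rewrite dotBl => /eqP; rewrite subr_eq0 dotC => /eqP ->.
  by rewrite dotC dot_mull PT Pfix // az eqxx.
by rewrite -(Pfix v wv) dotC dot_mull PT Pa dot0r.
Qed.

Lemma generic_conj u xi : u \in G -> generic xi -> generic (u *m xi).
Proof.
move=> uG gx w a z wG aP wz zo az v wv.
have uK := og_trK G_group uG; have uKr := og_trKr G_group uG.
have uTG := og_tr G_group uG.
have conj y : w *m y = y -> (u^T *m w *m u) *m (u^T *m y) = u^T *m y.
  by move=> wy; rewrite -!mulmxA (mulmxA u) uKr mul1mx wy.
have dTu y y' : dot (u^T *m y) (u^T *m y') = dot y y'.
  by rewrite dot_orth // trmxK.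
rewrite -(dTu a) (gx (u^T *m w *m u) _ (u^T *m z)) //.
- by apply: og_mul => //; apply: og_mul.
- by apply: (par_root Phi_root Delta_simple) aP; apply/G_par.
- exact: conj.
- move=> y; rewrite -!mulmxA => wy.
  have -> : y = u^T *m (u *m y) by rewrite mulmxA uK mul1mx.
  have -> : xi - u^T *m z = u^T *m (u *m xi - z).
    by rewrite mulmxBr mulmxA uK mul1mx.
  by rewrite dTu; apply: zo; rewrite -{2}wy mulmxA (mulmxA u) uKr mul1mx.
- by rewrite dTu.
- exact: conj.
Qed.

(** The elements of the parabolic subgroup of K with the smallest possible
    fixed space. *)
Definition full K w := par K w /\
  forall v, w *m v = v -> {in K, forall j, dot v (Delta j) = 0}.

Definition nfull K := count (fun w => `[< full K w >]) G.

Definition orthb K x := [forall j in K, dot x (Delta j) == 0].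

Lemma orthbP K x :
  reflect {in K, forall j, dot x (Delta j) = 0} (orthb K x).
Proof. by apply: (iffP 'forall_implyP) => h j jK; apply/eqP/h. Qed.

Lemma orthb_par K u x : par K u -> orthb K (u *m x) = orthb K x.
Proof.
move=> pu; apply/idP/idP => [/orthbP h|/orthbP h].
  have := par_fix (par_tr pu) h; rewrite mulmxA (parK pu) mul1mx => E.
  by apply/orthbP; rewrite E.
by apply/orthbP; rewrite (par_fix pu h).
Qed.

Lemma full_fix K w x : full K w -> (w *m x == x) = orthb K x.
Proof.
move=> [pw fw]; apply/eqP/orthbP => [/fw//|h]; exact: par_fix pw h.
Qed.

(** Move the projection z of xi on the fixed space of w so that - z becomes
    dominant; the support K and the coset of u are then determined. *)
Lemma full_conjugate_unique J w xi : generic xi -> par J w ->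
  exists K0 u0, [/\ K0 \subset J, par J u0 &
   forall K u, K \subset J -> par J u ->
     (full K (u *m w *m u^T) /\ qcond J K (u *m xi)) <->
     (K = K0 /\ par K0 (u *m u0^T))].
Proof.
move=> gx pw; have parG L u : par L u -> u \in G.
  by move=> pu; apply/G_par/(par_sub (finset.subsetT L)).
have wG := parG _ _ pw; have [P [wP PT Pfix]] := fixed_projection G_group wG.
pose z := P *m xi; have wz : w *m z = z by rewrite mulmxA wP.
have zo v : w *m v = v -> dot (xi - z) v = 0.
  by move=> wv; rewrite dotBl dot_mull PT Pfix // subrr.
have [u0 pu0 du0] := dominant_conj Phi_root Delta_simple lambda_weights
  J (- z) G_group G_par.
pose K0 := [set j in J | dot (u0 *m z) (Delta j) == 0].
have K0J : K0 \subset J by apply/fintype.subsetP => j; rewrite inE => /andP[].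
have orthpz K u : par J u -> full K (u *m w *m u^T) ->
    orthp K (u *m xi) = u *m z.
  move=> pu [pK fK]; have uK := parK pu.
  have conj v : w *m v = v -> (u *m w *m u^T) *m (u *m v) = u *m v.
    by move=> wv; rewrite -!mulmxA (mulmxA u^T) uK mul1mx wv.
  apply: orthp_unique => [|j jK]; first exact/fK/conj.
  set y := u *m xi - u *m z.
  have yo v : (u *m w *m u^T) *m v = v -> dot y v = 0.
    move=> wv; rewrite /y -mulmxBr dot_mull zo // -{2}wv -!mulmxA.
    by rewrite (mulmxA u^T) uK mul1mx.
  have z0 : orthp K y = 0.
    have fz : (u *m w *m u^T) *m orthp K y = orthp K y.
      by apply: par_fix pK _ => k kK; apply: orthp_orth.
    have h := yo _ fz; apply: dot_eq0; move: h.
    have {1}-> : y = orthp K y + \sum_i pcoef K y i *: Delta i.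
      by rewrite /orthp subrK.
    rewrite dotDl dot_suml [X in _ + X]big1 ?addr0 // => k _; rewrite dotZl.
    have [kK|kK] := boolP (k \in K); first by rewrite dotC orthp_orth ?mulr0.
    by rewrite pcoef_out ?mul0r.
  have -> : y = \sum_i pcoef K y i *: Delta i.
    by apply/eqP; rewrite -subr_eq0; apply/eqP.
  by rewrite (rcoord_comb Phi_root Delta_simple lambda_weights) pcoef_out.
exists K0, u0; split=> // K u KJ pu; split=> [[fK qK]|[-> pK0]].
  have oz := orthpz K u pu fK.
  have duz : dominant Delta J (- (u *m z)).
    move=> j jJ; rewrite dotNl oppr_ge0 -oz.
    have [jK|jK] := boolP (j \in K); first by rewrite orthp_orth.
    by rewrite ltW //; move/'forall_implyP: qK => /(_ j); apply; rewrite finset.in_setD jK.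
  have puu0 : par J (u *m u0^T) by apply: par_mul => //; apply: par_tr.
  have E : (u *m u0^T) *m (u0 *m - z) = - (u *m z).
    by rewrite -mulmxA (mulmxA u0^T) (parK pu0) mul1mx mulmxN.
  have E2 : - (u *m z) = u0 *m - z.
    rewrite -E (dominant_eq Phi_root Delta_simple lambda_weights puu0) //.
    by rewrite E.
  have KK0 : K = K0.
    apply/setP => j; rewrite inE -[u0 *m z]opprK -mulmxN -E2 opprK.
    apply/idP/andP => [jK|[jJ /eqP jz]].
      by rewrite (fintype.subsetP KJ) // -oz orthp_orth.
    apply/negPn/negP => jK; move/'forall_implyP: qK => /(_ j).
    by rewrite finset.in_setD jK jJ oz jz ltxx => /(_ isT).
  split=> //.
  have := dominant_stab Phi_root Delta_simple lambda_weights puu0 du0.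
  rewrite E => /(_ duz); congr (par _ _); apply/setP => j.
  by rewrite !inE mulmxN dotNl oppr_eq0.
have E2 : u *m z = u0 *m z.
  have -> : u *m z = (u *m u0^T) *m (u0 *m z).
    by rewrite -mulmxA (mulmxA u0^T) (parK pu0) mul1mx.
  by apply: par_fix pK0 _ => j; rewrite inE => /andP[_ /eqP].
have fK : full K0 (u *m w *m u^T).
  have pw1 : par J (u *m w *m u^T).
    by apply: par_mul; [apply: par_mul | apply: par_tr].
  have w1z : (u *m w *m u^T) *m (u0 *m - z) = u0 *m - z.
    by rewrite mulmxN -E2 mulmxN -!mulmxA (mulmxA u^T) (parK pu) mul1mx wz.
  split.
    have := dominant_stab Phi_root Delta_simple lambda_weights pw1 du0.
    rewrite w1z => /(_ du0); congr (par _ _); apply/setP => j.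
    by rewrite !inE mulmxN dotNl oppr_eq0.
  move=> v w1v j; rewrite inE => /andP[jJ /eqP jz].
  have wv : w *m (u^T *m v) = u^T *m v.
    by rewrite -{2}w1v -!mulmxA (mulmxA u^T) (parK pu) mul1mx.
  have uD : u^T *m Delta j \in Phi.
    by apply: (par_root Phi_root Delta_simple (par_tr pu)); apply: simple_in.
  have := gx w _ z wG uD wz zo; rewrite dot_mull trmxK E2 dotC => /(_ jz _ wv).
  by rewrite dot_mull trmxK mulmxA (parKr pu) mul1mx dotC.
split=> //; apply/'forall_implyP => j.
rewrite finset.in_setD inE (orthpz _ _ pu fK) E2 => /andP[].
case: (boolP (j \in J)) => //= jJ jz _; rewrite lt_def eq_sym jz /=.
by have := du0 j jJ; rewrite mulmxN dotNl oppr_ge0.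
Qed.

Definition signed_count J x xi : R := \sum_(w <- parl J)
  \prod_(i in J) ((0 <= dot (w *m x) (Delta i))%R%:R
                  - (pcoef J (w *m xi) i < 0)%R%:R).

(** The elements that make x dominant form a coset of the stabilizer of x. *)
Lemma dominant_count J x :
  \sum_(w <- parl J) [forall i in J, 0 <= dot (w *m x) (Delta i)]%R%:R =
  \sum_(w <- parl J) (w *m x == x)%:R :> R.
Proof.
have [u0 pu0 du0] := dominant_conj Phi_root Delta_simple lambda_weights
  J x G_group G_par.
rewrite -[RHS](og_sum_mull (u := u0^T) _ (parl_group J)); last first.
  by apply/mem_parl/par_tr.
apply: eq_big_seq => w /mem_parl pw; congr (_ %:R : R); congr (nat_of_bool _).
apply/'forall_implyP/eqP => [dw|E j jJ]; last first.
  have -> : w *m x = u0 *m x by rewrite -[in RHS]E !mulmxA (parKr pu0) mul1mx.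
  exact: du0.
have E : w *m x = (w *m u0^T) *m (u0 *m x).
  by rewrite -mulmxA (mulmxA u0^T) (parK pu0) mul1mx.
have E2 : w *m x = u0 *m x.
  rewrite E (dominant_eq Phi_root Delta_simple lambda_weights (J := J)) //.
    by apply: par_mul => //; apply: par_tr.
  by rewrite -E => j jJ; apply: dw.
by rewrite -mulmxA E2 mulmxA (parK pu0) mul1mx.
Qed.

Lemma count_parl J K : K \subset J ->
  count (fun w => `[< par K w >]) (parl J) = size (parl K).
Proof.
move=> KJ; rewrite size_filter count_filter; apply: eq_count => w /=.
by apply: andb_idr => /asboolP pw; apply/asboolP/par_sub/pw.
Qed.

(** By [full_conjugate_unique] every w is counted on the right in one term K
    only, and there it is counted for each u in a coset of the parabolic
    subgroup of K. *)
Lemma full_count J x xi : generic xi ->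
  \sum_(w <- parl J) (w *m x == x)%:R =
  \sum_(K : {set 'I_r} | K \subset J) (size (parl K))%:R^-1 *
    \sum_(u <- parl J) (qcond J K (u *m xi))%:R
                       * ((nfull K)%:R * (orthb K (u *m x))%:R) :> R.
Proof.
move=> gx; pose t K u w : R :=
  (qcond J K (u *m xi))%:R * `[< full K (u *m w *m u^T) >]%:R.
transitivity (\sum_(w <- parl J) (w *m x == x)%:R *
   \sum_(K : {set 'I_r} | K \subset J) (size (parl K))%:R^-1 *
    \sum_(u <- parl J) t K u w).
  apply: eq_big_seq => w /mem_parl pw; rewrite -[LHS]mulr1; congr (_ * _).
  have [K0 [u0 [K0J pu0 KP]]] := full_conjugate_unique gx pw.
  rewrite (bigD1 K0) //= [X in _ + X]big1 ?addr0 => [|K /andP[KJ KK0]]; last first.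
    rewrite big_seq big1 ?mulr0 // => u /mem_parl pu; rewrite /t -natrM mulnb.
    case: andP => // -[q /asboolP f]; have /KP/(_ pu) := KJ; case.
    by move=> /(_ (conj f q))[E]; rewrite E eqxx in KK0.
  rewrite [X in _ * X](eq_big_seq (fun u => `[< par K0 (u *m u0^T) >]%:R)).
    rewrite (og_sum_mulr (fun u => `[< par K0 u >]%:R) (parl_group J)); last first.
      by apply/mem_parl/par_tr.
    by rewrite sum_bool count_parl // mulVf ?parl_size_neq0.
  move=> u /mem_parl pu; rewrite /t -natrM mulnb; congr (_%:R : R).
  congr (nat_of_bool _); apply/andP/asboolP => [[q /asboolP f]|p].
    by have [/(_ (conj f q))[]] := KP K0 u K0J pu.
  by have [_ /(_ (conj erefl p))[f q]] := KP K0 u K0J pu; split; last exact/asboolP.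
under eq_bigr do rewrite mulr_sumr.
rewrite exchange_big /=; apply: eq_bigr => K KJ.
under eq_bigr do rewrite mulrCA mulr_sumr.
rewrite -mulr_sumr exchange_big /=; congr (_ * _).
apply: eq_big_seq => u /mem_parl pu; rewrite /t.
under eq_bigr do rewrite mulrCA.
rewrite -mulr_sumr; congr (_ * _).
have uP : u \in parl J by apply/mem_parl.
have uTP : u^T \in parl J by apply/mem_parl/par_tr.
rewrite -(og_sum_mull _ (parl_group J) uTP).
rewrite -(og_sum_mulr _ (parl_group J) uP).
rewrite (eq_big_seq (fun w => `[< full K w >]%:R * (orthb K (u *m x))%:R)).
  rewrite -mulr_suml sum_bool; congr (_ %:R * _).
  rewrite /nfull count_filter; apply: eq_count => w /=.
  by apply: andb_idr => /asboolP[pw _]; apply/asboolP/par_sub/pw.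
move=> w _; have -> : u *m (u^T *m (w *m u)) *m u^T = w.
  by rewrite mulmxA (parKr pu) mul1mx -mulmxA (parKr pu) mulmx1.
case: (asboolP (full K w)) => [fw|_]; last by rewrite mulr0 mul0r.
rewrite mulr1 mul1r -(full_fix _ fw); congr (_%:R : R); congr (nat_of_bool _).
rewrite -!mulmxA; apply/eqP/eqP => [E|->].
  by rewrite -[in RHS]E (mulmxA u u^T) (parKr pu) mul1mx.
by rewrite mulmxA (parK pu) mul1mx.
Qed.

Lemma orthp_qcond J K u x : K \subset J -> par K u ->
  qcond J K (u *m x) = qcond J K x.
Proof. by move=> KJ pu; rewrite /qcond orthp_par. Qed.

(** The condition [qcond J K] does not change under the parabolic subgroup of K,
    so that the sum can be averaged over this subgroup. *)
Lemma signed_count_average J K x xi : K \subset J ->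
  \sum_(w <- parl J) (qcond J K (w *m xi))%:R *
     \prod_(i in K) ((0 <= dot (w *m x) (Delta i))%R%:R
                     - (pcoef K (w *m xi) i < 0)%R%:R) =
  (size (parl K))%:R^-1 * \sum_(w <- parl J) (qcond J K (w *m xi))%:R
     * signed_count K (w *m x) (w *m xi).
Proof.
move=> KJ; apply: (canRL (mulKf (parl_size_neq0 K))).
under [RHS]eq_bigr do rewrite mulr_sumr.
rewrite exchange_big /=; set S := \sum_(w <- _) _.
rewrite [RHS](eq_big_seq (fun=> S)).
  by rewrite big_const_seq count_predT mulr_natl -Monoid.iteropE.
move=> u /mem_parl pu; rewrite /S.
rewrite -[RHS](og_sum_mull (u := u) _ (parl_group J)); last first.
  exact/mem_parl/(par_sub KJ).
by apply: eq_bigr => w _; rewrite -!(mulmxA u w) (orthp_qcond _ KJ pu).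
Qed.

Lemma qcond_refl J x : qcond J J x.
Proof.
by apply/'forall_implyP => j; rewrite finset.in_setD; case: (j \in J).
Qed.

(** By [dominant_count], the sums over the subsets K of J in [signed_sum] and
    [full_count] are equal.  By induction their terms agree for all proper
    subsets K, hence also for K = J. *)
Theorem signed_countE J x xi : generic xi ->
  signed_count J x xi = (nfull J)%:R * (orthb J x)%:R.
Proof.
have [n] := ubnP #|J|; elim: n J x xi => // n IH J x xi len gx.
have E : \sum_(w <- parl J) \sum_(K : {set 'I_r} | K \subset J)
    (qcond J K (w *m xi))%:R *
    \prod_(i in K) ((0 <= dot (w *m x) (Delta i))%R%:R
                     - (pcoef K (w *m xi) i < 0)%R%:R) =
    \sum_(w <- parl J) (w *m x == x)%:R :> R.
  rewrite -dominant_count; apply: eq_bigr => w _.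
  by rewrite signed_sum prod_bool.
move: E; rewrite (full_count J x gx) exchange_big /=.
rewrite (bigD1 J) //= [in RHS](bigD1 J) //=.
rewrite (eq_bigr (fun K : {set 'I_r} => (size (parl K))%:R^-1 *
    \sum_(u <- parl J) (qcond J K (u *m xi))%:R
      * ((nfull K)%:R * (orthb K (u *m x))%:R))); last first.
  move=> K /andP[KJ KK0]; rewrite (signed_count_average _ _ KJ).
  congr (_ * _); apply: eq_big_seq => u /mem_parl pu; congr (_ * _).
  apply: IH; last first.
    by apply: generic_conj gx; apply/G_par/(par_sub (finset.subsetT J)).
  rewrite -ltnS (leq_trans _ len) // ltnS proper_card //.
  by rewrite finset.properEneq KK0.
(* Only the terms with K = J are left. *)
move=> /addIr E; rewrite /signed_count.
rewrite (eq_bigr (fun w => (qcond J J (w *m xi))%:R *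
  \prod_(i in J) ((0 <= dot (w *m x) (Delta i))%R%:R
                  - (pcoef J (w *m xi) i < 0)%R%:R))); last first.
  by move=> w _; rewrite qcond_refl mul1r.
rewrite E (eq_big_seq (fun=> (nfull J)%:R * (orthb J x)%:R)); last first.
  by move=> u /mem_parl pu; rewrite qcond_refl mul1r orthb_par.
rewrite big_const_seq count_predT -Monoid.iteropE -/(GRing.natmul _ _).
by rewrite -[X in _ * X]mulr_natl mulKf // parl_size_neq0.
Qed.

End SignedCount.

(** * Chamber functions on the weight lattice *)

Module Convolution.
Import monalg.
Local Open Scope ring_scope.

Section Convolution.
Variable A : zmodType.
Implicit Types (p q : group_algebra A) (T : A -> int) (x y : A).

(** The action of the group algebra on functions that may have infinite support,
    such as the characteristic functions of cones. *)
Definition conv p T x : int := \sum_(y <- msupp p) p@_y * T (x - y).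

Lemma convw (d : {fset A}) p T x : (msupp p `<=` d)%fset ->
  conv p T x = \sum_(y <- d) p@_y * T (x - y).
Proof.
move=> pd; rewrite /conv; apply: big_fset_incl => // y _ /mcoeff_outdom ->.
by rewrite mul0r.
Qed.

Lemma convD p q T x : conv (p + q) T x = conv p T x + conv q T x.
Proof.
rewrite (convw _ _ (msuppD_le p q)) (convw _ _ (fsubsetUl _ (msupp q))).
rewrite (convw _ _ (fsubsetUr (msupp p) _)) -big_split; apply: eq_bigr => y _.
by rewrite mcoeffD mulrDl.
Qed.

Lemma conv0 T x : conv 0 T x = 0.
Proof. by rewrite /conv msupp0 big_seq_fset0. Qed.

Lemma conv_sum (I : Type) (s : seq I) (F : I -> group_algebra A) T x :
  conv (\sum_(i <- s) F i) T x = \sum_(i <- s) conv (F i) T x.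
Proof.
by apply: (big_morph (fun p => conv p T x)) => [p q|]; rewrite ?convD ?conv0.
Qed.

Lemma conv_U (c : int) y T x : conv << c *g y >> T x = c * T (x - y).
Proof. by rewrite (convw _ _ msuppU_le) big_seq_fset1 mcoeffUU. Qed.

Lemma convN p T x : conv (- p) T x = - conv p T x.
Proof. by apply/eqP; rewrite -addr_eq0 -convD addNr conv0. Qed.

Lemma conv_gexp y T x : conv (gexp y) T x = T (x - y).
Proof. by rewrite conv_U mul1r. Qed.

Lemma conv1 T x : conv 1 T x = T x.
Proof. by rewrite [LHS]conv_gexp subr0. Qed.

Lemma conv_1Bgexp y T x : conv (1 - gexp y) T x = T x - T (x - y).
Proof. by rewrite convD convN conv1 conv_gexp. Qed.

Lemma convM p q T x : conv (p * q) T x = conv p (conv q T) x.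
Proof.
rewrite [p * q]/(GroupAlgebra.gmul p q) conv_sum; apply: eq_bigr => y _.
rewrite conv_sum mulr_sumr; apply: eq_bigr => z _.
by rewrite conv_U -mulrA opprD addrA.
Qed.

Lemma conv_ext p T T' x : T =1 T' -> conv p T x = conv p T' x.
Proof. by move=> h; apply: eq_bigr => y _; rewrite h. Qed.

Lemma conv_sumr (I : Type) (s : seq I) (F : I -> A -> int) p x :
  conv p (fun y => \sum_(i <- s) F i y) x = \sum_(i <- s) conv p (F i) x.
Proof.
rewrite /conv; under eq_bigr do rewrite mulr_sumr.
by rewrite exchange_big.
Qed.

Definition delta0 x : int := (x == 0)%:R.

Lemma conv_delta0 p x : conv p delta0 x = p@_x.
Proof.
rewrite /conv /delta0; case: (boolP (x \in msupp p)) => [xp|xp].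
  rewrite (big_fsetD1 x) //= subrr eqxx mulr1 big1_fset ?addr0 //.
  by move=> y; rewrite !inE subr_eq0 eq_sym => /andP[/negbTE ->]; rewrite !mulr0.
rewrite (mcoeff_outdom xp) big1_fset // => y yp _; rewrite subr_eq0.
by case: eqP => [E|]; rewrite ?mulr0 //; rewrite E yp in xp.
Qed.

(** The group algebra acts faithfully, because p is the convolution of p with the
    characteristic function of 0. *)
Lemma conv_inj (n : nat) p q :
  (forall x, conv q delta0 x = n%:R * conv p delta0 x) -> q = n%:R * p.
Proof.
move=> h; apply/malgP => x; have := h x.
by rewrite !conv_delta0 => ->; rewrite mulr_natl [in RHS]mulr_natl raddfMn.
Qed.

(** A product of functions of independent coordinates: the factor 1 - e^(y i)
    takes the difference of the i-th factor. *)
Lemma conv_prod (I : finType) (s : seq I) (y : I -> A) (F : I -> A -> int) x :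
    uniq s -> (forall i j x, i != j -> F j (x - y i) = F j x) ->
  conv (\prod_(i <- s) (1 - gexp (y i))) (fun x => \prod_i F i x) x =
  \prod_i (if i \in s then F i x - F i (x - y i) else F i x).
Proof.
move=> us Fy; elim: s us x => [_ x|i s IH /= /andP[iNs us] x].
  by rewrite big_nil conv1.
rewrite big_cons convM conv_1Bgexp !IH //.
rewrite (bigD1 i) //= [X in _ - X](bigD1 i) //= (negbTE iNs).
rewrite [RHS](bigD1 i) //= mem_head.
have E j : i != j -> (if j \in s then F j (x - y i) - F j (x - y i - y j)
    else F j (x - y i)) = (if j \in s then F j x - F j (x - y j) else F j x).
  by move=> ij; rewrite (addrAC x (- y i)) !(Fy i j).
rewrite [X in _ - _ * X](eq_bigr (fun j => if j \in s
  then F j x - F j (x - y j) else F j x)) => [|j]; last by rewrite eq_sym => /E.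
rewrite -mulrBl; congr (_ * _); apply: eq_bigr => j ji.
by rewrite inE (negbTE ji).
Qed.

End Convolution.
End Convolution.
Export Convolution.

Lemma prod_tofracV (D : idomainType) (I : finType) (F : I -> D) :
  \prod_i (1 - tofrac (F i))^-1 = (tofrac (\prod_i (1 - F i)))^-1.
Proof.
rewrite prodfV; congr (_^-1); rewrite rmorph_prod; apply: eq_bigr => i _.
by rewrite /= tofracB tofrac1.
Qed.

Lemma sum_tofracV (D : idomainType) (I : eqType) (s : seq I) (d : I -> D) (n : nat) :
    uniq s -> (forall i, i \in s -> d i != 0) ->
    \sum_(i <- s) \prod_(j <- s | j != i) d j = n%:R * \prod_(i <- s) d i ->
  \sum_(i <- s) (tofrac (d i))^-1 = n%:R.
Proof.
move=> us d0 E.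
have P0 : tofrac (\prod_(i <- s) d i) != 0.
  by rewrite tofrac_eq0 prodf_seq_neq0; apply/allP => i /d0.
apply: (mulIf P0); rewrite mulr_suml.
have -> : n%:R = tofrac n%:R :> {fraction D} by rewrite tofracMn tofrac1.
rewrite -tofracM -E rmorph_sum; apply: eq_big_seq => i si /=.
by rewrite (bigD1_seq i) //= tofracM mulKf // tofrac_eq0 d0.
Qed.

Section Weights.
Variables (R : realType) (r : nat) (Phi : {fset 'cV[R]_r}).
Variables (Delta lambda : 'I_r -> 'cV[R]_r) (G : seq 'M[R]_r).
Hypothesis (Phi_root : crystallographic_root_system Phi).
Hypothesis (Delta_simple : simple_roots Phi Delta).
Hypothesis (lambda_weights : fundamental_weights Delta lambda).
Hypothesis (G_group : orth_group G).
Hypothesis (G_par : forall w, w \in G <-> par Delta [set: 'I_r] w).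
Implicit Types (i j : 'I_r) (v y xi : 'cV[R]_r) (w u : 'M[R]_r).

Notation par := (par Delta).
Notation parK := (par_trK Phi_root Delta_simple).
Notation parKr := (par_trKr Phi_root Delta_simple).
Notation pcoef := (pcoef Phi_root Delta_simple lambda_weights).

Lemma pairingD v y i : pairing (v + y) (Delta i) = pairing v (Delta i) + pairing y (Delta i).
Proof. by rewrite /pairing dotDl mulrDr mulrDl. Qed.

Lemma pairingZ c v i : pairing (c *: v) (Delta i) = c * pairing v (Delta i).
Proof. by rewrite /pairing dotZl mulrCA !mulrA. Qed.

Lemma pairingB v y i : pairing (v - y) (Delta i) = pairing v (Delta i) - pairing y (Delta i).
Proof. by rewrite pairingD -scaleN1r pairingZ mulN1r. Qed.

Lemma pairing_ge0 v i : (0 <= pairing v (Delta i)) = (0 <= dot v (Delta i)).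
Proof.
have D0 := Delta_gt0 Phi_root Delta_simple i.
by rewrite /pairing pmulr_lge0 ?invr_gt0 // pmulr_rge0.
Qed.

Lemma pairing_eq0 v i : (pairing v (Delta i) == 0) = (dot v (Delta i) == 0).
Proof.
have D0 := Delta_gt0 Phi_root Delta_simple i.
by rewrite /pairing !mulf_eq0 invr_eq0 (gt_eqF D0) orbF pnatr_eq0.
Qed.

Definition integral v := forall i, pairing v (Delta i) \is a Num.int.

Lemma integral_par w v : par [set: 'I_r] w -> integral v -> integral (w *m v).
Proof.
move=> [s _ ->] h; elim: s => [|i s IH] /=; first by rewrite mul1mx.
rewrite -mulmxA sr_mul => j; rewrite pairingB pairingZ.
rewrite rpredB // rpredM //.
by apply: (roots_integral Phi_root); apply: simple_in Delta_simple _.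
Qed.

Lemma integral_lambda i : integral (lambda i).
Proof. by move=> j; rewrite lambda_weights; case: (_ == _); rewrite ?rpred0 ?rpred1. Qed.

Definition weight_vec (c : 'rV[int]_r) : 'cV[R]_r := \sum_i (c 0 i)%:~R *: lambda i.

Lemma pairing_weight_vec c j : pairing (weight_vec c) (Delta j) = (c 0 j)%:~R.
Proof.
rewrite /pairing dot_suml (bigD1 j) //= big1 ?addr0 => [|i ij].
  rewrite dotZl mulrCA -mulrA -/(pairing (lambda j) (Delta j)) lambda_weights.
  by rewrite eqxx mulr1.
rewrite dotZl (dot_lambda Phi_root Delta_simple lambda_weights) (negbTE ij).
by rewrite mul0r mulr0.
Qed.

Lemma integral_weight_vec c : integral (weight_vec c).
Proof. by move=> j; rewrite pairing_weight_vec rpred_int. Qed.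

Lemma pairing_eq v y : (forall j, pairing v (Delta j) = pairing y (Delta j)) -> v = y.
Proof.
move=> h; apply/eqP; rewrite -subr_eq0; apply/eqP.
apply: (Delta_orth0 Phi_root Delta_simple lambda_weights) => j.
by apply/eqP; rewrite -pairing_eq0 pairingB h subrr.
Qed.

Lemma weight_vecB c v : integral v ->
  weight_vec (c - weight_coord Delta v) = weight_vec c - v.
Proof.
move=> iv; apply: pairing_eq => j; rewrite pairingB !pairing_weight_vec !mxE.
by rewrite rmorphB /= floorK // iv.
Qed.

Lemma weight_vec_eq0 c : (weight_vec c == 0) = (c == 0).
Proof.
apply/eqP/eqP => [E|->]; last by rewrite /weight_vec big1 // => i _; rewrite mxE scale0r.
apply/rowP => j; rewrite mxE; apply/eqP; rewrite -(intr_eq0 R).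
by rewrite -pairing_weight_vec E /pairing dot0l mulr0 mul0r.
Qed.

Notation weight_den w := (\prod_(i < r) (1 - weight_exp Delta (w *m lambda i))).

(** The characteristic function of the closed chamber of w, up to a constant in
    each coordinate: the differences in weight_den w do not see the constants. *)
Definition chamber_fun (b : 'I_r -> bool) w (c : 'rV[int]_r) : int :=
  \prod_i ((0 <= pairing (w^T *m weight_vec c) (Delta i))%R%:R - (b i)%:R).

Lemma conv_chamber b w c : par [set: 'I_r] w ->
  conv (weight_den w) (chamber_fun b w) c = delta0 c.
Proof.
move=> pw; pose n i c := pairing (w^T *m weight_vec c) (Delta i).
have nB i j x : n j (x - weight_coord Delta (w *m lambda i)) = n j x - (i == j)%:R.
  rewrite /n weight_vecB; last exact/integral_par/integral_lambda.
  by rewrite mulmxBr mulmxA (parK pw) mul1mx pairingB lambda_weights.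
rewrite (conv_prod (s := index_enum 'I_r) (y := fun i =>
    weight_coord Delta (w *m lambda i))
  (F := fun i c => (0 <= n i c)%R%:R - (b i)%:R)) ?index_enum_uniq //; last first.
  by move=> i j x ij; rewrite nB (negbTE ij) subr0.
transitivity (\prod_i (n i c == 0)%R%:R : int).
  apply: eq_bigr => i _; rewrite mem_index_enum nB eqxx opprB addrA subrK.
  have : n i c \is a Num.int.
    by apply: integral_par; [apply: par_tr | apply: integral_weight_vec].
  move=> /intrP[m ->]; rewrite -(intrB _ m 1) !ler0z intr_eq0.
  by rewrite subr_ge0; case: m => [[|m]|m].
rewrite /delta0; have -> : (c == 0) = [forall i in [set: 'I_r], n i c == 0].
  apply/idP/'forall_implyP => [/eqP -> i _|h].
    rewrite /n (_ : weight_vec 0 = 0); last by apply/eqP; rewrite weight_vec_eq0.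
    by rewrite mulmx0 /pairing dot0l mulr0 mul0r.
  rewrite -weight_vec_eq0 -[weight_vec c]mul1mx -(parKr pw) -mulmxA.
  rewrite (pairing_eq (v := w^T *m weight_vec c) (y := 0)) ?mulmx0 // => j.
  have /eqP := h j (finset.in_setT _); rewrite /n => ->.
  by rewrite /pairing dot0l mulr0 mul0r.
rewrite -prod_bool; apply: eq_bigl => i; by rewrite finset.in_setT.
Qed.

(** By [signed_countE], since only 0 is orthogonal to all roots. *)
Lemma sum_chamber xi c : generic Phi G xi ->
  \sum_(w <- G) chamber_fun (fun i => (pcoef [set: 'I_r] (w^T *m xi) i < 0)%R) w c
  = (nfull Delta G [set: 'I_r])%:R * (c == 0)%:R.
Proof.
move=> gx; apply: (@intr_inj R); rewrite rmorph_sum /=.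
have GT : parl Delta G [set: 'I_r] = G.
  by apply/all_filterP/allP => w /G_par pw; apply/asboolP.
have := signed_countE Phi_root Delta_simple lambda_weights G_group G_par
  [set: 'I_r] (weight_vec c) gx.
rewrite /signed_count GT.
have -> : orthb Delta [set: 'I_r] (weight_vec c) = (c == 0).
  rewrite -weight_vec_eq0; apply/orthbP/eqP => [h|-> j _]; last exact: dot0l.
  apply: (Delta_orth0 Phi_root Delta_simple lambda_weights) => j.
  by rewrite h ?finset.in_setT.
rewrite rmorphM /= !rmorph_nat => <-.
rewrite -(og_sum_tr _ G_group); apply: eq_bigr => w _.
rewrite /chamber_fun rmorph_prod; apply: eq_big => [i|i _].
  by rewrite finset.in_setT.
by rewrite rmorphB /= !rmorph_nat trmxK pairing_ge0.
Qed.

(** Multiplied by the common denominator, the sum acts on the characteristic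
    function of 0 as on the sum of the chamber functions. *)
Theorem chamber_sum :
  \sum_(w <- G) \prod_(i < r) (1 - tofrac (weight_exp Delta (w *m lambda i)))^-1
  = (nfull Delta G [set: 'I_r])%:R :> {fraction (weight_algebra r)}.
Proof.
have [xi gx] := generic_exists Phi G_group.
pose T w := chamber_fun (fun i => (pcoef [set: 'I_r] (w^T *m xi) i < 0)%R) w.
pose n := nfull Delta G [set: 'I_r].
have GT w : w \in G -> conv (weight_den w) (T w) =1 @delta0 _.
  by move=> /G_par pw c; apply: conv_chamber.
have den0 w : w \in G -> weight_den w != 0.
  move=> wG; apply/eqP => E; have := GT w wG 0.
  by rewrite E conv0 /delta0 eqxx => /eqP; rewrite eq_sym oner_eq0.
pose P := \prod_(w <- G) weight_den w.
pose P' w := \prod_(u <- G | u != w) weight_den u.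
have PE w : w \in G -> P = P' w * weight_den w.
  by move=> wG; rewrite mulrC /P (bigD1_seq w) ?(og_uniq G_group).
have key : \sum_(w <- G) P' w = n%:R * P.
  apply: conv_inj => c; rewrite conv_sum.
  transitivity (conv P (fun c => \sum_(w <- G) T w c) c); last first.
    rewrite /conv mulr_sumr; apply: eq_bigr => y _.
    by rewrite (sum_chamber _ gx) mulrCA.
  rewrite conv_sumr; apply: eq_big_seq => w wG.
  by rewrite (PE w wG) convM; apply: conv_ext => y; rewrite GT.
under eq_bigr do rewrite prod_tofracV.
exact: (sum_tofracV (og_uniq G_group) den0 key).
Qed.

End Weights.

(** * Polynomials, ideals and translations *)

Import mpoly.

Section PolynomialTools.
Variables (R : realType) (r : nat).
Notation V := 'cV[R]_r.
Notation S := {mpoly R[r]}.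
Implicit Types (p q : S) (x y v mu nu : V) (w u : 'M[R]_r).

Lemma mpoly_alg_ind (P : S -> Prop) : (forall c, P c%:MP) -> (forall i, P 'X_i) ->
  (forall p q, P p -> P q -> P (p + q)) -> (forall p q, P p -> P q -> P (p * q)) ->
  forall p, P p.
Proof.
move=> PC PX PD PM p; rewrite (mpolyE p).
apply: (big_ind P); [by rewrite -mpolyC0; apply: PC | exact: PD |].
move=> m _; rewrite -mul_mpolyC; apply: (PM) => //; rewrite mpolyXE_id.
apply: (big_ind P); [exact: PC | exact: PM |].
by move=> i _; elim: (m i) => [|k IH]; rewrite ?expr0 ?exprS; [apply: (PC) | apply: (PM)].
Qed.

Definition ev p x : R := p.@[fun i => x i 0].

Lemma evD p q x : ev (p + q) x = ev p x + ev q x. Proof. exact: mevalD. Qed.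
Lemma evB p q x : ev (p - q) x = ev p x - ev q x. Proof. exact: mevalB. Qed.
Lemma evM p q x : ev (p * q) x = ev p x * ev q x. Proof. exact: mevalM. Qed.
Lemma evC c x : ev c%:MP x = c. Proof. exact: mevalC. Qed.
Lemma evX i x : ev 'X_i x = x i 0. Proof. exact: mevalXU. Qed.
Lemma ev1 x : ev 1 x = 1. Proof. exact: meval1. Qed.
Lemma ev0 x : ev 0 x = 0. Proof. exact: meval0. Qed.

Lemma ev_sum (I : Type) (s : seq I) (P : pred I) (F : I -> S) x :
  ev (\sum_(i <- s | P i) F i) x = \sum_(i <- s | P i) ev (F i) x.
Proof. exact: rmorph_sum. Qed.

Definition lf mu : S := \sum_i (mu i 0)%:MP * 'X_i.

Lemma lfD mu nu : lf (mu + nu) = lf mu + lf nu.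
Proof.
by rewrite -big_split; apply: eq_bigr => i _; rewrite mxE mpolyCD mulrDl.
Qed.

Lemma lfZ c mu : lf (c *: mu) = c%:MP * lf mu.
Proof.
by rewrite mulr_sumr; apply: eq_bigr => i _; rewrite mxE mpolyCM mulrA.
Qed.

Lemma lfN mu : lf (- mu) = - lf mu.
Proof. by rewrite -scaleN1r lfZ mpolyCN mulN1r. Qed.

Lemma lfB mu nu : lf (mu - nu) = lf mu - lf nu.
Proof. by rewrite lfD lfN. Qed.

Lemma lf0 : lf 0 = 0.
Proof. by rewrite -(scale0r 0) lfZ mpolyC0 mul0r. Qed.

Lemma lf_delta i : lf (delta_mx i 0) = 'X_i.
Proof.
rewrite /lf (bigD1 i) //= mxE !eqxx mul1r big1 ?addr0 // => j ji.
by rewrite mxE (negbTE ji) mul0r.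
Qed.

Lemma ev_lf mu x : ev (lf mu) x = dot mu x.
Proof. by rewrite ev_sum; apply: eq_bigr => i _; rewrite evM evC evX. Qed.

Record ideal (I : S -> Prop) : Prop := {
  idl0 : I 0;
  idlD : forall p q, I p -> I q -> I (p + q);
  idlM : forall p q, I q -> I (p * q)
}.

Lemma idlMr I p q : ideal I -> I p -> I (p * q).
Proof. by move=> h Ip; rewrite mulrC; apply: idlM. Qed.

Lemma idlN I p : ideal I -> I p -> I (- p).
Proof. by move=> h Ip; rewrite -mulN1r; apply: idlM. Qed.

Lemma idlB I p q : ideal I -> I p -> I q -> I (p - q).
Proof. by move=> h Ip Iq; apply: idlD => //; apply: idlN. Qed.

Lemma idl_sum I (T : eqType) (s : seq T) (P : pred T) (F : T -> S) : ideal I ->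
  (forall i, i \in s -> P i -> I (F i)) -> I (\sum_(i <- s | P i) F i).
Proof.
move=> h hF; rewrite big_seq_cond; apply: (big_ind I); first exact: idl0.
  exact: idlD.
by move=> i /andP[si Pi]; apply: hF.
Qed.

Definition gen (g : 'I_r -> S) p := exists h : 'I_r -> S, p = \sum_i h i * g i.

Lemma gen_ideal g : ideal (gen g).
Proof.
split.
- by exists (fun=> 0); rewrite big1 // => i _; rewrite mul0r.
- move=> _ _ [h ->] [h' ->]; exists (fun i => h i + h' i).
  by rewrite -big_split; apply: eq_bigr => i _; rewrite mulrDl.
- move=> p _ [h ->]; exists (fun i => p * h i).
  by rewrite mulr_sumr; apply: eq_bigr => i _; rewrite mulrA.
Qed.

Lemma gen_in g i : gen g (g i).
Proof.
exists (fun j => (j == i)%:R); rewrite (bigD1 i) //= eqxx mul1r big1 ?addr0 //.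
by move=> j /negbTE ->; rewrite mul0r.
Qed.

Lemma idl_gen I g p : ideal I -> (forall i, I (g i)) -> gen g p -> I p.
Proof.
by move=> h hg [k ->]; apply: idl_sum => // i _ _; apply: idlM.
Qed.

(** Induction on p, where a product is treated by
    p q - p(x) q(x) = q (p - p(x)) + p(x) (q - q(x)). *)
Lemma hadamard p x : gen (fun i => 'X_i - (x i 0)%:MP) (p - (ev p x)%:MP).
Proof.
set g := fun i => _; have h := gen_ideal g.
elim/mpoly_alg_ind: p => [c|i|p q hp hq|p q hp hq].
- by rewrite evC subrr; apply: idl0.
- by rewrite evX; apply: (gen_in g).
- by rewrite evD mpolyCD opprD addrACA; apply: idlD.
rewrite evM mpolyCM (_ : _ - _ = q * (p - (ev p x)%:MP)
  + (ev p x)%:MP * (q - (ev q x)%:MP)); last by ring.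
by apply: idlD => //; apply: idlM.
Qed.

Lemma vanish_in I p x : ideal I -> (forall i, I ('X_i - (x i 0)%:MP)) ->
  ev p x = 0 -> I p.
Proof.
move=> h hX px; have := hadamard p x; rewrite px mpolyC0 subr0.
exact: idl_gen.
Qed.

Notation act := (@Exponents.mpoly_act R r).

Lemma ev_act w p x : ev (act w p) x = ev p (w *m x).
Proof.
elim/mpoly_alg_ind: p => [c|i|p q|p q]; rewrite /act.
- by rewrite comp_mpolyC !evC.
- rewrite comp_mpolyXU -tnth_nth tnth_mktuple ev_sum evX mxE.
  by apply: eq_bigr => j _; rewrite -mul_mpolyC evM evC evX.
- by rewrite rmorphD !evD => -> ->.
- by rewrite rmorphM !evM => -> ->.
Qed.

Lemma act_lf w mu : act w (lf mu) = lf (w^T *m mu).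
Proof.
rewrite /act /lf rmorph_sum.
under eq_bigr => i _.
  rewrite rmorphM /= comp_mpolyC comp_mpolyXU -tnth_nth tnth_mktuple mulr_sumr.
  over.
rewrite exchange_big; apply: eq_bigr => j _; rewrite mxE rmorph_sum mulr_suml.
apply: eq_bigr => i _ /=.
by rewrite mxE mpolyCM -mul_mpolyC mulrA (mulrC (w i j)%:MP).
Qed.

Lemma actD w p q : act w (p + q) = act w p + act w q.
Proof. exact: rmorphD. Qed.

Lemma actM w p q : act w (p * q) = act w p * act w q.
Proof. exact: rmorphM. Qed.

Lemma act_act w u p : act w (act u p) = act (u *m w) p.
Proof.
elim/mpoly_alg_ind: p => [c|i|p q|p q].
- by rewrite /act !comp_mpolyC.
- by rewrite -lf_delta !act_lf trmx_mul mulmxA.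
- by rewrite !actD => -> ->.
- by rewrite !actM => -> ->.
Qed.

Variable v : V.

Definition tr p : S := p \mPo [tuple 'X_i + (v i 0)%:MP | i < r].

Lemma ev_tr p x : ev (tr p) x = ev p (x + v).
Proof.
elim/mpoly_alg_ind: p => [c|i|p q|p q]; rewrite /tr.
- by rewrite comp_mpolyC !evC.
- by rewrite comp_mpolyXU -tnth_nth tnth_mktuple evD evC !evX mxE.
- by rewrite rmorphD !evD => -> ->.
- by rewrite rmorphM !evM => -> ->.
Qed.

Lemma tr_lf mu : tr (lf mu) = lf mu + (dot mu v)%:MP.
Proof.
rewrite /tr /lf rmorph_sum rmorph_sum -big_split; apply: eq_bigr => i _ /=.
by rewrite rmorphM /= comp_mpolyC comp_mpolyXU -tnth_nth tnth_mktuple mulrDr mpolyCM.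
Qed.

Fact sh_key : unit. Proof. exact: tt. Qed.

(** The translation y |-> y + t v, with t the variable of {poly S}.  It is
    locked, since terms in iterated polynomial rings are costly to unfold. *)
Definition sh : S -> {poly S} := locked_with sh_key
  (mmap (@polyC S \o @mpolyC r R) (fun i => ('X_i)%:P + ((v i 0)%:MP)%:P * 'X)).

Lemma shC c : sh c%:MP = (c%:MP)%:P.
Proof. by rewrite /sh unlock; apply: mmapC. Qed.

Lemma shX i : sh 'X_i = ('X_i)%:P + ((v i 0)%:MP)%:P * 'X.
Proof. by rewrite /sh unlock mmapX mmap1U. Qed.

Lemma shD p q : sh (p + q) = sh p + sh q.
Proof. by rewrite /sh unlock rmorphD. Qed.

Lemma shM p q : sh (p * q) = sh p * sh q.
Proof. by rewrite /sh unlock rmorphM. Qed.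

Lemma sh_horner (Q : {poly S}) p : (map_poly sh Q).[sh p] = sh Q.[p].
Proof. by rewrite /sh unlock horner_map. Qed.

Lemma sh_sum (I : Type) (s : seq I) (P : pred I) (F : I -> S) :
  sh (\sum_(i <- s | P i) F i) = \sum_(i <- s | P i) sh (F i).
Proof. by rewrite /sh unlock rmorph_sum. Qed.

Lemma sh_prod (I : Type) (s : seq I) (P : pred I) (F : I -> S) :
  sh (\prod_(i <- s | P i) F i) = \prod_(i <- s | P i) sh (F i).
Proof. by rewrite /sh unlock rmorph_prod. Qed.

Lemma sh_lf mu : sh (lf mu) = (lf mu)%:P + ((dot mu v)%:MP)%:P * 'X.
Proof.
rewrite /lf sh_sum (rmorph_sum (@polyC S)) /dot (rmorph_sum (@mpolyC r R)).
rewrite (rmorph_sum (@polyC S)) mulr_suml -big_split; apply: eq_bigr => i _ /=.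
by rewrite shM shC shX mulrDr mulrA -!polyCM -mpolyCM.
Qed.

Lemma sh0 p : (sh p).[0] = p.
Proof.
elim/mpoly_alg_ind: p => [c|i|p q|p q].
- by rewrite shC hornerC.
- by rewrite shX hornerD hornerC hornerMX mulr0 addr0.
- by move=> hp hq; rewrite shD hornerD; congr (_ + _).
- by move=> hp hq; rewrite shM hornerM; congr (_ * _).
Qed.

Lemma sh1 p : (sh p).[1] = tr p.
Proof.
elim/mpoly_alg_ind: p => [c|i|p q|p q]; rewrite /tr.
- by rewrite shC hornerC comp_mpolyC.
- rewrite shX hornerD hornerMX !hornerC mulr1.
  by rewrite comp_mpolyXU -tnth_nth tnth_mktuple.
- by move=> hp hq; rewrite shD hornerD rmorphD; congr (_ + _).
- by move=> hp hq; rewrite shM hornerM rmorphM; congr (_ * _).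
Qed.

(** The difference quotient (p(y + t v) - p(y)) / t. *)
Definition dq p : {poly S} := locked_with sh_key (drop_poly 1) (sh p).

Lemma shE p : sh p = p%:P + dq p * 'X.
Proof.
rewrite /dq unlock -[LHS](poly_take_drop 1); congr (_ + _ * _).
apply/polyP => i; rewrite coef_take_poly coefC ltnS leqn0.
by case: eqP => // ->; rewrite -horner_coef0 sh0.
Qed.

Lemma dq1 p : (dq p).[1] = tr p - p.
Proof.
by rewrite -sh1 shE hornerD hornerC hornerMX mulr1 addrC addKr.
Qed.

Lemma dqD p q : dq (p + q) = dq p + dq q.
Proof. by rewrite /dq unlock shD linearD. Qed.

Lemma dqM p q : dq (p * q) = dq p * sh q + p%:P * dq q.
Proof.
apply: (mulIf (negbT (polyX_eq0 _))); apply: (addrI (p * q)%:P).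
rewrite -(shE (p * q)) shM (shE p) (shE q) polyCM.
by move: (dq p) (dq q) p%:P q%:P => a b x y; ring.
Qed.

Lemma dqC c : dq c%:MP = 0.
Proof.
apply: (mulIf (negbT (polyX_eq0 _))); apply: (addrI (c%:MP)%:P).
by rewrite -shE shC mul0r addr0.
Qed.

(** If the values of a polynomial of degree d are split according to powers of
    t, then the coefficient of t^k has degree d - k. *)
Definition hgraded d (P : {poly S}) :=
  forall k, if (k <= d)%N then is_true (P`_k \is (d - k).-homog) else P`_k = 0.

Lemma hgradedM d e P Q : hgraded d P -> hgraded e Q -> hgraded (d + e) (P * Q).
Proof.
move=> hP hQ k; have coefPQ : forall i, (i <= k)%N ->
    P`_i * Q`_(k - i) = 0 \/ [/\ (i <= d)%N, (k - i <= e)%N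
    & P`_i * Q`_(k - i) \is (d - i + (e - (k - i))).-homog].
  move=> i ik; have := hP i; case: leqP => id hPi; last by left; rewrite hPi mul0r.
  have := hQ (k - i)%N; case: leqP => ie hQi; last by left; rewrite hQi mulr0.
  by right; split=> //; apply: dhomogM.
rewrite coefM; case: leqP => kde.
  apply: rpred_sum => i _; case: (coefPQ i) => [|->|[id ie h]].
  - by rewrite -ltnS.
  - exact: dhomog0.
  have -> : (d + e - k = d - i + (e - (k - i)))%N; last by [].
  have ik : (i <= k)%N by rewrite -ltnS.
  by lia.
rewrite big1 // => i _; case: (coefPQ i) => [|//|[id ie h]]; first by rewrite -ltnS.
have ik : (i <= k)%N by rewrite -ltnS.
by move: kde; rewrite ltnNge -{1}(subnKC ik) leq_add.
Qed.

Lemma hgraded_sh d p : p \is d.-homog -> hgraded d (sh p).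
Proof.
have hX i : hgraded 1 (sh 'X_i).
  move=> k; rewrite shX coefD coefC coefMX coefC.
  case: k => [|[|k]] /=; rewrite ?addr0 ?add0r //.
    by rewrite dhomogX /= mdeg1.
  by rewrite -[_%:MP]mulr1 mul_mpolyC dhomogZ // dhomog1.
have h1 : hgraded 0 1 by case=> [|k]; rewrite coef1 //= dhomog1.
have hm m : hgraded (mdeg m) (sh 'X_[m]).
  rewrite mpolyXE_id mdegE sh_prod.
  elim/big_rec2: _ => // i d' P _ hP; apply: hgradedM => //.
  elim: (m i) => [|k IH]; first by rewrite expr0 -mpolyC1 shC.
  by rewrite exprS shM -[k.+1]add1n; apply: hgradedM.
move=> hp k; rewrite (mpolyE p) sh_sum coef_sum.
have hmk m : m \in msupp p -> if (k <= d)%N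
    then is_true ((sh (p@_m *: 'X_[m]))`_k \is (d - k).-homog) else (sh (p@_m *: 'X_[m]))`_k = 0.
  move=> /(dhomog_mf hp) /= md; have := hm m k; rewrite md.
  rewrite -mul_mpolyC shM shC coefCM; case: leqP => _ h; last by rewrite h mulr0.
  by rewrite mul_mpolyC dhomogZ.
case: leqP hmk => kd hmk; first by rewrite big_seq rpred_sum.
by rewrite big_seq big1.
Qed.

End PolynomialTools.

(** * Relations between the points of an orbit *)

Section OrbitRelations.
Variables (R : realType) (r : nat) (G : seq 'M[R]_r).
Notation V := 'cV[R]_r.
Notation S := {mpoly R[r]}.
Notation act := (@Exponents.mpoly_act R r).
Hypothesis (G_group : orth_group G).
Variable (f : r.-tuple S).
Hypothesis f_gen : forall q : S, (forall w, w \in G -> act w q = q) ->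
  exists p : S, q = p \mPo f.
Variable v : V.
Implicit Types (p q : S) (x y mu nu : V) (w u : 'M[R]_r).
Notation dq := (dq v).
Notation sh := (sh v).

Definition quot_gen (P : {poly S}) :=
  exists h : 'I_r -> {poly S}, P = \sum_i h i * dq (tnth f i).

Lemma quot_genD P Q : quot_gen P -> quot_gen Q -> quot_gen (P + Q).
Proof.
move=> [h ->] [h' ->]; exists (fun i => h i + h' i).
by rewrite -big_split; apply: eq_bigr => i _; rewrite mulrDl.
Qed.

Lemma quot_genM P Q : quot_gen Q -> quot_gen (P * Q).
Proof.
move=> [h ->]; exists (fun i => P * h i).
by rewrite mulr_sumr; apply: eq_bigr => i _; rewrite mulrA.
Qed.

Lemma quot_gen0 : quot_gen 0.
Proof. by exists (fun=> 0); rewrite big1 // => i _; rewrite mul0r. Qed.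

(** An invariant is a polynomial in the f_i, and the difference quotient obeys a
    product rule. *)
Lemma dq_invariant q : (forall w, w \in G -> act w q = q) -> quot_gen (dq q).
Proof.
move=> /f_gen[p ->]; elim/mpoly_alg_ind: p => [c|i|p q' hp hq|p q' hp hq].
- by rewrite comp_mpolyC dqC; apply: quot_gen0.
- rewrite comp_mpolyXU -tnth_nth; exists (fun j => (j == i)%:R).
  rewrite (bigD1 i) //= eqxx mul1r big1 ?addr0 // => j /negbTE ->.
  by rewrite mul0r.
- by rewrite rmorphD dqD; apply: quot_genD.
rewrite rmorphM dqM; apply: quot_genD; last exact: quot_genM.
by rewrite mulrC; apply: quot_genM.
Qed.

(** The monic polynomial whose roots are the linear forms of an orbit has
    invariant coefficients.  Its value at the translate of one of its roots is
    divisible by t, with a quotient in the ideal of the difference quotients. *)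
Lemma orbit_relation (orb : seq V) mu : uniq orb ->
    (forall w nu, w \in G -> nu \in orb -> w *m nu \in orb) ->
    mu \in orb -> dot mu v != 0 ->
  quot_gen (\prod_(nu <- orb | nu != mu)
              ((lf (mu - nu))%:P + ((dot mu v)%:MP)%:P * 'X)).
Proof.
move=> uo Go muo muv.
pose Q : {poly S} := \prod_(nu <- orb) ('X - (lf nu)%:P).
have Qinv k : quot_gen (dq Q`_k).
  apply: dq_invariant => w wG.
  have -> : act w Q`_k = (map_poly (comp_mpoly
     [tuple \sum_j w i j *: 'X_j | i < r]) Q)`_k by rewrite coef_map.
  congr ((polyseq _)`_k); rewrite rmorph_prod /=.
  have pm : perm_eq [seq w^T *m nu | nu <- orb] orb.
    apply: uniq_perm => //.
      rewrite map_inj_uniq // => nu nu' /(congr1 (mulmx w)).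
      by rewrite !(og_trVl _ G_group wG).
    move=> nu; apply/mapP/idP => [[nu' h ->]|h].
      by apply: Go => //; apply: og_tr.
    by exists (w *m nu); [apply: Go | rewrite (og_trKl _ G_group wG)].
  rewrite /Q -[RHS](perm_big _ pm) big_map; apply: eq_bigr => nu _.
  by rewrite rmorphB /= map_polyX map_polyC /= -act_lf.
(* Q vanishes at lf mu, and the translate of Q at the translate L of lf mu, so
   that Q at L is minus a combination of difference quotients of coefficients
   (E3).  On the other hand the factor mu of Q at L is a multiple of t (E4). *)
have sh00 : sh 0 = 0 by rewrite -mpolyC0 shC.
have [L L_def] : {L | L = sh (lf mu)} by eexists.
have E1 : (map_poly sh Q).[L] = 0.
  have Q0 : Q.[lf mu] = 0.
    rewrite /Q horner_prod; apply/eqP; rewrite prodf_seq_eq0.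
    by apply/hasP; exists mu => //=; rewrite hornerXsubC subrr.
  by rewrite L_def sh_horner Q0.
have E2 : (map_poly (@polyC S) Q).[L] = \prod_(nu <- orb) (L - (lf nu)%:P).
  rewrite rmorph_prod horner_prod; apply: eq_bigr => nu _.
  by rewrite rmorphB /= map_polyX map_polyC /= hornerXsubC.
have E3 : (map_poly (@polyC S) Q).[L] = - ((\sum_(k < size Q) L ^+ k * dq Q`_k) * 'X).
  rewrite -[LHS]opprK -[- (map_poly _ _).[L]]add0r -{1}E1; congr (- _).
  rewrite mulr_suml.
  rewrite (horner_coef_wide (n := size Q) L (p := map_poly sh Q)) ?size_poly //.
  rewrite (horner_coef_wide (n := size Q) L) ?size_poly // -sumrB.
  apply: eq_bigr => k _; rewrite (coef_map_id0 _ _ sh00) coef_map /= shE.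
  by rewrite -mulrBl addrC addKr mulrC mulrA.
have LE nu : L - (lf nu)%:P = (lf (mu - nu))%:P + ((dot mu v)%:MP)%:P * 'X.
  by rewrite L_def sh_lf lfB polyCB addrAC.
set P := \prod_(nu <- orb | nu != mu) _.
have E4 : \prod_(nu <- orb) (L - (lf nu)%:P) = (((dot mu v)%:MP)%:P * 'X) * P.
  have Lmu : L - (lf mu)%:P = ((dot mu v)%:MP)%:P * 'X.
    by rewrite (LE mu) subrr lf0 polyC0 add0r.
  rewrite (bigD1_seq mu muo uo); congr (_ * _); first exact: Lmu.
  by apply: eq_bigr => nu _; apply: LE.
have E5 : ((dot mu v)%:MP)%:P * P = - \sum_(k < size Q) L ^+ k * dq Q`_k.
  apply: (mulIf (negbT (polyX_eq0 _))).
  by rewrite mulNr -E3 E2 E4 mulrAC.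
have -> : P = (((- (dot mu v)^-1)%:MP)%:P) * \sum_(k < size Q) L ^+ k * dq Q`_k.
  rewrite -[X in _ * X]opprK -E5 mpolyCN polyCN mulrNN mulrA -polyCM -mpolyCM.
  by rewrite mulVf // mul1r.
apply: quot_genM; apply: (big_ind quot_gen); first exact: quot_gen0.
  exact: quot_genD.
by move=> k _; apply: quot_genM.
Qed.

(** The difference quotients at t = 0 and t = 1.  The former is the derivative
    of the invariant in the direction v, which is the component of highest
    degree of the latter. *)
Definition g0 i : S := (dq (tnth f i)).[0].
Definition g1 i : S := tr v (tnth f i) - tnth f i.

Lemma quot_gen_ev0 P : quot_gen P -> gen g0 P.[0].
Proof.
move=> [h ->]; exists (fun i => (h i).[0]); rewrite horner_sum.
by apply: eq_bigr => i _; rewrite hornerM.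
Qed.

Lemma quot_gen_ev1 P : quot_gen P -> gen g1 P.[1].
Proof.
move=> [h ->]; exists (fun i => (h i).[1]); rewrite horner_sum.
by apply: eq_bigr => i _; rewrite hornerM dq1.
Qed.

Lemma orbit_relation_ev (orb : seq V) mu : uniq orb ->
    (forall w nu, w \in G -> nu \in orb -> w *m nu \in orb) ->
    mu \in orb -> dot mu v != 0 ->
  gen g0 (\prod_(nu <- orb | nu != mu) (lf (mu - nu) + (0%:MP))) /\
  gen g1 (\prod_(nu <- orb | nu != mu) (lf (mu - nu) + (dot mu v)%:MP)).
Proof.
move=> uo Go muo muv; have h := orbit_relation uo Go muo muv; split.
  have := quot_gen_ev0 h; rewrite horner_prod.
  under eq_bigr do rewrite hornerD hornerMX !hornerC mulr0.
  by under [X in _ -> gen _ X]eq_bigr do rewrite mpolyC0.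
have := quot_gen_ev1 h; rewrite horner_prod.
by under eq_bigr do rewrite hornerD hornerMX !hornerC mulr1.
Qed.

End OrbitRelations.

Section PointIdeals.
Variables (R : realType) (r : nat).
Notation V := 'cV[R]_r.
Notation S := {mpoly R[r]}.
Implicit Types (p q : S) (x y mu nu : V) (I : S -> Prop) (pts : seq V).

Lemma all2_catl (T U : Type) (e : T -> U -> bool) s1 s2 t1 t2 :
  size s1 = size t1 -> all2 e (s1 ++ s2) (t1 ++ t2) = all2 e s1 t1 && all2 e s2 t2.
Proof.
by elim: s1 t1 => [|x s1 IH] [|y t1] //= [/IH ->]; rewrite andbA.
Qed.

Definition vanish_on (h : seq S) pts := all2 (fun p x => ev p x == 0) h pts.

(** The product of the maximal ideals of the points is contained in I. *)
Definition max_product I pts := forall h, vanish_on h pts -> I (\prod_(p <- h) p).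

Definition adjoin I q p := exists a, I (p - a * q).

Lemma adjoin_ideal I q : ideal I -> ideal (adjoin I q).
Proof.
move=> hI; split.
- by exists 0; rewrite mul0r subrr; apply: idl0.
- move=> p p' [a ha] [a' ha']; exists (a + a').
  by rewrite mulrDl opprD addrACA; apply: idlD.
- move=> p p' [a ha]; exists (p * a).
  by rewrite -mulrA -mulrBr; apply: idlM.
Qed.

Lemma adjoin_sub I q p : ideal I -> I p -> adjoin I q p.
Proof. by move=> _ Ip; exists 0; rewrite mul0r subr0. Qed.

Lemma adjoin_in I q : ideal I -> adjoin I q q.
Proof. by move=> hI; exists 1; rewrite mul1r subrr; apply: idl0. Qed.

(** The product of the ideals (I, E t) is contained in the ideal generated by I
    and the product of the E t. *)
Lemma max_product_adjoin (T : eqType) I (s : seq T) (E : T -> S) (Z : Prop) :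
    ideal I ->
    (forall t, t \in s -> exists pts, (Z -> {in pts, forall x, x = 0}) /\
       max_product (adjoin I (E t)) pts) ->
  exists pts, (Z -> {in pts, forall x, x = 0}) /\
    max_product (adjoin I (\prod_(t <- s) E t)) pts.
Proof.
move=> hI; elim: s => [_|t s IH hs].
  exists [::]; split=> // -[|//] _; exists 1; rewrite !big_nil mulr1 subrr.
  exact: idl0.
have [|pts [Zp hp]] := IH; first by move=> t' t's; apply: hs; rewrite inE t's orbT.
have [pts' [Zp' hp']] := hs t (mem_head _ _).
exists (pts' ++ pts); split.
  by move=> z x; rewrite mem_cat => /orP[/(Zp' z)|/(Zp z)].
move=> h; rewrite /vanish_on => hv.
have sz : size h = size (pts' ++ pts) by move: hv; rewrite all2E => /andP[/eqP].
move: hv; rewrite -(cat_take_drop (size pts') h) all2_catl; last first.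
  by rewrite size_takel // sz size_cat leq_addr.
move=> /andP[/hp'[a ha] /hp[b hb]]; exists (a * b).
rewrite big_cat big_cons /=; move: ha hb.
set A := \prod_(p <- take _ _) p; set B := \prod_(p <- drop _ _) p.
set C := \prod_(t <- s) E t => ha hb.
have -> : A * B - a * b * (E t * C) = B * (A - a * E t) + a * E t * (B - b * C) by ring.
by apply: idlD => //; apply: idlM.
Qed.

(** The pairs (nu, c) with A nu c form a subspace, and the condition on X says
    that its first components contain a spanning set. *)
Lemma subspace_graph_total (X : seq V) (A : V -> R -> Prop) :
    A 0 0 -> (forall nu c nu' c', A nu c -> A nu' c' -> A (nu + nu') (c + c')) ->
    (forall a nu c, A nu c -> A (a *: nu) (a * c)) ->
    (forall nu, nu \in X -> exists c, A nu c) ->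
    (forall x, (forall nu, nu \in X -> dot nu x = 0) -> x = 0) ->
  forall nu, exists c, A nu c.
Proof.
move=> A0 AD AZ AX X0 nu.
pose M : 'M[R]_(size X, r) := \matrix_(k, j) (X`_k) j 0.
have Mfull : row_full M.
  rewrite /row_full -mxrank_tr -[_ == _]/(row_free M^T) -kermx_eq0.
  apply/rowV0P => x /sub_kermxP xM; apply: trmx_inj; rewrite trmx0; apply: X0 => nu' /(nthP 0)[k kX <-].
  have /rowP/(_ (Ordinal kX)) := xM; rewrite !mxE => <-.
  by rewrite dotC; apply: eq_bigr => j _; rewrite !mxE.
have /submxP[a aM] : (nu^T <= M)%MS by apply: submx_full.
have AXk (k : 'I_(size X)) : exists c, A X`_k c by apply: AX; rewrite mem_nth.
have /choice[c hc] := AXk.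
exists (\sum_k a 0 k * c k).
have -> : nu = \sum_k a 0 k *: X`_k.
  apply/colP => j; have /rowP/(_ j) := aM; rewrite !mxE => ->.
  by rewrite summxE; apply: eq_bigr => k _; rewrite !mxE.
elim/big_rec2: _ => // k nu' c' _ h; apply: AD => //; exact: AZ.
Qed.

(** Modulo I one factor of each orbit relation can be chosen to vanish.  Any
    choice gives affine forms whose linear parts span, that is, a point (or the
    unit ideal), and the product over all choices of the ideals of these points
    is contained in I. *)
Lemma orbit_points (Om : seq V) (orb : V -> seq V) (c : V -> R) I (X : seq V)
    (Z := forall mu, c mu = 0) : ideal I ->
    (forall nu, nu \in X -> exists b, (Z -> b = 0) /\ I (lf nu + b%:MP)) ->
    (forall mu, mu \in Om ->
      I (\prod_(nu <- orb mu | nu != mu) (lf (mu - nu) + (c mu)%:MP))) ->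
    (forall x, x != 0 -> (forall nu, nu \in X -> dot nu x = 0) ->
      exists2 mu, mu \in Om &
        forall nu, nu \in orb mu -> nu != mu -> dot (mu - nu) x != 0) ->
  exists pts, (Z -> {in pts, forall x, x = 0}) /\ max_product I pts.
Proof.
elim: Om I X => [|mu Om IH] I X hI hX hO hS.
  pose A nu b := (Z -> b = 0) /\ I (lf nu + b%:MP).
  have span : forall nu, exists b, A nu b.
    apply: (subspace_graph_total (X := X)) => //.
    - by split=> //; rewrite lf0 mpolyC0 addr0; apply: idl0.
    - move=> nu b nu' b' [zb hb] [zb' hb']; split.
        by move=> z; rewrite zb // zb' // addr0.
      by rewrite lfD mpolyCD addrACA; apply: idlD.
    - move=> a nu b [zb hb]; split; first by move=> z; rewrite zb // mulr0.
      by rewrite lfZ mpolyCM -mulrDr; apply: idlM.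
    - move=> x hx; apply/eqP/negPn/negP => x0.
      by have [] := hS x x0 hx.
  have /choice[b hb] : forall i : 'I_r, exists b, A (delta_mx i 0) b by [].
  exists [:: \col_i - b i]; split.
    move=> z x; rewrite inE => /eqP ->; apply/colP => i; rewrite !mxE.
    by have [-> //] := hb i; rewrite oppr0.
  case=> [|p [|p' h]]; rewrite /vanish_on //= ?andbF // andbT big_seq1 => /eqP hp.
  apply: (vanish_in hI) hp => i; have [_] := hb i.
  by rewrite lf_delta mxE mpolyCN opprK.
have [||pts [Zp hp]] := @max_product_adjoin _ I
    [seq nu <- orb mu | nu != mu] (fun nu => lf (mu - nu) + (c mu)%:MP) Z => //.
  move=> nu; rewrite mem_filter => /andP[nu_mu nuo].
  have hA := adjoin_ideal (lf (mu - nu) + (c mu)%:MP) hI.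
  apply: (IH _ ((mu - nu) :: X)) => //.
  - move=> nu'; rewrite inE => /predU1P[->|/hX[b [zb hb]]].
      by exists (c mu); split; [move=> z; apply: z | apply: adjoin_in].
    by exists b; split=> //; apply: adjoin_sub.
  - by move=> mu' mu'O; apply: adjoin_sub => //; apply: hO; rewrite inE mu'O orbT.
  move=> x x0 hx; have [|mu' + hmu'] := hS x x0.
    by move=> nu' nu'X; apply: hx; rewrite inE nu'X orbT.
  rewrite inE => /predU1P[E|mu'O]; last by exists mu'.
  by have := hmu' nu; rewrite E => /(_ nuo nu_mu); rewrite hx ?mem_head ?eqxx.
exists pts; split=> // h /hp[a]; rewrite big_filter => ha.
rewrite -[X in I X](subrK (a * \prod_(nu <- orb mu | nu != mu)
   (lf (mu - nu) + (c mu)%:MP))).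
by apply: idlD => //; apply: idlM => //; apply: hO; rewrite mem_head.
Qed.

End PointIdeals.

(** * Lowering the degree *)

Section Degree.
Variables (R : realType) (r : nat).
Notation V := 'cV[R]_r.
Notation S := {mpoly R[r]}.
Variables (f : r.-tuple S) (e : 'I_r -> nat) (v : V).
Hypothesis f_hom : forall i, tnth f i \is (e i).+1.-homog.
Implicit Types (p q : S).
Notation g0 := (g0 f v).
Notation g1 := (g1 f v).

Lemma msize_homog d p : p \is d.-homog -> (msize p <= d.+1)%N.
Proof.
move=> hp; rewrite msizeE; apply/bigmax_leqP_seq => m mp _.
by rewrite (dhomog_mf hp).
Qed.

Lemma msizeD n p q : (msize p <= n)%N -> (msize q <= n)%N -> (msize (p + q) <= n)%N.
Proof. by move=> hp hq; rewrite (leq_trans (msizeD_le _ _)) // geq_max hp. Qed.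

Lemma msize_sumle (T : eqType) (s : seq T) (F : T -> S) n :
  (forall t, t \in s -> (msize (F t) <= n)%N) -> (msize (\sum_(t <- s) F t) <= n)%N.
Proof.
move=> h; rewrite big_seq; apply: (big_ind (fun p => (msize p <= n)%N)) => //.
  by rewrite msize0.
by move=> p q; apply: msizeD.
Qed.

Lemma msizeZle n c p : (msize p <= n)%N -> (msize (c *: p) <= n)%N.
Proof. by apply: leq_trans; apply: msizeZ_le. Qed.

Lemma msizeMle a b p q : (msize p <= a)%N -> (msize q <= b.+1)%N ->
  (msize (p * q) <= a + b)%N.
Proof.
move=> hp hq; have [->|p0] := eqVneq p 0; first by rewrite mul0r msize0.
have [->|q0] := eqVneq q 0; first by rewrite mulr0 msize0.
rewrite msizeM // -subn1 leq_subLR add1n -addnS.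
exact: leq_add.
Qed.

Lemma g0_homog i : g0 i \is (e i).-homog.
Proof.
rewrite /g0 horner_coef0 /dq unlock coef_drop_poly add0n.
by have := hgraded_sh v (f_hom i) 1; rewrite /= subn1.
Qed.

(** The coefficient of t^k in f_i(y + t v) has degree e_i + 1 - k, so that all
    but the first one of the difference quotient have degree less than e_i. *)
Lemma g1_g0 i : (msize (g1 i - g0 i) <= e i)%N.
Proof.
have -> : g1 i = (dq v (tnth f i)).[1] by rewrite dq1.
rewrite /g0 horner_coef0 horner_coef.
set P := dq v _; have Pk k : (0 < k)%N -> (msize (P`_k) <= e i)%N.
  case: k => // k _; rewrite /P /dq unlock coef_drop_poly.
  have := hgraded_sh v (f_hom i) (k.+1 + 1)%N; case: (leqP (k.+1 + 1) (e i).+1) => [le|_ ->].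
    move=> /msize_homog h; apply: leq_trans h _; lia.
  by rewrite msize0.
case sP: (size P) => [|n].
  move/eqP: sP; rewrite size_poly_eq0 => /eqP ->.
  by rewrite big_ord0 coef0 subrr msize0.
rewrite big_ord_recl expr0 mulr1 addrAC subrr add0r.
by apply: msize_sumle => k _; rewrite expr1n mulr1 Pk.
Qed.

Lemma msize_g1 i : (msize (g1 i) <= (e i).+1)%N.
Proof.
rewrite -(subrK (g0 i) (g1 i)); apply: msizeD.
  by rewrite (leq_trans (g1_g0 i)).
exact/msize_homog/g0_homog.
Qed.

Lemma pihomogM n d p q : q \is d.-homog ->
  pihomog mdeg n (p * q) = (if (d <= n)%N then pihomog mdeg (n - d) p else 0) * q.
Proof.
move=> hq; rewrite {1}(mpolyE p) mulr_suml raddf_sum /=.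
have E m : pihomog mdeg n ((p@_m *: 'X_[m]) * q) =
    (if (mdeg m + d == n)%N then p@_m *: 'X_[m] else 0) * q.
  have hm : (p@_m *: 'X_[m]) * q \is (mdeg m + d).-homog.
    by apply: dhomogM => //; rewrite dhomogZ // dhomogX.
  case: eqP => [<-|/eqP ne]; first by rewrite pihomog_dE.
  by rewrite (pihomog_ne0 ne) ?mul0r.
under eq_bigr do rewrite E.
rewrite -mulr_suml; congr (_ * _); case: leqP => dn.
  rewrite [in RHS](mpolyE p) raddf_sum; apply: eq_bigr => m _ /=.
  rewrite linearZ /= pihomogX -(eqn_add2r d (mdeg m)) subnK //.
  by case: ifP; rewrite ?scaler0.
by rewrite big1 // => m _; case: eqP => // E'; lia.
Qed.

Hypothesis top : exists M, forall s : seq S, size s = M ->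
  (forall p, p \in s -> ev p 0 = 0) -> gen g0 (\prod_(p <- s) p).

Lemma monomial_split M (m : 'X_{1..r}) : (M <= mdeg m)%N ->
  exists (s : seq 'I_r) (m' : 'X_{1..r}), size s = M /\
    'X_[m] = (\prod_(p <- [seq 'X_i | i <- s]) p) * 'X_[m'] :> S.
Proof.
elim: M m => [|M IH] m hm; first by exists [::], m; rewrite big_nil mul1r.
have [|s [m' [sz E]]] := IH m; first exact: ltnW.
have [i mi] : exists i, (0 < m' i)%N.
  apply/not_existsP => H; have m0 : m' = 0%MM.
    by apply/mnmP => i; rewrite mnm0E; apply/eqP; rewrite -leqn0 leqNgt; apply/negP/H.
  have := congr1 (fun p : S => msize p) E; rewrite m0 mpolyX0 mulr1 msizeX => E'.
  have : (msize (\prod_(p <- [seq 'X_i | i <- s]) p : S) <= M.+1)%N.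
    rewrite -sz; elim: (s) => [|j t IHt]; first by rewrite big_nil msize1.
    rewrite big_cons mulrC /= -addn1; apply: msizeMle => //.
    by rewrite msizeX mdeg1.
  by rewrite -E' ltnNge hm.
exists (i :: s), (m' - U_(i))%MM; rewrite /= sz; split=> //.
have Em : 'X_[m'] = 'X_i * 'X_[m' - U_(i)] :> S.
  by rewrite -mpolyXD addmC submK // lep1mP -lt0n.
rewrite E {1}Em big_cons; move: (\prod_(p <- _) p) ('X_i) => P x.
by rewrite mulrCA mulrA.
Qed.

(** A monomial of large degree n lies in the ideal of the leading forms g0 i.  The
    coefficients may be taken homogeneous, of degrees n - e i, and replacing g0
    by g1 changes only terms of lower degree. *)
Lemma lower_degree : exists M, forall n p, (M <= n)%N -> (msize p <= n.+1)%N ->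
  exists h : 'I_r -> S, (forall i, (msize (h i) <= n.+1 - e i)%N) /\
    (msize (p - \sum_i h i * g1 i) <= n)%N.
Proof.
have [M hM] := top; exists M => n p Mn hp.
pose Q p := exists h : 'I_r -> S, (forall i, (msize (h i) <= n.+1 - e i)%N) /\
    (msize (p - \sum_i h i * g1 i) <= n)%N.
have Q0 q : (msize q <= n)%N -> Q q.
  move=> hq; exists (fun=> 0); split=> [i|]; first by rewrite msize0.
  by rewrite big1 ?subr0 // => i _; rewrite mul0r.
have QD p1 p2 : Q p1 -> Q p2 -> Q (p1 + p2).
  move=> [h1 [b1 s1]] [h2 [b2 s2]]; exists (fun i => h1 i + h2 i).
  split=> [i|]; first exact: msizeD.
  under eq_bigr do rewrite mulrDl.
  by rewrite big_split /= opprD addrACA; apply: msizeD.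
have QZ c p1 : Q p1 -> Q (c *: p1).
  move=> [h1 [b1 s1]]; exists (fun i => c *: h1 i).
  split=> [i|]; first exact: msizeZle.
  under eq_bigr do rewrite -scalerAl.
  by rewrite -scaler_sumr -scalerBr; apply: msizeZle.
rewrite -/(Q p) (mpolyE p) big_seq; apply: (big_ind Q) => //.
  by apply: Q0; rewrite msize0.
move=> m mp; apply: QZ; have := msize_mdeg_lt mp => hm.
have [lt|ge] := ltnP (mdeg m) n; first by apply: Q0; rewrite msizeX.
have mn : mdeg m = n by apply/eqP; rewrite eqn_leq ge -ltnS (leq_trans hm).
have [|s [m' [sz E]]] := @monomial_split M m; first by rewrite mn.
have [h Eh] : gen g0 ('X_[m] : S).
  rewrite E; apply: idlMr; first exact: gen_ideal.
  apply: hM; first by rewrite size_map.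
  by move=> q /mapP[i _ ->]; rewrite evX mxE.
pose h' i := if (e i <= n)%N then pihomog mdeg (n - e i) (h i) else 0.
have Eh' : 'X_[m] = \sum_i h' i * g0 i :> S.
  rewrite -[LHS](pihomog_dE (d := n) (mf := mdeg)); last first.
    by rewrite dhomogX /= mn.
  rewrite Eh raddf_sum; apply: eq_bigr => i _ /=.
  by rewrite (pihomogM _ _ (g0_homog i)).
have hb i : (msize (h' i) <= n.+1 - e i)%N.
  rewrite /h'; case: (leqP (e i) n) => en; last by rewrite msize0.
  by rewrite subSn //; apply/msize_homog/pihomogP.
exists h'; split=> //; rewrite Eh' -sumrB; apply: msize_sumle => i _.
rewrite -mulrBr -(opprB (g1 i)) mulrN (msizeN (h' i * (g1 i - g0 i))).
have [->|h0] := eqVneq (h' i) 0; first by rewrite mul0r msize0.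
have en : (e i <= n)%N by move: h0; rewrite /h'; case: (leqP (e i) n) => //; rewrite eqxx.
have [->|d0] := eqVneq (g1 i - g0 i) 0; first by rewrite mulr0 msize0.
rewrite msizeM //; have := hb i; have := g1_g0 i.
by move: (msize _) (msize _) en => a b; lia.
Qed.

Lemma reduce_degree : exists n1, forall n p, (msize p <= n)%N ->
  exists h : 'I_r -> S, (forall i, (msize (h i) <= n - e i)%N) /\
    (msize (p - \sum_i h i * g1 i) <= n1)%N.
Proof.
have [n1 hn1] := lower_degree; exists n1.
elim=> [|n IH] p hp.
  exists (fun=> 0); split=> [i|]; first by rewrite msize0.
  rewrite big1 ?subr0 ?(leq_trans hp) // => i _; by rewrite mul0r.
have [lt|ge] := ltnP n n1.
  exists (fun=> 0); split=> [i|]; first by rewrite msize0.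
  rewrite big1 ?subr0 ?(leq_trans hp) // => i _; by rewrite mul0r.
have [h [hb hs]] := hn1 n p ge hp; have [h' [hb' hs']] := IH _ hs.
exists (fun i => h i + h' i); split=> [i|].
  by apply: msizeD => //; apply: leq_trans (hb' i) _; apply: leq_sub2r.
under eq_bigr do rewrite mulrDl.
by rewrite big_split /= opprD addrA.
Qed.

End Degree.

(** * The common zeros *)

Section Fibre.
Variables (R : realType) (r : nat) (G : seq 'M[R]_r).
Notation V := 'cV[R]_r.
Notation S := {mpoly R[r]}.
Notation act := (@Exponents.mpoly_act R r).
Hypothesis (G_group : orth_group G).
Variable (f : r.-tuple S).
Hypothesis f_gen : forall q : S, (forall w, w \in G -> act w q = q) ->
  exists p : S, q = p \mPo f.
Variable v : V.
Implicit Types (p q : S) (x y z mu nu : V) (w u : 'M[R]_r).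
Notation tr := (tr v).
Notation g1 := (g1 f v).

Lemma interpolation (s : seq V) z : z \notin s ->
  exists p, ev p z = 1 /\ forall x, x \in s -> ev p x = 0.
Proof.
elim: s => [|x s IH]; first by exists 1; rewrite ev1.
rewrite inE negb_or => /andP[zx /IH[p [pz ps]]].
have d0 : dot (z - x) (z - x) != 0 by rewrite dot_neq0 // subr_eq0.
exists ((dot (z - x) (z - x))^-1%:MP * (lf (z - x) - (dot (z - x) x)%:MP) * p).
rewrite !evM evB !evC ev_lf -dotBr mulVf // pz mulr1; split=> // y.
rewrite inE !evM evB !evC ev_lf => /predU1P[->|/ps ->]; last by rewrite mulr0.
by rewrite subrr mulr0 mul0r.
Qed.

Definition symm p : S := \sum_(u <- G) act u p.

Lemma symm_inv p w : w \in G -> act w (symm p) = symm p.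
Proof.
move=> wG; rewrite /symm /Exponents.mpoly_act rmorph_sum.
rewrite -[RHS](og_sum_mulr (u := w) _ G_group wG).
by apply: eq_bigr => u _; apply: act_act.
Qed.

Lemma tr_symm p : gen g1 (tr (symm p) - symm p).
Proof.
have := dq_invariant f_gen v (symm_inv p).
by move=> /quot_gen_ev1; rewrite dq1.
Qed.

Lemma ev_symm p x : ev (symm p) x = \sum_(u <- G) ev p (u *m x).
Proof. by rewrite ev_sum; apply: eq_bigr => u _; apply: ev_act. Qed.

(** If x + v were not in the orbit of x, then the symmetrization of a polynomial
    that is 1 at x + v and 0 on the rest of both orbits would have different
    values at x and x + v. *)
Lemma common_zero x : (forall i, ev (g1 i) x = 0) ->
  exists2 w, w \in G & w *m x = x + v.
Proof.
move=> gx; have [/hasP[w wG /eqP]|/hasPn nx] :=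
  boolP (has (fun w => w *m x == x + v) G); first by exists w.
have [|p [p1 p0]] := @interpolation ([seq w *m x | w <- G] ++
    [seq w *m (x + v) | w <- G & w *m (x + v) != x + v]) (x + v).
  rewrite mem_cat negb_or; apply/andP; split; apply/mapP => -[w].
    by move=> /nx h E; rewrite -E eqxx in h.
  by rewrite mem_filter => /andP[h _] E; rewrite -E eqxx in h.
have [h E] := tr_symm p; have := congr1 (fun q => ev q x) E.
rewrite evB [in RHS]ev_sum [RHS]big1 => [|i _]; last by rewrite evM gx mulr0.
rewrite ev_tr !ev_symm [X in _ - X]big_seq [X in _ - X]big1 => [|u uG]; last first.
  by apply: p0; rewrite mem_cat (map_f (mulmx^~ x) uG).
rewrite subr0 (eq_big_seq (fun u => (u *m (x + v) == x + v)%:R)) => [|u uG].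
  rewrite sum_bool => /eqP; rewrite pnatr_eq0 => /eqP c0.
  have : has (fun u => u *m (x + v) == x + v) G.
    by apply/hasP; exists 1%:M; [apply: og_1 | rewrite mul1mx].
  by rewrite has_count c0.
have [->|h'] := eqVneq (u *m (x + v)) (x + v); first by rewrite p1.
rewrite p0 // mem_cat orbC; apply/orP; left.
by apply/mapP; exists u; rewrite ?mem_filter ?h'.
Qed.

(** The square of the maximal ideal of z. *)
Definition sq_ideal z p := exists a : 'I_r -> S,
  (forall l, ev (a l) z = 0) /\ p = \sum_l a l * ('X_l - (z l 0)%:MP).

Lemma sq_idealD z p q : sq_ideal z p -> sq_ideal z q -> sq_ideal z (p + q).
Proof.
move=> [a [a0 ->]] [b [b0 ->]]; exists (fun l => a l + b l); split.
  by move=> l; rewrite evD a0 b0 addr0.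
by rewrite -big_split; apply: eq_bigr => l _; rewrite mulrDl.
Qed.

Lemma sq_idealM z p q : sq_ideal z p -> sq_ideal z (q * p).
Proof.
move=> [a [a0 ->]]; exists (fun l => q * a l); split.
  by move=> l; rewrite evM a0 mulr0.
by rewrite mulr_sumr; apply: eq_bigr => l _; rewrite mulrA.
Qed.

Lemma sq_ideal0 z : sq_ideal z 0.
Proof.
exists (fun=> 0); split=> [l|]; first exact: ev0.
by rewrite big1 // => l _; rewrite mul0r.
Qed.

Lemma sq_idealN z p : sq_ideal z p -> sq_ideal z (- p).
Proof. by rewrite -mulN1r; apply: sq_idealM. Qed.

Lemma sq_ideal_mul z p q : ev p z = 0 -> ev q z = 0 -> sq_ideal z (p * q).
Proof.
move=> p0 q0; have [h] := hadamard q z; rewrite q0 mpolyC0 subr0 => ->.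
exists (fun l => p * h l); split; first by move=> l; rewrite evM p0 mul0r.
by rewrite mulr_sumr; apply: eq_bigr => l _; rewrite mulrA.
Qed.

Lemma trM p q : tr (p * q) = tr p * tr q.
Proof. exact: rmorphM. Qed.

Lemma trB p q : tr (p - q) = tr p - tr q.
Proof. exact: rmorphB. Qed.

Lemma actB w p q : act w (p - q) = act w p - act w q.
Proof. exact: rmorphB. Qed.

Lemma tr_sum (I : Type) (s : seq I) (F : I -> S) :
  tr (\sum_(i <- s) F i) = \sum_(i <- s) tr (F i).
Proof. exact: rmorph_sum. Qed.

Lemma act1 p : act 1%:M p = p.
Proof.
elim/mpoly_alg_ind: p => [c|i|p q hp hq|p q hp hq].
- by rewrite /Exponents.mpoly_act comp_mpolyC.
- by rewrite -lf_delta act_lf trmx1 mul1mx.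
- by rewrite actD hp hq.
- by rewrite actM hp hq.
Qed.

(** Symmetrize a polynomial that equals a linear form up to second order at
    z + v and vanishes to second order on the rest of the orbit of z + v.  The
    result q is invariant, and q(y + v) - q(y) has at z the same linear part
    as the linear form in y + v - w y. *)
Lemma cotangent z w k : w \in G -> w *m z = z + v ->
    (forall x, w *m x = x -> x = 0) ->
    (forall u, u \in G -> u *m z = z -> u = 1%:M) ->
  exists p, gen g1 p /\ sq_ideal z ('X_k - (z k 0)%:MP - p).
Proof.
move=> wG wz wfree zreg; pose z' := z + v.
have z'reg u : u \in G -> u *m z' = z' -> u = 1%:M.
  move=> uG uz; have wK := og_trK G_group wG; have wKr := og_trKr G_group wG.
  have E : w^T *m u *m w = 1%:M.
    apply: zreg; first by apply: og_mul => //; apply: og_mul => //; apply: og_tr.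
    by rewrite -!mulmxA wz uz /z' -wz mulmxA wK mul1mx.
  have : w *m (w^T *m u *m w) *m w^T = u.
    by rewrite -!mulmxA wKr mulmx1 mulmxA wKr mul1mx.
  by rewrite E mulmx1 wKr.
have [|q0 [q1 qs]] := @interpolation
    [seq u *m z' | u <- G & u != 1%:M] z'.
  apply/mapP => -[u]; rewrite mem_filter => /andP[u1 uG] /esym E.
  by rewrite (z'reg u uG E) eqxx in u1.
have uW : (1%:M - w^T) \in unitmx.
  rewrite -unitmx_tr -row_free_unit -kermx_eq0; apply/rowV0P => y /sub_kermxP yw.
  have : (1%:M - w^T) *m y^T = 0.
    by rewrite -[1%:M - w^T]trmxK -trmx_mul yw trmx0.
  rewrite mulmxBl mul1mx => /eqP; rewrite subr_eq0 => /eqP E.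
  apply: trmx_inj; rewrite trmx0; apply: wfree.
  by rewrite E mulmxA (og_trKr G_group wG) mul1mx.
pose mu := invmx (1%:M - w^T) *m (delta_mx k 0 : V).
have muE : mu - w^T *m mu = delta_mx k 0.
  by rewrite -{1}[mu]mul1mx -mulmxBl mulmxA mulmxV // mul1mx.
have muv : dot mu v = - z k 0.
  have -> : v = w *m z - z by rewrite wz addrC addKr.
  rewrite dotBr (dotC mu) dot_mull (dotC z) -dotBl -opprB muE dotNl.
  by rewrite -ev_lf lf_delta evX.
(* The difference of l at y + v and at w y is the k-th coordinate of y - z.  As b
   vanishes at z + v, kap agrees with l there up to second order. *)
pose l := lf mu; pose b := 1 - q0 ^+ 2; pose kap := l - b ^+ 2 * l.
have kapE : kap = q0 * (q0 * ((1 + b) * l)) by rewrite /kap /b; ring.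
exists (tr (symm kap) - symm kap); split; first exact: tr_symm.
have -> : symm kap = \sum_(u <- G) act (u *m w) kap.
  by rewrite /symm (og_sum_mulr (fun u => act u kap) G_group wG).
have -> : tr (\sum_(u <- G) act (u *m w) kap) = \sum_(u <- G) tr (act u kap).
  by rewrite (og_sum_mulr (fun u => act u kap) G_group wG) tr_sum.
rewrite -sumrB (bigD1_seq 1%:M) ?(og_1 G_group) ?(og_uniq G_group) //= opprD addrA.
apply: sq_idealD; last first.
  apply: sq_idealN; rewrite big_seq_cond; apply: (big_ind (sq_ideal z)).
  - exact: sq_ideal0.
  - exact: sq_idealD.
  move=> u /andP[uG u1]; rewrite kapE !actM !trM.
  have qu : ev q0 (u *m z') = 0.
    by apply: qs; apply/mapP; exists u; rewrite ?mem_filter ?u1.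
  have z1 : ev (tr (act u q0)) z = 0 by rewrite ev_tr ev_act.
  have z2 : ev (act (u *m w) q0) z = 0 by rewrite ev_act -mulmxA wz.
  set A := tr (act u q0) in z1 *; set B := act _ q0 in z2 *.
  apply: sq_idealD; first by rewrite mulrA mulrC; apply/sq_idealM/sq_ideal_mul.
  by apply: sq_idealN; rewrite mulrA mulrC; apply/sq_idealM/sq_ideal_mul.
rewrite mul1mx act1 /kap trB actB opprB.
have lE : tr l - act w l = 'X_k - (z k 0)%:MP.
  rewrite /l tr_lf act_lf muv mpolyCN addrAC -lfB muE lf_delta //.
rewrite [X in sq_ideal z X](_ : _ = tr (b ^+ 2 * l) - act w (b ^+ 2 * l)); last first.
  by rewrite -lE; move: (tr _) (tr _) (act _ _) (act _ _) => *; ring.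
have b0 : ev b z' = 0 by rewrite /b evB ev1 expr2 evM q1 mulr1 subrr.
rewrite -mulrA !trM !actM; apply: sq_idealD; last apply: sq_idealN.
  rewrite mulrA mulrC; apply/sq_idealM/sq_ideal_mul; by rewrite ev_tr.
rewrite mulrA mulrC; apply/sq_idealM/sq_ideal_mul; by rewrite ev_act wz.
Qed.

(** By the determinant trick, the maximal ideal of z and the ideal of the
    equations agree after multiplication by a polynomial that is 1 at z. *)
Lemma local_equations z w : w \in G -> w *m z = z + v ->
    (forall x, w *m x = x -> x = 0) ->
    (forall u, u \in G -> u *m z = z -> u = 1%:M) ->
  exists p, ev p z = 1 /\ forall q, ev q z = 0 -> gen g1 (p * q).
Proof.
move=> wG wz wfree zreg; have hI := gen_ideal g1.
have /choice[i iP] := fun k => cotangent k wG wz wfree zreg.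
have /choice[a aP] : forall k, exists a : 'I_r -> S, (forall l, ev (a l) z = 0) /\
    'X_k - (z k 0)%:MP - i k = \sum_l a l * ('X_l - (z l 0)%:MP).
  by move=> k; have [_ [a ha]] := iP k; exists a.
(* The matrix B maps the vector of the coordinates of y - z to that of the i k,
   and it is the identity at z. *)
pose B : 'M[S]_r := \matrix_(k, l) ((k == l)%:R - a k l).
pose d : 'cV[S]_r := \col_l ('X_l - (z l 0)%:MP).
have Bd k : (B *m d) k 0 = i k.
  rewrite mxE; under eq_bigr do rewrite !mxE mulrBl.
  rewrite sumrB -(proj2 (aP k)) (bigD1 k) //= eqxx mul1r big1 ?addr0.
    by rewrite opprB addrC subrK.
  by move=> l kl; rewrite eq_sym (negbTE kl) mul0r.
exists (\det B); split.
  rewrite /ev -det_map_mx; rewrite (_ : map_mx _ B = 1%:M) ?det1 //.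
  apply/matrixP => k l; rewrite !mxE.
  rewrite [LHS](_ : _ = ev ((k == l)%:R - a k l) z) // evB (proj1 (aP k)) subr0.
  by case: eqP => _; rewrite ?ev1 ?ev0.
move=> q qz; have [h] := hadamard q z; rewrite qz mpolyC0 subr0 => ->.
rewrite mulr_sumr; apply: idl_sum => // k _ _; rewrite mulrCA; apply: idlM => //.
have -> : \det B * ('X_k - (z k 0)%:MP) = \sum_j (\adj B) k j * i j.
  have : (\adj B *m (B *m d)) k 0 = \det B * ('X_k - (z k 0)%:MP).
    by rewrite mulmxA mul_adj_mx mul_scalar_mx !mxE.
  by move=> <-; rewrite [LHS]mxE; apply: eq_bigr => j _; rewrite Bd.
by apply: idl_sum => // j _ _; apply: idlM => //; have [] := iP j.
Qed.

Variable Z : seq V.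
Hypothesis Z_in : forall z, z \in Z -> exists w, [/\ w \in G, w *m z = z + v,
  forall x, w *m x = x -> x = 0 &
  forall u, u \in G -> u *m z = z -> u = 1%:M].
Hypothesis Z_all : forall z w, w \in G -> w *m z = z + v -> z \in Z.

(** The ideal quotient by h is contained in none of the maximal ideals whose
    product is contained in the ideal, hence it contains 1. *)
Lemma vanishing_ideal (pts : seq V) h : max_product (gen g1) pts ->
  {in Z, forall z, ev h z = 0} -> gen g1 h.
Proof.
move=> hpts hZ; have hI := gen_ideal g1.
have loc x : exists p, ev p x = 1 /\ gen g1 (p * h).
  have [gx|] := pselect (forall i, ev (g1 i) x = 0).
    have [w wG wx] := common_zero gx.
    have xZ := Z_all wG wx; have [w' [w'G w'x fx rx]] := Z_in xZ.
    have [p [p1 hp]] := local_equations w'G w'x fx rx.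
    by exists p; split=> //; apply: hp; apply: hZ.
  move/existsNP => [i /eqP gi]; exists ((ev (g1 i) x)^-1%:MP * g1 i).
  rewrite evM evC mulVf //; split=> //.
  by rewrite -mulrA mulrCA; apply: idlMr => //; apply: gen_in.
have /choice[P hP] := loc.
have : gen g1 (\prod_(p <- [seq 1 - P x | x <- pts]) p).
  apply: hpts; rewrite /vanish_on; elim: (pts) => //= x s ->.
  by rewrite evB ev1 (proj1 (hP x)) subrr eqxx.
rewrite big_map => h1.
have h2 : gen g1 ((\prod_(x <- pts) (1 - P x) - 1) * h).
  elim: (pts) => [|x s IH]; first by rewrite big_nil subrr mul0r; apply: idl0.
  rewrite big_cons (_ : _ * h = (\prod_(x <- s) (1 - P x) - 1) * h
    - \prod_(x <- s) (1 - P x) * (P x * h)); last by ring.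
  by apply: idlB => //; apply: idlM => //; have [] := hP x.
rewrite (_ : h = \prod_(x <- pts) (1 - P x) * h
  - (\prod_(x <- pts) (1 - P x) - 1) * h); last by ring.
by apply: idlB => //; apply: idlMr.
Qed.

End Fibre.

(** * Counting monomials *)

Section Growth.
Variable r : nat.

Definition nmon n := #|{: 'X_{1..r < n}}|.

(** A multi-index of degree at most n is a partition of a number up to n into r
    ordered parts. *)
Lemma nmonE n : nmon n.+1 = 'C(r + n, r).
Proof.
rewrite -card_partial_ord_partitions cardE -cardE.
apply/eqP; rewrite eqn_leq; apply/andP; split.
  pose F (m : 'X_{1..r < n.+1}) : r.-tuple 'I_n.+1 := [tuple inord (m i) | i < r].
  have mi (m : 'X_{1..r < n.+1}) i : (m i < n.+1)%N.
    by apply: leq_ltn_trans (bmdeg m); rewrite mdegE (bigD1 i) //= leq_addr.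
  have Fi : injective F.
    move=> m m' h; apply/val_inj/mnmP => i.
    have := congr1 (fun t => nat_of_ord (tnth t i)) h.
    by rewrite !tnth_mktuple !inordK.
  rewrite /nmon -(card_codom Fi); apply/subset_leq_card/fintype.subsetP => _ /codomP[m ->].
  rewrite inE big_tuple; under eq_bigr do rewrite tnth_mktuple inordK //.
  by rewrite -mdegE -ltnS bmdeg.
rewrite cardsE -(card_sig (fun t : r.-tuple 'I_n.+1 => (\sum_(i <- t) i <= n)%N)).
pose m (t : {t : r.-tuple 'I_n.+1 | (\sum_(i <- t) i <= n)%N}) :=
  [multinom nat_of_ord (tnth (val t) i) | i < r].
have mn t : (mdeg (m t) < n.+1)%N.
  rewrite mdegE; under eq_bigr do rewrite mnmE.
  by have := valP t; rewrite big_tuple.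
apply: (@leq_card _ _ (fun t => BMultinom (mn t))) => t t' /(congr1 val)/mnmP h.
apply/val_inj/eq_from_tnth => i; apply: val_inj.
by have := h i; rewrite !mnmE.
Qed.

Lemma nmon_leq n k : (n <= k)%N -> (nmon n <= nmon k)%N.
Proof.
move=> nk; have h (m : 'X_{1..r < n}) : (mdeg m < k)%N by apply: leq_trans (bmdeg m) nk.
rewrite /nmon; apply: (@leq_card _ _ (fun m : 'X_{1..r < n} => BMultinom (h m))).
by move=> m m' /(congr1 val) E'; apply: val_inj.
Qed.

(** The quotient of consecutive values, (r + n) / n, tends to 1. *)
Lemma nmon_growth c k : exists n0, forall n, (n0 <= n)%N ->
  (c * (nmon (n + k) - nmon n) < nmon n)%N.
Proof.
have pos n : (0 < nmon n.+1)%N by rewrite nmonE bin_gt0 leq_addr.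
have step n : (n.+1 * nmon n.+2 = (r + n.+1) * nmon n.+1)%N.
  rewrite !nmonE !addnS; have /= := mul_bin_down (r + n).+1 r.
  by rewrite (_ : ((r + n).+1 - r = n.+1)%N); [move=> <- | lia].
elim: k c => [|k IH] c.
  by exists 1%N => -[//|n] _; rewrite addn0 subnn muln0.
have [n0 hn0] := IH (2 * c).+1.
(* For n above 4 r c the last difference is less than a / (2 c), and by induction
   the sum of the other differences is less than a / (2 c + 1). *)
exists (maxn n0.+1 (4 * r * c).+2) => -[|n]; rewrite geq_max // => /andP[h1 h2].
have le1 := nmon_leq (leq_addr k n.+1); have := hn0 n.+1 (ltnW h1).
have := step (n + k)%N; rewrite !addSn !addnS.
have le2 : (nmon (n + k).+1 <= nmon (n + k).+2)%N by apply: nmon_leq.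
rewrite addSn in le1; have := pos n.
move: (nmon n.+1) (nmon (n + k).+1) (nmon (n + k).+2) le1 le2 => a b d le1 le2 a0 E1 E2.
have h3 : (4 * r * c < r + (n + k).+1)%N by lia.
have [x E3] : exists x, b = (a + x)%N by exists (b - a)%N; rewrite subnKC.
have [y E4] : exists y, d = (b + y)%N by exists (d - b)%N; rewrite subnKC.
subst b d; rewrite addKn in E2.
rewrite (_ : (a + x + y - a = x + y)%N); last lia.
have E5 : ((n + k).+1 * y = r * (a + x))%N by nia.
have xa : (x <= a)%N by nia.
suff : (2 * c * y < a)%N by nia.
rewrite ltnNge; apply/negP => ay.
have : ((n + k).+1 * y <= 4 * r * c * y)%N by nia.
have h4 : (4 * r * c < (n + k).+1)%N by lia.
case: y E1 le2 E5 ay => [|y] _ _ _ ay; first by nia.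
by rewrite leq_mul2r /= leqNgt h4.
Qed.

End Growth.

Section LatticeCount.
Variables (r : nat) (e : 'I_r -> nat).
Hypothesis e_gt0 : forall i, (0 < e i)%N.
Implicit Types (n k : nat) (b m : 'X_{1..r}).

Definition wt b : nat := (\sum_i b i * e i)%N.

Lemma wtD b m : wt (b + m) = (wt b + wt m)%N.
Proof. by rewrite /wt -big_split; apply: eq_bigr => i _; rewrite mnmDE mulnDl. Qed.

Lemma wt0 : wt 0%MM = 0%N.
Proof. by rewrite /wt big1 // => i _; rewrite mnm0E. Qed.

Lemma wtU i : wt U_(i)%MM = e i.
Proof.
rewrite /wt (bigD1 i) //= mnm1E eqxx mul1n big1 ?addn0 // => j ji.
by rewrite mnm1E eq_sym (negbTE ji).
Qed.

Lemma mdeg_wt b : (mdeg b <= wt b)%N.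
Proof. by rewrite mdegE leq_sum // => i _; rewrite leq_pmulr. Qed.

(** The multi-indices b for which the product of the g_i^(b_i), where g_i has
    degree e i, is of degree less than n. *)
Definition wmon n := {b : 'X_{1..r < n} | (wt b < n)%N}.

Lemma wmonP n b : (wt b < n)%N -> exists t : wmon n, val (val t) = b.
Proof.
move=> h; have hb : (mdeg b < n)%N by apply: leq_ltn_trans (mdeg_wt b) h.
by exists (exist _ (BMultinom hb) h).
Qed.

Let D := (\prod_i e i)%N.
Let E := (\sum_i e i)%N.

Lemma card_remainders : #|{dffun forall i, 'I_(e i)}| = D.
Proof.
rewrite card_dep_ffun foldrE big_map big_enum.
by apply: eq_bigr => i _; rewrite card_ord.
Qed.

(** Division with remainder by e in each coordinate cuts the lattice points
    into boxes of D points each. *)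
Lemma nmon_le n : (nmon r n <= D * #|{: wmon n}|)%N.
Proof.
rewrite -card_remainders mulnC -card_prod.
pose q (a : 'X_{1..r}) := [multinom (a i %/ e i)%N | i < r].
have qn (a : 'X_{1..r < n}) : (wt (q a) < n)%N.
  apply: leq_ltn_trans (bmdeg a); rewrite mdegE leq_sum // => i _.
  by rewrite mnmE leq_trunc_div.
have qd (a : 'X_{1..r < n}) : (mdeg (q a) < n)%N.
  exact: leq_ltn_trans (mdeg_wt _) (qn a).
pose F (a : 'X_{1..r < n}) : wmon n * {dffun forall i, 'I_(e i)} :=
  (exist _ (BMultinom (qd a)) (qn a),
   [ffun i => Ordinal (ltn_pmod (a i) (e_gt0 i))]).
apply: (@leq_card _ _ F) => a a' h.
have /mnmP h1 := congr1 (fun x => val (val x.1)) h.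
have /ffunP h2 := congr1 snd h.
apply/val_inj/mnmP => i; rewrite (divn_eq (a i) (e i)) (divn_eq (a' i) (e i)).
have := h1 i; rewrite !mnmE => ->; have := h2 i; rewrite !ffunE => -[->].
by [].
Qed.

Lemma nmon_ge n : (D * #|{: wmon n}| <= nmon r (n + E))%N.
Proof.
rewrite -card_remainders mulnC -card_prod.
pose a (x : wmon n * {dffun forall i, 'I_(e i)}) :=
  [multinom (val (val x.1) i * e i + x.2 i)%N | i < r].
have an x : (mdeg (a x) < n + E)%N.
  rewrite mdegE; under eq_bigr do rewrite mnmE.
  rewrite big_split -addSn leq_add //; first exact: (valP x.1).
  by apply: leq_sum => i _; apply: ltnW.
apply: (@leq_card _ _ (fun x => BMultinom (an x))) => -[b p] [b' p'] /(congr1 val)/mnmP h.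
have hi i : val (val b) i = val (val b') i /\ p i = p' i.
  have := h i; rewrite !mnmE /= => hi; split; last apply: val_inj.
    have := congr1 (divn^~ (e i)) hi.
    by rewrite !divnMDl ?divn_small ?addn0.
  have := congr1 (modn^~ (e i)) hi.
  by rewrite !modnMDl !modn_small.
congr (_, _); first by do 2!apply: val_inj; apply/mnmP => i; have [] := hi i.
by apply/ffunP => i; have [] := hi i.
Qed.

End LatticeCount.

(** * Bezout's theorem *)

Section Dimension.
Variables (R : realType) (r n : nat) (T : finType).
Notation S := {mpoly R[r]}.
Variable F : T -> S.

Let cf (t : 'I_#|T|) (k : 'I_#|{: 'X_{1..r < n}}|) : R :=
  (F (enum_val t))@_(val (enum_val k)).

Lemma span_dim : (forall m : 'X_{1..r < n}, exists c : T -> R,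
    'X_[val m] = \sum_t c t *: F t) -> (nmon r n <= #|T|)%N.
Proof.
move=> /choice[c hc].
pose A : 'M[R]_(#|{: 'X_{1..r < n}}|, #|T|) := \matrix_(k, t) c (enum_val k) (enum_val t).
pose B : 'M[R]_(#|T|, #|{: 'X_{1..r < n}}|) := \matrix_(t, k) cf t k.
have AB : A *m B = 1%:M.
  apply/matrixP => k k'; rewrite !mxE.
  have := congr1 (mcoeff (val (enum_val k'))) (hc (enum_val k)).
  rewrite mcoeffX raddf_sum /= (inj_eq val_inj) (inj_eq enum_val_inj) => ->.
  rewrite (reindex _ (onW_bij _ (enum_val_bij T))) /=.
  by apply: eq_bigr => t _; rewrite !mxE mcoeffZ.
rewrite /nmon; apply: leq_trans (rank_leq_col A).
by rewrite -[X in (X <= _)%N](mxrank1 R) -AB mxrankM_maxl.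
Qed.

Lemma free_dim : (forall t, msize (F t) <= n)%N ->
  (forall c : T -> R, \sum_t c t *: F t = 0 -> forall t, c t = 0) ->
  (#|T| <= nmon r n)%N.
Proof.
move=> hF hc.
pose B : 'M[R]_(#|T|, #|{: 'X_{1..r < n}}|) := \matrix_(t, k) cf t k.
have : row_free B.
  rewrite -kermx_eq0; apply/rowV0P => x /sub_kermxP xB; apply/rowP => t.
  rewrite mxE -(enum_valK t); apply: (hc (fun t => x 0 (enum_rank t))).
  apply/mpolyP => m; rewrite mcoeff0 raddf_sum /=.
  rewrite (reindex _ (onW_bij _ (enum_val_bij T))) /=.
  have [mn|mn] := ltnP (mdeg m) n.
    have /rowP/(_ (enum_rank (BMultinom mn))) := xB; rewrite !mxE => h.
    rewrite -[RHS]h; apply: eq_bigr => i _.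
    by rewrite mcoeffZ enum_valK mxE /cf enum_rankK.
  rewrite big1 // => i _; rewrite mcoeffZ memN_msupp_eq0 ?mulr0 //.
  by apply: msize_mdeg_ge; apply: leq_trans mn.
by move=> /eqP <-; apply: rank_leq_col.
Qed.

End Dimension.

Section Bezout.
Variables (R : realType) (r : nat).
Notation V := 'cV[R]_r.
Notation S := {mpoly R[r]}.
Variables (g : 'I_r -> S) (e : 'I_r -> nat).
Hypothesis e_gt0 : forall i, (0 < e i)%N.
Hypothesis g_size : forall i, (msize (g i) <= (e i).+1)%N.
Variables (Q : nat) (Z : 'I_Q -> V) (c : 'I_Q -> S).
Hypothesis cZ : forall s t, ev (c s) (Z t) = (s == t)%:R.
Implicit Types (p q : S) (x z : V) (b m : 'X_{1..r}).

Definition gm b : S := 'X_[b] \mPo [tuple g i | i < r].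

Lemma gmD b m : gm (b + m)%MM = gm b * gm m.
Proof. by rewrite /gm mpolyXD rmorphM. Qed.

Lemma gm0 : gm 0%MM = 1.
Proof. by rewrite /gm mpolyX0 rmorph1. Qed.

Lemma gmU i : gm U_(i)%MM = g i.
Proof. by rewrite /gm comp_mpolyXU -tnth_nth tnth_mktuple. Qed.

Lemma gmE b : gm b = \prod_i g i ^+ b i.
Proof.
by rewrite /gm comp_mpolyX; apply: eq_bigr => i _; rewrite tnth_mktuple.
Qed.

Lemma msize_gm b : (msize (gm b) <= (wt e b).+1)%N.
Proof.
have hM p q a a' : (msize p <= a.+1)%N -> (msize q <= a'.+1)%N ->
    (msize (p * q) <= (a + a').+1)%N.
  by move=> hp hq; rewrite -addSn; apply: msizeMle.
rewrite gmE /wt; apply: (big_ind2 (fun p k => (msize p <= k.+1)%N)).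
- by rewrite msize1.
- by move=> p a q a'; apply: hM.
move=> i _; elim: (b i) => [|k IH]; first by rewrite expr0 msize1.
by rewrite exprS mulSn; apply: hM.
Qed.

Section Independence.
(** The equations are local coordinates at every point. *)
Hypothesis coordinates : forall s k, exists h a : 'I_r -> S,
  (forall l, ev (a l) (Z s) = 0) /\
  'X_k - (Z s k 0)%:MP = \sum_i h i * g i + \sum_l a l * ('X_l - (Z s l 0)%:MP).
Hypothesis gZ : forall s i, ev (g i) (Z s) = 0.

Section Germ.
Variables (z : V) (U : 'I_r -> S).

Fact germ_key : unit. Proof. exact: tt. Qed.

(** The expansion along z + t U. *)
Definition germ : S -> {poly S} := locked_with germ_key
  (mmap (@polyC S \o @mpolyC r R) (fun k => ((z k 0)%:MP)%:P + (U k)%:P * 'X)).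

Lemma germD p q : germ (p + q) = germ p + germ q.
Proof. by rewrite /germ unlock rmorphD. Qed.

Lemma germM p q : germ (p * q) = germ p * germ q.
Proof. by rewrite /germ unlock rmorphM. Qed.

Lemma germC a : germ a%:MP = (a%:MP)%:P.
Proof. by rewrite /germ unlock; apply: mmapC. Qed.

Lemma germX k : germ 'X_k = ((z k 0)%:MP)%:P + (U k)%:P * 'X.
Proof. by rewrite /germ unlock mmapX mmap1U. Qed.

Lemma germ_sum (I : Type) (s : seq I) (P : pred I) (F : I -> S) :
  germ (\sum_(i <- s | P i) F i) = \sum_(i <- s | P i) germ (F i).
Proof. by rewrite /germ unlock rmorph_sum. Qed.

Lemma germ_prod (I : Type) (s : seq I) (P : pred I) (F : I -> S) :
  germ (\prod_(i <- s | P i) F i) = \prod_(i <- s | P i) germ (F i).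
Proof. by rewrite /germ unlock rmorph_prod. Qed.

Lemma germXn p k : germ (p ^+ k) = germ p ^+ k.
Proof. by rewrite /germ unlock rmorphXn. Qed.

Lemma germ_coef0 p : (germ p)`_0 = (ev p z)%:MP.
Proof.
elim/mpoly_alg_ind: p => [a|k|p q hp hq|p q hp hq].
- by rewrite germC coefC evC.
- by rewrite germX coefD coefC coefMX addr0 evX.
- by rewrite germD coefD hp hq evD mpolyCD.
- by rewrite germM coef0M hp hq evM mpolyCM.
Qed.

Lemma germ_coef1M p q : ev q z = 0 -> (germ (p * q))`_1 = (ev p z)%:MP * (germ q)`_1.
Proof.
move=> qz; rewrite germM coefM !big_ord_recl big_ord0 /= !subn0 addr0.
by rewrite !germ_coef0 qz mpolyC0 mulr0 addr0.
Qed.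

Lemma germ_coef1X k : (germ ('X_k - (z k 0)%:MP))`_1 = U k.
Proof.
rewrite -mpolyCN germD germX germC !coefD coefC coefC coefMX coefC /=.
by rewrite add0r addr0.
Qed.

End Germ.

(** Substituting suitable linear forms for the displacement, the linear part of
    the i-th equation becomes the i-th variable. *)
Lemma germ_coordinates s : exists U : 'I_r -> S, forall i, (germ (Z s) U (g i))`_1 = 'X_i.
Proof.
pose z := Z s.
have /choice[G hG] : forall i, exists G : 'I_r -> S,
    g i = \sum_l G l * ('X_l - (z l 0)%:MP).
  by move=> i; have [G] := hadamard (g i) z; rewrite gZ mpolyC0 subr0; exists G.
have /choice[h hh] := coordinates s.
have /choice[a ha] := hh.
pose B : 'M[R]_r := \matrix_(k, i) ev (h k i) z.
pose C : 'M[R]_r := \matrix_(i, l) ev (G i l) z.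
have Xz l : ev ('X_l - (z l 0)%:MP) z = 0 by rewrite evB evX evC subrr.
have g1E U i : (germ z U (g i))`_1 = \sum_l (C i l)%:MP * U l.
  rewrite {1}(hG i) germ_sum coef_sum; apply: eq_bigr => l _.
  by rewrite germ_coef1M // germ_coef1X mxE.
have BC : B *m C = 1%:M.
  apply/matrixP => k l; have [h0 E] := ha k.
  have := congr1 (fun p => (germ z (fun k => 'X_k) p)`_1) E.
  rewrite germ_coef1X germD coefD !germ_sum !coef_sum.
  rewrite [X in _ = _ + X]big1 ?addr0 => [|j _]; last first.
    by rewrite germ_coef1M // h0 mpolyC0 mul0r.
  move=> /(congr1 (mcoeff U_(l)%MM)).
  rewrite mcoeffXU !mxE => ->; rewrite raddf_sum; apply: eq_bigr => i _ /=.
  rewrite germ_coef1M ?gZ // g1E mul_mpolyC mcoeffZ mxE raddf_sum; congr (_ * _).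
  rewrite (bigD1 l) //= mul_mpolyC mcoeffZ mcoeffXU eqxx mulr1 big1 ?addr0 //.
  by move=> j /negbTE jl; rewrite mul_mpolyC mcoeffZ mcoeffXU jl mulr0.
have CB := mulmx1C BC.
exists (fun l => \sum_j (B l j)%:MP * 'X_j) => i; rewrite g1E.
under eq_bigr do rewrite mulr_sumr.
rewrite exchange_big (bigD1 i) //= [X in _ + X]big1 ?addr0 => [|j ji].
  under eq_bigr do rewrite mulrA -mpolyCM.
  rewrite -mulr_suml -rmorph_sum /=.
  have /matrixP/(_ i i) := CB; rewrite !mxE eqxx => ->.
  by rewrite mpolyC1 mul1r.
under eq_bigr do rewrite mulrA -mpolyCM.
rewrite -mulr_suml -rmorph_sum /=.
have /matrixP/(_ i j) := CB; rewrite !mxE eq_sym (negbTE ji) => ->.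
by rewrite mpolyC0 mul0r.
Qed.

(** At the point of index s and in order k, only the terms of this point and of
    degree k remain, and they give a polynomial with these coefficients. *)
Lemma products_free n (ga : 'I_Q * wmon e n -> R) :
  \sum_t ga t *: (c t.1 * gm (val (val t.2))) = 0 -> forall t, ga t = 0.
Proof.
move=> E0.
suff H k : forall s (b : wmon e n), (mdeg (val (val b)) < k)%N -> ga (s, b) = 0.
  by case=> s b; apply: (H (mdeg (val (val b))).+1).
elim: k => // k IH s b; rewrite ltnS leq_eqVlt => /predU1P[bk|]; last exact: IH.
have [U hU] := germ_coordinates s.
(* The i-th equation is t tau i at this point, and tau i has the constant term
   X_i. *)
pose tau i := drop_poly 1 (germ (Z s) U (g i)).
have tauE i : germ (Z s) U (g i) = tau i * 'X.
  rewrite -[LHS](poly_take_drop 1) [X in X + _ = _](_ : _ = 0) ?add0r //.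
  apply/polyP => j; rewrite coef_take_poly coef0 ltnS leqn0.
  by case: eqP => // ->; rewrite germ_coef0 gZ mpolyC0.
have tau0 i : (tau i)`_0 = 'X_i by rewrite coef_drop_poly add0n hU.
have gE m : germ (Z s) U (gm m) = (\prod_i tau i ^+ m i) * 'X^(mdeg m).
  rewrite gmE germ_prod mdegE expr_sum -big_split; apply: eq_bigr => i _ /=.
  by rewrite germXn tauE exprMn.
have prod0 m : (\prod_i tau i ^+ m i)`_0 = 'X_[m].
  rewrite -horner_coef0 horner_prod mpolyXE_id; apply: eq_bigr => i _.
  by rewrite horner_exp horner_coef0 tau0.
have term t : (germ (Z s) U (ga t *: (c t.1 * gm (val (val t.2)))))`_k =
    if (t.1 == s) && (mdeg (val (val t.2)) == k) then ga t *: 'X_[val (val t.2)] else 0.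
  case: t => t b' /=.
  have [lt|ge] := ltnP (mdeg (val (val b'))) k.
    rewrite IH // !scale0r -mpolyC0 germC coefC mpolyC0.
    by case: ifP; case: ifP.
  rewrite -mul_mpolyC !germM germC coefCM gE mulrA coefMXn.
  have [kb|kb] := ltnP k (mdeg (val (val b'))).
    by rewrite mulr0 (gtn_eqF kb) andbF.
  have -> : mdeg (val (val b')) = k by apply/eqP; rewrite eqn_leq ge kb.
  rewrite subnn eqxx andbT coef0M germ_coef0 cZ prod0 -mul_mpolyC.
  by case: eqP => _; rewrite ?mpolyC1 ?mul1r // mpolyC0 mul0r mulr0.
have := congr1 (fun p => (germ (Z s) U p)`_k) E0.
rewrite germ_sum coef_sum -mpolyC0 germC coefC mpolyC0 if_same.
under eq_bigr do rewrite term.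
rewrite -big_mkcond => /(congr1 (mcoeff (val (val b)))).
rewrite mcoeff0 raddf_sum /= (bigD1 (s, b)) /=; last by rewrite eqxx bk eqxx.
rewrite mcoeffZ mcoeffX eqxx mulr1 big1 ?addr0 // => -[t b'] /=.
move=> /andP[/andP[/eqP -> _] ne]; rewrite mcoeffZ mcoeffX.
case: eqP => [E|]; last by rewrite mulr0.
by move: ne; rewrite (_ : b' = b) ?eqxx //; do 2!apply: val_inj.
Qed.

(** These products have degree less than n + n0 and are linearly independent. *)
Lemma independence_bound : exists n0, forall n,
  (Q * #|{: wmon e n}| <= nmon r (n + n0))%N.
Proof.
pose n0 := (\max_s msize (c s))%N; exists n0 => n.
rewrite -[X in (X * _)%N]card_ord -card_prod.
apply: (@free_dim R r (n + n0) _ (fun t => c t.1 * gm (val (val t.2)))) => [[s b]|ga].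
  have hc : (msize (c s) <= n0)%N by apply: (leq_bigmax s).
  apply: leq_trans (msizeMle hc (msize_gm _)) _.
  by rewrite addnC leq_add2r ltnW // (valP b).
exact: products_free.
Qed.

End Independence.

Section Spanning.
Hypothesis spanned : exists n2, forall n p, (n2 <= n)%N -> (msize p <= n)%N ->
  exists (ga : 'I_Q -> R) (h : 'I_r -> S), (forall i, (msize (h i) <= n - e i)%N) /\
    p = \sum_s ga s *: c s + \sum_i h i * g i.

Definition subspace (L : S -> Prop) :=
  [/\ L 0, (forall p q, L p -> L q -> L (p + q)) & forall a p, L p -> L (a *: p)].

(** Dividing repeatedly by the equations: either the coefficient is a
    combination of the c s, or its degree has become small. *)
Lemma spanning_products n2 :
  (forall n p, (n2 <= n)%N -> (msize p <= n)%N ->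
    exists (ga : 'I_Q -> R) (h : 'I_r -> S), (forall i, (msize (h i) <= n - e i)%N) /\
      p = \sum_s ga s *: c s + \sum_i h i * g i) ->
  forall n p (L : S -> Prop), (msize p <= n)%N -> subspace L ->
    (forall s b, (wt e b < n)%N -> L (c s * gm b)) ->
    (forall m b, (mdeg m < n2)%N -> (n - n2 <= wt e b < n)%N -> L ('X_[m] * gm b)) ->
  L p.
Proof.
move=> hs n; have [k] := ubnP n; elim: k n => // k IH n; rewrite ltnS => nk p L hp.
move=> [L0 LD LZ] Lc LX.
have Lsum (T : eqType) (s : seq T) (F : T -> S) :
    (forall t, t \in s -> L (F t)) -> L (\sum_(t <- s) F t).
  by move=> h; rewrite big_seq; apply: (big_ind L).
have [n0|npos] := posnP n.
  move: hp; rewrite n0 leqn0 msize_poly_eq0 => /eqP -> //.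
have [nn2|nn2] := ltnP n n2.
  rewrite (mpolyE p); apply: Lsum => m mp; apply: LZ.
  have mn : (mdeg m < n)%N by apply: leq_trans (msize_mdeg_lt mp) hp.
  rewrite -['X_[m]]mulr1 -gm0; apply: LX; first exact: ltn_trans mn nn2.
  by rewrite wt0 npos andbT leqn0 subn_eq0 ltnW.
have [ga [h [hh ->]]] := hs n p nn2 hp; apply: (LD).
  apply: Lsum => s _; apply: LZ; rewrite -[c s]mulr1 -gm0.
  by apply: Lc; rewrite wt0.
apply: Lsum => i _.
have lt : (n - e i < k)%N.
  by apply: leq_trans nk; rewrite ltn_subrL npos e_gt0.
apply: (IH _ lt (h i) (fun q => L (q * g i))) => //.
- split; first by rewrite mul0r.
    by move=> q q' hq hq'; rewrite mulrDl; apply: LD.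
  by move=> a q hq; rewrite -scalerAl; apply: LZ.
- move=> s b hb; rewrite -mulrA -gmU -gmD; apply: Lc.
  by rewrite wtD wtU; lia.
move=> m b hm hb; rewrite -mulrA -gmU -gmD; apply: LX => //.
by rewrite wtD wtU; lia.
Qed.

(** In [spanning_products] the second kind of generators is a bounded number of
    multiples of the products of the equations with weights in [n - n2, n). *)
Lemma spanning_bound : exists n2 C, forall n, (n2 <= n)%N ->
  (nmon r n <= Q * #|{: wmon e n}| + C * (#|{: wmon e n}| - #|{: wmon e (n - n2)}|))%N.
Proof.
have [n2 hs] := spanned; exists n2, (nmon r n2) => n n2n.
pose T' := {b : wmon e n | (n - n2 <= wt e (val (val b)))%N}.
have card_T' : (#|{: T'}| <= #|{: wmon e n}| - #|{: wmon e (n - n2)}|)%N.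
  suff : (#|{: T' + wmon e (n - n2)}| <= #|{: wmon e n}|)%N.
    rewrite card_sum; move: #|{: T'}| #|{: wmon e n}| #|{: wmon e (n - n2)}|.
    by move=> a b d; lia.
  have wn (b : wmon e (n - n2)) : (wt e (val (val b)) < n)%N.
    by apply: leq_trans (valP b) _; apply: leq_subr.
  have dn (b : wmon e (n - n2)) : (mdeg (val (val b)) < n)%N.
    exact: leq_ltn_trans (mdeg_wt e_gt0 _) (wn b).
  pose F (t : T' + wmon e (n - n2)) : wmon e n := match t with
    | inl b => val b | inr b => exist _ (BMultinom (dn b)) (wn b) end.
  have disj (b : T') (b' : wmon e (n - n2)) : val b = F (inr b') -> False.
    move=> /(congr1 (fun b : wmon e n => wt e (val (val b)))) /= E.
    by have := valP b; rewrite E leqNgt (valP b').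
  apply: (@leq_card _ _ F) => -[b|b] [b'|b'] /=.
  - by move=> /val_inj ->.
  - by move=> E; case: (disj b b').
  - by move=> E; case: (disj b' b).
  move=> /(congr1 (fun b : wmon e n => val (val b))) /= E; congr inr.
  by do 2!apply: val_inj.
pose F (t : 'I_Q * wmon e n + 'X_{1..r < n2} * T') : S := match t with
  | inl (s, b) => c s * gm (val (val b))
  | inr (m, b) => 'X_[val m] * gm (val (val (val b))) end.
have : (nmon r n <= #|{: 'I_Q * wmon e n + 'X_{1..r < n2} * T'}|)%N.
  apply: (@span_dim R r n _ F) => m.
  pose L p := exists ga, p = \sum_t ga t *: F t.
  have LF t : L (F t).
    exists (fun t' => (t' == t)%:R); rewrite (bigD1 t) //= eqxx scale1r big1 ?addr0 //.
    by move=> t' /negbTE ->; rewrite scale0r.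
  apply: (spanning_products hs (n := n) (L := L)).
  - by rewrite msizeX bmdeg.
  - split.
    + by exists (fun=> 0); rewrite big1 // => t _; rewrite scale0r.
    + move=> p q [ga ->] [ga' ->]; exists (fun t => ga t + ga' t).
      by rewrite -big_split; apply: eq_bigr => t _; rewrite scalerDl.
    + move=> a p [ga ->]; exists (fun t => a * ga t).
      by rewrite scaler_sumr; apply: eq_bigr => t _; rewrite scalerA.
  - by move=> s b /(wmonP e_gt0)[b' <-]; apply: (LF (inl (s, b'))).
  move=> m' b hm /andP[h1 /(wmonP e_gt0)[b' bE]]; rewrite -bE in h1 *.
  exact: (LF (inr (BMultinom hm, exist _ b' h1))).
move=> /leq_trans; apply; rewrite card_sum !card_prod card_ord leq_add2l.
by rewrite leq_mul2l card_T' orbT.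
Qed.

End Spanning.

(** By [nmon_le] and [nmon_ge], the number of multi-indices of weight less than n
    is asymptotic to the number of those of degree less than n, divided by the
    product of the e i.  For large n, [independence_bound] excludes that Q is
    larger than this product, and [spanning_bound] that it is smaller. *)
Theorem bezout :
  (forall s k, exists h a : 'I_r -> S, (forall l, ev (a l) (Z s) = 0) /\
    'X_k - (Z s k 0)%:MP = \sum_i h i * g i + \sum_l a l * ('X_l - (Z s l 0)%:MP)) ->
  (forall s i, ev (g i) (Z s) = 0) ->
  (exists n2, forall n p, (n2 <= n)%N -> (msize p <= n)%N ->
    exists (ga : 'I_Q -> R) (h : 'I_r -> S), (forall i, (msize (h i) <= n - e i)%N) /\
      p = \sum_s ga s *: c s + \sum_i h i * g i) ->
  Q = (\prod_i e i)%N.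
Proof.
move=> coordinates gZ spanned.
have [n0 up] := independence_bound coordinates gZ.
have [n2 [C lo]] := spanning_bound spanned.
set D := (\prod_i e i)%N; pose E := (\sum_i e i)%N.
have le := nmon_le e_gt0; have ge := nmon_ge e_gt0; rewrite -/D -/E in le ge.
have [DQ|QD|//] := ltngtP D Q.
  have [n /(_ n (leqnn n))] := nmon_growth r D n0.
  have h1 := up n; have h2 := le n; have h3 := nmon_leq r (leq_addr n0 n).
  move: (nmon r n) (nmon r (n + n0)) #|{: wmon e n}| h1 h2 h3 => a b w h1 h2 h3.
  rewrite ltnNge => /negP []; nia.
have [m /(_ m (leqnn m))] := nmon_growth r (Q + C) (n2 + E).
have h1 := lo (m + n2)%N (leq_addl _ _); rewrite addnK in h1.
have h2 := ge (m + n2)%N; have h3 := le m; have h4 := nmon_leq r (leq_addr n2 m).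
have h5 := nmon_leq r (leq_addr E (m + n2)%N); rewrite addnA.
move: (nmon r m) (nmon r (m + n2)) (nmon r (m + n2 + E)) h1 h2 h3 h4 h5 => a b d.
move: #|{: wmon e m}| #|{: wmon e (m + n2)}| => w w' h1 h2 h3 h4 h5.
rewrite ltnNge => /negP []; nia.
Qed.

End Bezout.

(** * Group elements without fixed vectors *)

Section FixedPointFree.
Variables (R : realType) (r : nat) (Phi : {fset 'cV[R]_r}).
Variables (Delta lambda : 'I_r -> 'cV[R]_r) (G : seq 'M[R]_r).
Variables (f : r.-tuple {mpoly R[r]}) (e : 'I_r -> nat).
Hypothesis (Phi_root : crystallographic_root_system Phi).
Hypothesis (Delta_simple : simple_roots Phi Delta).
Hypothesis (lambda_weights : fundamental_weights Delta lambda).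
Hypothesis (G_group : orth_group G).
Hypothesis (G_par : forall w, w \in G <-> par Delta [set: 'I_r] w).
Notation V := 'cV[R]_r.
Notation S := {mpoly R[r]}.
Notation act := (@Exponents.mpoly_act R r).
Hypothesis f_hom : forall i, tnth f i \is (e i).+1.-homog.
Hypothesis f_inv : forall i w, w \in G -> act w (tnth f i) = tnth f i.
Hypothesis f_free : forall p : S, p \mPo f = 0 -> p = 0.
Hypothesis f_gen : forall q : S, (forall w, w \in G -> act w q = q) ->
  exists p : S, q = p \mPo f.
Implicit Types (v x y z mu nu : V) (w u : 'M[R]_r).

Lemma lf_coef mu k : (lf mu)@_U_(k)%MM = mu k 0.
Proof.
rewrite /lf raddf_sum /= (bigD1 k) //= mul_mpolyC mcoeffZ mcoeffXU eqxx mulr1.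
rewrite big1 ?addr0 // => i /negbTE ik.
by rewrite mul_mpolyC mcoeffZ mcoeffXU ik mulr0.
Qed.

Lemma homog1_lf (p : S) : p \is 1.-homog -> p = lf (\col_k p@_U_(k)%MM).
Proof.
move=> hp; have hl mu : lf mu \is 1.-homog.
  apply: rpred_sum => i _; rewrite mul_mpolyC dhomogZ // dhomogX /=.
  by rewrite mdeg1.
apply/mpolyP => m; have [/mdeg1P[k /eqP ->]|m1] := boolP (mdeg m == 1%N).
  by rewrite lf_coef mxE.
by rewrite (dhomog_nemf_coeff hp m1) (dhomog_nemf_coeff (hl _) m1).
Qed.

(** The roots span, so there is no nonzero invariant linear form. *)
Lemma exponent_gt0 i : (0 < e i)%N.
Proof.
rewrite lt0n; apply/eqP => e0.
have := f_hom i; rewrite e0 => /homog1_lf; set mu := \col_k _ => fE.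
have mu0 : mu = 0.
  apply: (Delta_orth0 Phi_root Delta_simple lambda_weights) => j.
  have sG : sr Delta j \in G by apply/G_par/par_srT.
  have : sr Delta j *m mu = mu.
    apply/colP => k; rewrite -!lf_coef; congr (_@__).
    by rewrite -[in RHS]fE -(f_inv i sG) fE act_lf sr_tr.
  rewrite sr_mul => /eqP; rewrite -subr_eq0 addrAC subrr add0r oppr_eq0.
  rewrite scaler_eq0 (negbTE (Delta_neq0 Phi_root Delta_simple j)) orbF => /eqP p0.
  by apply/eqP; rewrite -(pairing_eq0 Phi_root Delta_simple) p0.
have X0 : 'X_i = 0 :> S.
  by apply: f_free; rewrite comp_mpolyXU -tnth_nth fE mu0 lf0.
have := mcoeffXU R i i; rewrite X0 mcoeff0 eqxx => /eqP.
by rewrite eq_sym oner_eq0.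
Qed.

Definition fixfree w := `[< forall x : V, w *m x = x -> x = 0 >].

Lemma nfull_fixfree : nfull Delta G [set: 'I_r] = size [seq w <- G | fixfree w].
Proof.
rewrite /nfull size_filter; apply: eq_in_count => w /G_par pw.
apply/asboolP/asboolP => [[_ h] x /h x0|h].
  apply: (Delta_orth0 Phi_root Delta_simple lambda_weights) => j.
  by rewrite x0 ?finset.in_setT.
by split=> // x /h -> j _; rewrite dot0l.
Qed.

Let Om := [seq w *m lambda i | w <- G, i <- enum 'I_r].
Let orb mu := undup [seq w *m mu | w <- G].

Lemma mem_orb mu nu : reflect (exists2 w, w \in G & nu = w *m mu) (nu \in orb mu).
Proof. by rewrite mem_undup; apply: (iffP mapP). Qed.

Lemma lambda_neq0 i : lambda i != 0.
Proof.
apply/eqP => l0; have := lambda_weights i i.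
by rewrite l0 /pairing dot0l mulr0 mul0r eqxx => /eqP; rewrite eq_sym oner_eq0.
Qed.

Lemma orbit_separates x : x != 0 -> exists2 mu, mu \in Om &
  forall nu, nu \in orb mu -> nu != mu -> dot (mu - nu) x != 0.
Proof.
move=> x0; have [i [u [/G_par uG hu]]] := orbit_separation Phi_root Delta_simple
  lambda_weights G_group G_par x0.
exists (u *m lambda i); first by apply/allpairsP; exists (u, i); rewrite mem_enum.
move=> _ /mem_orb[w wG ->]; rewrite mulmxA; apply: hu.
by apply/G_par; apply: og_mul.
Qed.

(** If w z = z + v, then v is orthogonal to all vectors fixed by w; if moreover
    w has no fixed vectors and u fixes z, then (u - 1) (w - 1)^-1 kills v.  So it
    is enough that v is not orthogonal to one fixed vector of each w that has
    some, nor to the nonzero rows of these matrices. *)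
Lemma good_displacement : exists v, [/\ forall mu, mu \in Om -> dot mu v != 0,
   forall w z, w \in G -> w *m z = z + v -> fixfree w &
   forall w z u, w \in G -> w *m z = z + v -> u \in G -> u *m z = z -> u = 1%:M].
Proof.
have /choice[fx hfx] : forall w, exists x : V, (exists y : V, y != 0 /\ w *m y = y) ->
    x != 0 /\ w *m x = x.
  move=> w; have [[y hy]|h] := pselect (exists y : V, y != 0 /\ w *m y = y).
    by exists y.
  by exists 0.
pose N w u : 'M[R]_r := (u - 1%:M) *m invmx (w - 1%:M).
pose L := Om ++ [seq fx w | w <- G] ++
  flatten [seq [seq (row k (N wu.1 wu.2))^T | k <- enum 'I_r] |
            wu <- [seq (w, u) | w <- G, u <- G]].
have [v hv] := generic_vector L; exists v.
have ff w z : w \in G -> w *m z = z + v -> fixfree w.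
  move=> wG wz; apply/asboolP => x wx; apply/eqP/negPn/negP => x0.
  have [f0 fw] : fx w != 0 /\ w *m fx w = fx w by apply: hfx; exists x.
  have : dot (fx w) v != 0.
    by apply: hv f0; rewrite !mem_cat (map_f fx wG) orbT.
  have -> : v = w *m z - z by rewrite wz addrC addKr.
  rewrite dotBr -{1}fw dot_orth ?subrr ?eqxx //.
  exact: og_trK wG.
split=> //.
  move=> mu muO; apply: hv; first by rewrite mem_cat muO.
  case/allpairsP: muO => -[w i] /= [wG _ ->].
  apply: contra (lambda_neq0 i) => /eqP E.
  by rewrite -[lambda i](og_trKl _ G_group wG) E mulmx0.
move=> w z u wG wz uG uz; have /asboolP wf := ff w z wG wz.
have Wu : w - 1%:M \in unitmx.
  rewrite -unitmx_tr -row_free_unit -kermx_eq0; apply/rowV0P => y /sub_kermxP yw.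
  have : (w - 1%:M) *m y^T = 0 by rewrite -[w - _]trmxK -trmx_mul yw trmx0.
  rewrite mulmxBl mul1mx => /eqP; rewrite subr_eq0 => /eqP E.
  by apply: trmx_inj; rewrite trmx0; apply: wf.
have zE : z = invmx (w - 1%:M) *m v.
  have <- : (w - 1%:M) *m z = v by rewrite mulmxBl mul1mx wz addrC addKr.
  by rewrite mulmxA mulVmx // mul1mx.
have Nv : N w u *m v = 0 by rewrite -mulmxA -zE mulmxBl mul1mx uz subrr.
have N0 : N w u = 0.
  apply/row_matrixP => k; rewrite row0; apply/eqP/negPn/negP => rk.
  have : dot (row k (N w u))^T v != 0.
    apply: hv; last by apply: contra rk => /eqP E; rewrite -[row _ _]trmxK E trmx0.
    rewrite !mem_cat; apply/orP; right; apply/orP; right.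
    apply/flatten_mapP; exists (w, u); first by apply/allpairsP; exists (w, u).
    by apply/mapP; exists k; rewrite ?mem_enum.
  by rewrite dotE trmxK -row_mul Nv row0 mxE eqxx.
move: N0 => /(congr1 (mulmx^~ (w - 1%:M))); rewrite mul0mx -mulmxA mulVmx // mulmx1.
by move/eqP; rewrite subr_eq0 => /eqP.
Qed.

(** Both numbers count the solutions of the equations f i (y + v) = f i y, the
    second one by Bezout's theorem. *)
Theorem count_fixfree : size [seq w <- G | fixfree w] = (\prod_i e i)%N.
Proof.
have [v [vO vfree vreg]] := good_displacement.
pose g1 := g1 f v; pose F := [seq w <- G | fixfree w].
have hI := gen_ideal g1.
have FG w : w \in F -> w \in G by rewrite mem_filter => /andP[].
have Wu w : w \in F -> w - 1%:M \in unitmx.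
  rewrite mem_filter => /andP[/asboolP wf _].
  rewrite -unitmx_tr -row_free_unit -kermx_eq0; apply/rowV0P => y /sub_kermxP yw.
  have : (w - 1%:M) *m y^T = 0 by rewrite -[w - _]trmxK -trmx_mul yw trmx0.
  rewrite mulmxBl mul1mx => /eqP; rewrite subr_eq0 => /eqP E.
  by apply: trmx_inj; rewrite trmx0; apply: wf.
pose sol w : V := invmx (w - 1%:M) *m v.
have solE w : w \in F -> w *m sol w = sol w + v.
  move=> wF; have : (w - 1%:M) *m sol w = v by rewrite mulmxA mulmxV ?Wu // mul1mx.
  by rewrite mulmxBl mul1mx => <-; rewrite addrC subrK.
pose Zl := [seq sol w | w <- F].
have Zuniq : uniq Zl.
  rewrite map_inj_in_uniq ?filter_uniq ?(og_uniq G_group) // => w w' wF w'F E.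
  have wG := FG _ wF; have w'G := FG _ w'F.
  have E2 : w' *m sol w = w *m sol w by rewrite solE // E solE.
  have : w^T *m w' = 1%:M.
    apply: (vreg w (sol w)) => //; first exact: solE.
      by apply: og_mul => //; apply: og_tr.
    by rewrite -mulmxA E2 (og_trKl _ G_group wG).
  by move=> /(congr1 (mulmx w)); rewrite (og_trVl _ G_group wG) mulmx1.
have Zin z : z \in Zl -> exists w, [/\ w \in G, w *m z = z + v,
    forall x, w *m x = x -> x = 0 & forall u, u \in G -> u *m z = z -> u = 1%:M].
  move=> /mapP[w wF ->]; have wG := FG _ wF; exists w; split=> //.
  - exact: solE.
  - by move: wF; rewrite mem_filter => /andP[/asboolP].
  - by move=> u; apply: (vreg w) => //; apply: solE.
have Zall z w : w \in G -> w *m z = z + v -> z \in Zl.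
  move=> wG wz; have wF : w \in F by rewrite mem_filter (vfree w z).
  apply/mapP; exists w => //; rewrite /sol.
  have <- : (w - 1%:M) *m z = v by rewrite mulmxBl mul1mx wz addrC addKr.
  by rewrite mulmxA mulVmx ?Wu // mul1mx.
have orbG mu w nu : w \in G -> nu \in orb mu -> w *m nu \in orb mu.
  move=> wG /mem_orb[u uG ->]; apply/mem_orb; exists (w *m u); last by rewrite mulmxA.
  exact: og_mul.
have muorb mu : mu \in orb mu.
  by apply/mem_orb; exists 1%:M; rewrite ?mul1mx ?(og_1 G_group).
have rel mu : mu \in Om -> _ := fun h => orbit_relation_ev G_group f_gen
  (undup_uniq _) (orbG mu) (muorb mu) (vO mu h).
have [pts0 [z0 hp0]] := @orbit_points R r Om orb (fun=> 0) (gen (g0 f v)) [::]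
  (gen_ideal _) (fun _ h => match notF h with end) (fun mu h => (rel mu h).1)
  (fun x (x0 : x != 0) _ => @orbit_separates x x0).
have [pts1 [_ hp1]] := @orbit_points R r Om orb (fun mu => dot mu v) (gen g1) [::]
  hI (fun _ h => match notF h with end) (fun mu h => (rel mu h).2)
  (fun x (x0 : x != 0) _ => @orbit_separates x x0).
have top : exists M, forall s : seq S, size s = M ->
    (forall p, p \in s -> ev p 0 = 0) -> gen (g0 f v) (\prod_(p <- s) p).
  exists (size pts0) => s sz sv; apply: hp0; move: (z0 (fun=> erefl)) sz sv.
  rewrite /vanish_on; elim: s (pts0) => [|p s IH] [|x pts] //= zx [sz] sv.
  rewrite (zx x) ?mem_head // sv ?mem_head // eqxx; apply: IH => // [y yp|q qs].
    by apply: zx; rewrite inE yp orbT.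
  by apply: sv; rewrite inE qs orbT.
pose Q := size F; pose Z (s : 'I_Q) : V := nth 0 Zl s.
have szZ : size Zl = Q by rewrite size_map.
have ZZ s : Z s \in Zl by apply: mem_nth; rewrite szZ.
have /choice[c hc] : forall s : 'I_Q, exists p : S, ev p (Z s) = 1 /\
    forall x, x \in rem (Z s) Zl -> ev p x = 0.
  by move=> s; apply: interpolation; rewrite mem_rem_uniq // inE eqxx.
have cZ s t : ev (c s) (Z t) = (s == t)%:R.
  have [<-|st] := eqVneq s t; first by rewrite (hc s).1.
  apply: (hc s).2; rewrite mem_rem_uniq // inE ZZ andbT /= /Z.
  by rewrite nth_uniq ?szZ // eq_sym.
have g_size i : (msize (g1 i) <= (e i).+1)%N by apply: msize_g1.
apply: (bezout exponent_gt0 g_size cZ).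
- move=> s k; have [w [wG wz wf wr]] := Zin _ (ZZ s).
  have [_ [[h ->] [a [a0 E]]]] := cotangent G_group f_gen k wG wz wf wr.
  exists h, a; split=> //; move/eqP: E; rewrite subr_eq => /eqP ->.
  by rewrite addrC.
- move=> s i; have [w [wG wz _ _]] := Zin _ (ZZ s).
  by rewrite /g1 /g1 evB ev_tr -wz -ev_act f_inv // subrr.
have [n1 red] := reduce_degree f_hom top.
have interp p : gen g1 (p - \sum_s (ev p (Z s)) *: c s).
  apply: (vanishing_ideal G_group f_gen Zin Zall hp1) => z zZ.
  have [s ->] : exists s, z = Z s.
    have iz : (index z Zl < Q)%N by rewrite -szZ index_mem.
    by exists (Ordinal iz); rewrite /Z /= nth_index.
  rewrite evB ev_sum (bigD1 s) //= -mul_mpolyC evM evC cZ eqxx mulr1 big1 ?addr0.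
    by rewrite subrr.
  by move=> t ts; rewrite -mul_mpolyC evM evC cZ (negbTE ts) mulr0.
have /choice[h hh] : forall m : 'X_{1..r < n1}, exists h : 'I_r -> S,
    'X_[val m] - \sum_s (ev 'X_[val m] (Z s)) *: c s = \sum_i h i * g1 i.
  by move=> m; apply: interp.
(* The finitely many monomials that remain after lowering the degree have to fit
   with their quotients into degree n. *)
pose n2 := (\max_m \max_i (msize (h m i) + e i))%N.
exists n2 => n p n2n hp.
pose B p := exists (ga : 'I_Q -> R) (h : 'I_r -> S),
  (forall i, (msize (h i) <= n - e i)%N) /\ p = \sum_s ga s *: c s + \sum_i h i * g1 i.
have BD p1 p2 : B p1 -> B p2 -> B (p1 + p2).
  move=> [ga1 [h1 [b1 ->]]] [ga2 [h2 [b2 ->]]].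
  exists (fun s => ga1 s + ga2 s), (fun i => h1 i + h2 i); split=> [i|].
    exact: msizeD.
  under [X in _ = X + _]eq_bigr do rewrite scalerDl.
  under [X in _ = _ + X]eq_bigr do rewrite mulrDl.
  by rewrite !big_split /= addrACA.
have BZ a p1 : B p1 -> B (a *: p1).
  move=> [ga1 [h1 [b1 ->]]]; exists (fun s => a * ga1 s), (fun i => a *: h1 i).
  split=> [i|]; first exact: msizeZle.
  under [X in _ = X + _]eq_bigr do rewrite -scalerA.
  under [X in _ = _ + X]eq_bigr do rewrite -scalerAl.
  by rewrite -!scaler_sumr scalerDr.
have B0 : B 0.
  exists (fun=> 0), (fun=> 0); split=> [i|]; first by rewrite msize0.
  by rewrite !big1 ?addr0 // => i _; rewrite ?scale0r ?mul0r.
have [h1 [b1 s1]] := red n p hp.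
rewrite -[p](subrK (\sum_i h1 i * g1 i)); apply: (BD).
  rewrite [p - _]mpolyE big_seq; apply: (big_ind B) => // m mp; apply: BZ.
  have mn : (mdeg m < n1)%N by apply: leq_trans (msize_mdeg_lt mp) s1.
  pose bm := BMultinom mn.
  exists (fun s => ev 'X_[m] (Z s)), (h bm); split=> [i|]; last first.
    by rewrite -(hh bm) addrC subrK.
  have : (msize (h bm i) + e i <= n)%N.
    apply: leq_trans n2n; apply: leq_trans (leq_bigmax bm).
    exact: (leq_bigmax (F := fun i => msize (h bm i) + e i)%N).
  by move: (msize _) => a; lia.
exists (fun=> 0), h1; split=> //.
by rewrite [X in _ = X + _]big1 ?add0r // => s _; rewrite scale0r.
Qed.

End FixedPointFree.

(** * The identity *)

Theorem proposition1p7 (R : realType) (r : nat) (Phi : {fset 'cV[R]_r})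
    (Delta lambda : 'I_r -> 'cV[R]_r) (e : 'I_r -> nat)
    (Phi_root : crystallographic_root_system Phi)
    (Delta_simple : simple_roots Phi Delta)
    (lambda_weights : fundamental_weights Delta lambda)
    (e_exponents : exponents Phi e) :
  \sum_(w \in weyl_group Phi)
     \prod_(i < r) (1 - tofrac (weight_exp Delta (w *m lambda i)))^-1
  = (\prod_(i < r) e i)%:R :> {fraction (weight_algebra r)}.
Proof.
have [G [G_group G_par]] := weyl_list Phi_root Delta_simple lambda_weights.
have GW w : w \in G <-> weyl_group Phi w.
  rewrite G_par; have [h h'] := weyl_par Phi_root Delta_simple lambda_weights w.
  by split.
have -> : weyl_group Phi = [set` G]%classic by apply/seteqP; split=> w /GW.
case: e_exponents => f [f_hom f_inv f_free f_gen].
rewrite -fsbig_seq ?(og_uniq G_group) //.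
rewrite (chamber_sum Phi_root Delta_simple lambda_weights G_group G_par).
rewrite (nfull_fixfree Phi_root Delta_simple lambda_weights G_par).
rewrite (count_fixfree Phi_root Delta_simple lambda_weights G_group G_par f_hom) //.
- by move=> i w /GW; apply: f_inv.
- by move=> q q_inv; apply: f_gen => w /GW; apply: q_inv.
Qed.
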